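(* Suppose $\mathcal{K}$ is a Borel class of countable structures closed under isomorphism, and let $E_{\infty\mathcal{K}}$ be the universal $\mathcal{K}$-structurable equivalence relation, on the space $Y_{\infty\mathcal{K}}$. Then: (1) If $\mu$ is a Borel probability measure on $Y_{\infty\mathcal{K}}$, there is a $\mu$-null Borel set $A$ so that $E_{\infty\mathcal{K}} \sqsubseteq^i_B E_{\infty\mathcal{K}}\restriction A$. (2) If the class of $\mathcal{K}$-structurable countable Borel equivalence relations is closed under binary independent joins, then there is a Borel cardinality preserving $\sigma$-complete ultrafilter on the quotient space of $E_{\infty\mathcal{K}}$, and hence $E_{\infty\mathcal{K}}$ is not a smooth disjoint union of equivalence relations of smaller Borel cardinality. (3) If the class of $\mathcal{K}$-structurable countable Borel equivalence relations is closed under countable independent joins, then whenever $\{A_i\}_{i\in\omega}$ is a Borel partition of $Y_{\infty\mathcal{K}}$ into countably many sets, there exists some $A_i$ such that $E_{\infty\mathcal{K}}\sqsubseteq_B E_{\infty\mathcal{K}}\restriction A_i$. It follows that for all countable Borel equivalence relations $F$, $E_{\infty\mathcal{K}}\leq_B F$ implies $E_{\infty\mathcal{K}}\sqsubseteq_B F$.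
   Context: A countable Borel equivalence relation is a Borel equivalence relation on a standard Borel space all of whose classes are countable. A Borel reduction from $E$ to $F$ is a Borel $f$ with $x\mathrel{E}y\iff f(x)\mathrel{F}f(y)$; $E\leq_B F$ means one exists, $E\sim_B F$ means $E\leq_B F\leq_B E$, and $E$ has smaller Borel cardinality than $F$ if $E\leq_B F$ and $F\nleq_B E$. $E\sqsubseteq_B F$ means there is an injective Borel reduction from $E$ to $F$, and $E\sqsubseteq_B^i F$ means there is an injective Borel reduction whose range is $F$-invariant. Let $L=\{R_i\}$ be a countable relational language and $X_L$ the standard Borel space of $L$-structures whose universe is some $I\leq\omega$. Here $\mathcal{K}\subseteq X_L$ is Borel and closed under isomorphism. A countable Borel equivalence relation $E$ on $X$ is $\mathcal{K}$-structurable if there are Borel relations $Q_i$ on $X$, with $Q_i$ of the same arity as $R_i$, such that for each $E$-class $C$ the structure with universe $C$ and relations $Q_i\restriction C$ is isomorphic to a structure in $\mathcal{K}$. The universal $\mathcal{K}$-structurable equivalence relation $E_{\infty\mathcal{K}}$ is a $\mathcal{K}$-structurable countable Borel equivalence relation such that $E\sqsubseteq_B^i E_{\infty\mathcal{K}}$ for every $\mathcal{K}$-structurable countable Borel equivalence relation $E$ (it is known to exist, and is unique up to Borel isomorphism). A collection $\{E_i\}_{i\in I}$, $I\leq\omega$, of at least two equivalence relations on $X$ is independent if there do not exist a sequence $x_0,\ldots,x_n$ of distinct elements of $X$ and indices $i_0,\ldots,i_n\in I$ with $n\geq 2$ such that $i_j\neq i_{j+1}$ for $j<n$ and $x_0\mathrel{E_{i_0}}x_1\mathrel{E_{i_1}}x_2\cdots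 x_n\mathrel{E_{i_n}}x_0$. The join $\bigvee_{i}E_i$ is the smallest equivalence relation containing all $E_i$. The class of $\mathcal{K}$-structurable countable Borel equivalence relations is closed under binary (resp. countable) independent joins if whenever two (resp. countably many) $\mathcal{K}$-structurable countable Borel equivalence relations on the same standard Borel space are independent, their join is $\mathcal{K}$-structurable. For a countable Borel equivalence relation $E$ on $X$, a $\sigma$-complete ultrafilter on the quotient space of $E$ is a maximal filter $U$ on the $\sigma$-algebra of $E$-invariant Borel subsets of $X$ that is closed under countable intersections; it preserves the Borel cardinality of $E$ if $E\sim_B E\restriction A$ for all $A\in U$. $E$ is a smooth disjoint union of equivalence relations of smaller Borel cardinality if there is a Borel $f\colon X\to 2^\omega$, constant on $E$-classes, such that for each $c\in 2^\omega$ the relation $E\restriction f^{-1}(c)$ has smaller Borel cardinality than $E$.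
   Formalization: Part (2) additionally assumes that some structure in K has at least two elements: if K is all one-element structures, the universal relation is equality on an uncountable space and (2) fails. The empty standard Borel space is excluded. *)

(* Defs.v *)
From HB Require Import structures.
From mathcomp Require Import all_boot all_order all_algebra.
From mathcomp Require Import all_classical all_reals all_analysis.

Set Implicit Arguments.
Unset Strict Implicit.
Unset Printing Implicit Defensive.

Local Open Scope classical_set_scope.

(* A measurable space is standard Borel when it is isomorphic to a separable
   complete metric space with its Borel sigma-algebra.  (A measurableType is
   nonempty by construction, so the empty standard Borel space is excluded.) *)
Definition standard_borel (R : realType) d (X : measurableType d) : Prop :=
  exists P : metricType R,
    [/\ forall F : set_system P, ProperFilter F -> cauchy F ->
          exists p : P, F --> p,
        @second_countable P &
        exists h : X -> P, bijective h /\
          forall B : set P, measurable (h @^-1` B) <-> <<s @open P >> B].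

Definition borel_2omega := g_sigma_algebraType (@open cantor_space).

Definition cber d (X : measurableType d) (E : X -> X -> Prop) : Prop :=
  [/\ RelationClasses.Equivalence E,
      measurable [set p : X * X | E p.1 p.2] &
      forall x, countable [set y | E x y]].

(* The restriction of E to a Borel set A is represented by
    the pair (A, E): a map from E|A to F|B is a function that is measurable on A
    and sends A into B; its values outside A are irrelevant. *)
Definition borel_reduction d d' (X : measurableType d) (Y : measurableType d')
    (A : set X) (E : X -> X -> Prop) (B : set Y) (F : Y -> Y -> Prop)
    (f : X -> Y) : Prop :=
  [/\ measurable_fun A f, set_fun A B f &
      forall x y, A x -> A y -> (E x y <-> F (f x) (f y))].

Definition borel_reducible d d' (X : measurableType d) (Y : measurableType d')
    (A : set X) (E : X -> X -> Prop) (B : set Y) (F : Y -> Y -> Prop) : Prop :=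
  exists f : X -> Y, borel_reduction A E B F f.

Definition borel_bireducible d d' (X : measurableType d)
    (Y : measurableType d')
    (A : set X) (E : X -> X -> Prop) (B : set Y) (F : Y -> Y -> Prop) : Prop :=
  borel_reducible A E B F /\ borel_reducible B F A E.

Definition smaller_borel_card d d' (X : measurableType d)
    (Y : measurableType d')
    (A : set X) (E : X -> X -> Prop) (B : set Y) (F : Y -> Y -> Prop) : Prop :=
  borel_reducible A E B F /\ ~ borel_reducible B F A E.

Definition borel_embeds d d' (X : measurableType d) (Y : measurableType d')
    (A : set X) (E : X -> X -> Prop) (B : set Y) (F : Y -> Y -> Prop) : Prop :=
  exists f : X -> Y, borel_reduction A E B F f /\ set_inj A f.

Definition borel_invariantly_embeds d d' (X : measurableType d)
    (Y : measurableType d')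
    (A : set X) (E : X -> X -> Prop) (B : set Y) (F : Y -> Y -> Prop) : Prop :=
  exists f : X -> Y, [/\ borel_reduction A E B F f, set_inj A f &
    forall y z, (f @` A) y -> B z -> F y z -> (f @` A) z].

Record language := Language {
  symbol :> countType;
  arity : symbol -> nat }.

(* The subsets I of nat with I <= omega as von Neumann ordinals *)
Definition le_omega (I : set nat) : Prop :=
  forall m n, (m <= n)%N -> I n -> I m.

Record Lstructure (L : language) := LStructure {
  universe : set nat;
  universe_le_omega : le_omega universe;
  interp : forall i : L, set ((arity i).-tuple nat);
  interp_universe : forall (i : L) t, interp t ->
    forall j, universe (tnth (t : (arity i).-tuple nat) j) }.

(* The Borel structure of X_L is the one it inherits from the Cantor space of
   all pairs (universe, interpretations): it is generated by the subbasic
   clopen conditions "k is in the universe" and "R_i(t) holds". *)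
Definition subbasic_Lstructures (L : language) : set (set (Lstructure L)) :=
  [set S | (exists k, S = [set M | universe M k]) \/
           (exists i (t : (arity i).-tuple nat), S = [set M | interp M t])].

Definition borel_class (L : language) (K : set (Lstructure L)) : Prop :=
  <<s @subbasic_Lstructures L >> K.

Definition isomorphic (L : language) (T U : Type)
    (A : set T) (Q : forall i : L, set ((arity i).-tuple T))
    (B : set U) (P : forall i : L, set ((arity i).-tuple U)) : Prop :=
  exists f : T -> U, set_bij A B f /\
    forall (i : L) (t : (arity i).-tuple T), (forall j, A (tnth t j)) ->
      (Q i t <-> P i (map_tuple f t)).

Definition iso_closed (L : language) (K : set (Lstructure L)) : Prop :=
  forall M N : Lstructure L,
    isomorphic (universe M) (@interp L M) (universe N) (@interp L N) ->
    K M -> K N.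

(* If the nonempty structures in K are all singletons, then the universal
   K-structurable equivalence relation is equality on an uncountable standard
   Borel space.  Any sigma-complete ultrafilter is then principal, so none
   preserves Borel cardinality, although this class is closed under independent
   joins. *)
Definition has_nontrivial_structure (L : language) (K : set (Lstructure L))
    : Prop :=
  exists2 M, K M & exists a b : nat, [/\ universe M a, universe M b & a <> b].

Definition structurable (L : language) (K : set (Lstructure L))
    d (X : measurableType d) (E : X -> X -> Prop) : Prop :=
  cber E /\
  exists Q : forall i : L, set ((arity i).-tuple X),
    (forall i, measurable (Q i)) /\
    forall x, exists2 M, K M &
      isomorphic [set y | E x y] Q (universe M) (@interp L M).

Definition universal_structurable (R : realType) (L : language)
    (K : set (Lstructure L))
    d (Y : measurableType d) (E : Y -> Y -> Prop) : Prop :=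
  structurable K E /\
  forall d' (X : measurableType d') (F : X -> X -> Prop),
    standard_borel R X -> structurable K F ->
    borel_invariantly_embeds setT F setT E.

(* Only x 0, ..., x n and k 0, ..., k n are relevant. *)
Definition independent (X : Type) (I : set nat) (E : nat -> X -> X -> Prop)
    : Prop :=
  ~ exists (n : nat) (x : nat -> X) (k : nat -> nat),
      [/\ (2 <= n)%N,
          set_inj [set j | (j <= n)%N] x,
          forall j, (j <= n)%N -> I (k j),
          forall j, (j < n)%N -> k j <> k j.+1 &
          (forall j, (j < n)%N -> E (k j) (x j) (x j.+1)) /\
          E (k n) (x n) (x 0%N)].

Definition join (X : Type) (I : set nat) (E : nat -> X -> X -> Prop)
    (x y : X) : Prop :=
  forall F : X -> X -> Prop, RelationClasses.Equivalence F ->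
    (forall i, I i -> forall u v, E i u v -> F u v) -> F x y.

Definition closed_under_independent_joins (R : realType) (L : language)
    (K : set (Lstructure L)) (I : set nat) : Prop :=
  forall d (X : measurableType d) (E : nat -> X -> X -> Prop),
    standard_borel R X ->
    (forall i, I i -> structurable K (E i)) ->
    independent I E -> structurable K (join I E).

Definition closed_under_binary_independent_joins (R : realType)
    (L : language) (K : set (Lstructure L)) : Prop :=
  closed_under_independent_joins R K `I_2.

(* I ranges over the ordinals 2 <= I <= omega. *)
Definition closed_under_countable_independent_joins (R : realType)
    (L : language) (K : set (Lstructure L)) : Prop :=
  forall I : set nat, le_omega I -> I 1%N ->
    closed_under_independent_joins R K I.

Definition invariant_borel d (X : measurableType d) (E : X -> X -> Prop)
    : set (set X) :=
  [set A | measurable A /\ forall x y, E x y -> A x -> A y].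

Definition quotient_filter d (X : measurableType d) (E : X -> X -> Prop)
    (U : set (set X)) : Prop :=
  [/\ U `<=` invariant_borel E,
      U setT,
      ~ U set0,
      forall A B, U A -> U B -> U (A `&` B) &
      forall A B, U A -> invariant_borel E B -> A `<=` B -> U B].

Definition sigma_complete_ultrafilter d (X : measurableType d)
    (E : X -> X -> Prop) (U : set (set X)) : Prop :=
  [/\ quotient_filter E U,
      forall V, quotient_filter E V -> U `<=` V -> V = U &
      forall A : nat -> set X, (forall n, U (A n)) -> U (\bigcap_n A n)].

Definition preserves_borel_card d (X : measurableType d)
    (E : X -> X -> Prop) (U : set (set X)) : Prop :=
  forall A, U A -> borel_bireducible setT E A E.

Definition smooth_disjoint_union_of_smaller d (X : measurableType d)
    (E : X -> X -> Prop) : Prop :=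
  exists f : X -> borel_2omega,
    [/\ measurable_fun setT f,
        forall x y, E x y -> f x = f y &
        forall c, smaller_borel_card (f @^-1` [set c]) E setT E].

(* Main.v *)
(* Part 1: E times equality on 2^omega is K-structurable, so it embeds into E.
   The images of the slices Y x {a} are pairwise disjoint, and halving measures
   bit by bit yields an a whose slice has a null image.

   Parts 2 and 3: let J be the join of I-many independent copies of E on the
   space of labelled trees below.  Closure under joins and universality embed J
   into E.  Given a cover (A_i) of the space by Borel sets, play for each i a game
   in which a player builds a labelled tree; the opponent writes the labels that
   belong to direction i.  If the opponent won each game i for A_i, playing all the
   winning strategies against each other would give a tree outside every A_i, so
   by Borel determinacy the player wins some game i.  Running this strategy
   simultaneously at all points of an E-class, the labels in direction i being
   copied from the runs at the neighbouring points, embeds E into the restriction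
   of J to A_i.  Trees violating independence are distributed over the directions
   by orienting them towards canonical cycles; no class in a single direction i lies
   within the part of i, so winning runs assembled along a class are free.

   For part 3, apply this to the preimages of the partition with I = nat.  For
   part 2, take two directions: an invariant set is large when the player wins its
   game.  Playing countably many strategies at different points of one infinite
   class shows that countably many large sets meet. *)
Require Import Defs.
From HB Require Import structures.
From mathcomp Require Import all_boot all_order all_algebra.
From mathcomp Require Import all_classical all_reals all_analysis.
From mathcomp Require Import zify lra.

Set Implicit Arguments.
Unset Strict Implicit.
Unset Printing Implicit Defensive.

Local Open Scope classical_set_scope.

(** The payoff sets combine freeness, orientation towards cycles and preimages of arbitrary Borel
    sets, so their Borel rank is unbounded and full Borel determinacy is proved, by Martin's
    unravelling. Moves are integers whereas points of [Y] are reals: one position is spelled out by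
    a label and the others in its class are computed from it. Hence a class must be traversed by
    countably many Borel maps [g m], which come from a Lusin-Novikov theorem. Copying labels along a
    class sends equivalent points to joined trees; the obstacle is the converse, as a strategy might
    reproduce foreign labels and so join trees of inequivalent points. Labels therefore also contain
    numbers too large for the strategy to imitate. The slots are ordered so that a copied entry is
    always written already and no entry of larger index precedes such a number. Freeness is no rule
    of the game, since whether two vertices coincide depends on infinitely many moves of both sides;
    it has to enter through the payoff. In part 3 a reduction becomes injective because its domain
    splits into countably many Borel pieces on which it is injective, and [E] embeds into its
    restriction to one of them. *)

(** * Borel determinacy *)

(* Positions of length n are moved from by player [odd n]; there are no leaves,
   so that plays are infinite branches. *)
Record game_tree := GameTree {
  pos :> Type;
  sz : pos -> nat;
  par : pos -> pos;
  root : pos;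
  sz_root : sz root = 0%N;
  root_uniq : forall p, sz p = 0%N -> p = root;
  par_root : par root = root;
  sz_par : forall p, sz (par p) = (sz p).-1;
  kid_ex : forall p, exists q, sz q = (sz p).+1 /\ par q = p }.

Definition kid (T : game_tree) (q p : T) := sz q = (sz p).+1 /\ par q = p.
Definition play (T : game_tree) (x : nat -> T) :=
  forall n, sz (x n) = n /\ par (x n.+1) = x n.
Definition strat (T : game_tree) (s : T -> T) := forall p, kid (s p) p.
Definition follows (T : game_tree) (b : bool) (s : T -> T) (x : nat -> T) :=
  forall n, odd n = b -> x n.+1 = s (x n).
Definition anc (T : game_tree) (p : T) (j : nat) : T := iter (sz p - j)%N (@par T) p.

Section Anc.
Variable T : game_tree.
Implicit Types (p q : T) (x : nat -> T).

Lemma sz_iter n p : sz (iter n (@par T) p) = (sz p - n)%N.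
Proof. by elim: n => [|n IH] /=; [rewrite subn0|rewrite sz_par IH subnS]. Qed.

Lemma sz_anc p j : (j <= sz p)%N -> sz (anc p j) = j.
Proof. by move=> h; rewrite sz_iter subKn. Qed.

Lemma anc_sz p : anc p (sz p) = p.
Proof. by rewrite /anc subnn. Qed.

Lemma par_anc p j : (j < sz p)%N -> par (anc p j.+1) = anc p j.
Proof. by move=> h; rewrite /anc -(subnSK h). Qed.

Lemma anc_kid q p j : kid q p -> (j <= sz p)%N -> anc q j = anc p j.
Proof. by case=> s e h; rewrite /anc s subSn // iterSr e. Qed.

Lemma kid_par p : (0 < sz p)%N -> kid p (par p).
Proof. by move=> h; split=> //; rewrite sz_par prednK. Qed.

Lemma play_kid x n : play x -> kid (x n.+1) (x n).
Proof. by move=> px; split; [rewrite !(px _).1|exact: (px n).2]. Qed.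

Lemma anc_play x n j : play x -> (j <= n)%N -> anc (x n) j = x j.
Proof.
move=> px; elim: n => [|n IH]; first by rewrite leqn0 => /eqP ->; rewrite /anc (px 0).1.
rewrite leq_eqVlt => /orP[/eqP ->|jn]; first by rewrite /anc (px n.+1).1 subnn.
by rewrite (anc_kid (play_kid n px)) ?(px n).1 // IH.
Qed.

Lemma play0 x : play x -> x 0 = root T.
Proof. by move=> px; apply: root_uniq; exact: (px 0).1. Qed.

End Anc.

(* Martin's coverings: a strategy upstairs induces one downstairs, locally in the
   length ([phi_loc]), and each play following the latter lifts ([phi_lift]). *)
Record cover (T' T : game_tree) := Cover {
  pi : T' -> T;
  phi : bool -> (T' -> T') -> T -> T;
  pi_sz : forall p, sz (pi p) = sz p;
  pi_par : forall p, pi (par p) = par (pi p);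
  phi_strat : forall b s, strat s -> strat (phi b s);
  phi_loc : forall b s s' n, strat s -> strat s' ->
    (forall p, (sz p <= n)%N -> s p = s' p) ->
    forall p, (sz p <= n)%N -> phi b s p = phi b s' p;
  phi_lift : forall b s x, strat s -> play x -> follows b (phi b s) x ->
    exists x', [/\ play x', follows b s x' & forall n, pi (x' n) = x n] }.

(* The covering is an isomorphism up to level [k]. *)
Record kcover (k : nat) (T' T : game_tree) (c : cover T' T) : Prop := KCover {
  kc_surj : forall p, (sz p <= k)%N -> exists p', pi c p' = p;
  kc_inj : forall p q, (sz p <= k)%N -> pi c p = pi c q -> p = q;
  kc_phi : forall b s p, strat s -> (sz p < k)%N -> phi c b s (pi c p) = pi c (s p) }.

Lemma kcover_le k k' T' T (c : cover T' T) : (k <= k')%N -> kcover k' c -> kcover k c.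
Proof.
move=> kk [h1 h2 h3]; split.
- by move=> p h; apply: h1; exact: leq_trans kk.
- by move=> p q h; apply: h2; exact: leq_trans kk.
- by move=> b s p hs h; apply: h3 => //; exact: leq_trans kk.
Qed.

Lemma pi_play T' T (c : cover T' T) x : play x -> play (fun n => pi c (x n)).
Proof. by move=> px n; rewrite pi_sz -pi_par; case: (px n) => -> ->. Qed.

Definition idcover (T : game_tree) : cover T T.
Proof.
refine (@Cover T T id (fun _ s => s) _ _ _ _ _) => //.
by move=> b s x hs px fx; exists x; split.
Defined.

Lemma kcover_id k T : kcover k (idcover T).
Proof. by split=> // p h; exists p. Qed.

Definition compcover (T1 T2 T3 : game_tree) (c : cover T1 T2) (d : cover T2 T3) : cover T1 T3.
Proof.
refine (@Cover T1 T3 (fun p => pi d (pi c p)) (fun b s => phi d b (phi c b s)) _ _ _ _ _).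
- by move=> p; rewrite !pi_sz.
- by move=> p; rewrite !pi_par.
- by move=> b s hs; do 2 apply: phi_strat.
- move=> b s s' n hs hs' h p hp; apply: phi_loc hp; try exact: phi_strat.
  by move=> q hq; apply: phi_loc hq.
- move=> b s x hs px fx.
  have [y [py fy ey]] := phi_lift (phi_strat c b hs) px fx.
  have [z [pz fz ez]] := phi_lift hs py fy.
  by exists z; split=> // n; rewrite ez ey.
Defined.

Lemma kcover_comp k T1 T2 T3 (c : cover T1 T2) (d : cover T2 T3) :
  kcover k c -> kcover k d -> kcover k (compcover c d).
Proof.
case=> c1 c2 c3 [d1 d2 d3]; split=> /=.
- move=> p hp; have [q eq] := d1 p hp.
  have [|r er] := c1 q; first by rewrite -(pi_sz d) eq.
  by exists r; rewrite er.
- by move=> p q hp e; apply: c2 => //; apply: d2 => //; rewrite pi_sz.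
- move=> b s p hs hp; rewrite d3 ?pi_sz ?c3 //; exact: phi_strat.
Qed.

Lemma sval_inj (A : Type) (P : A -> Prop) (u v : {a | P a}) : sval u = sval v -> u = v.
Proof. by case: u v => [a p] [b q] /= e; subst b; congr exist; exact: Prop_irrelevance. Qed.

(** * Inverse limits of coverings *)

Section Limit.
Variables (T : nat -> game_tree) (c : forall i, cover (T i.+1) (T i)).

Definition thread (th : forall i, T i) := forall i, pi (c i) (th i.+1) = th i.

Lemma thread_sz th i : thread th -> sz (th i) = sz (th 0).
Proof. by move=> h; elim: i => // i IH; rewrite -IH -(h i) pi_sz. Qed.

Lemma thread_down th th' j : thread th -> thread th' -> th j = th' j ->
  forall i, (i <= j)%N -> th i = th' i.
Proof.
move=> h h'; elim: j => [|j IH] e i; first by rewrite leqn0 => /eqP ->.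
rewrite leq_eqVlt => /orP[/eqP -> //|ij]; apply: IH => //.
by rewrite -h -h' e.
Qed.
End Limit.

(** Below [J] a thread is forced by projecting, above [J] by injectivity on positions of length [n];
    so one coordinate far enough out determines all others. *)
Lemma thread_inj n J (T : nat -> game_tree) (c : forall i, cover (T i.+1) (T i)) th th' :
  (forall i, (J <= i)%N -> forall p q, sz p = n -> pi (c i) p = pi (c i) q -> p = q) ->
  thread c th -> thread c th' -> sz (th 0) = n -> th J = th' J -> forall i, th i = th' i.
Proof.
move=> inj h h' hn e i; case: (leqP i J) => iJ; first exact: (thread_down h h' e).
rewrite -(subnKC (ltnW iJ)); elim: (i - J)%N => [|m IH]; first by rewrite addn0.
rewrite addnS; apply: (inj _ (leq_addr _ _)); last by rewrite h h'.
by rewrite (thread_sz _ h).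
Qed.

(** Coordinates above [J] are chosen one at a time by surjectivity, those below are projections. The
    induction on [J] shifts the sequence of trees and then refills the first coordinate. *)
Lemma thread_ex n J : forall (T : nat -> game_tree) (c : forall i, cover (T i.+1) (T i)),
  (forall i, (J <= i)%N -> forall p : T i, sz p = n -> exists q, pi (c i) q = p) ->
  forall q : T J, sz q = n -> exists th, thread c th /\ th J = q.
Proof.
elim: J => [|J IH] T c surj q hq.
  pose S i := {p : T i | sz p = n}.
  have nxt i (p : S i) : {r : S i.+1 | pi (c i) (sval r) = sval p}.
    have [r hr] := cid (surj i (leq0n i) _ (svalP p)).
    by exists (exist _ r (etrans (esym (pi_sz (c i) r)) (etrans (congr1 (@sz _) hr) (svalP p)))).
  pose F := fix F i : S i := match i with 0 => exist _ q hq | i.+1 => proj1_sig (nxt i (F i)) end.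
  by exists (fun i => sval (F i)); split=> // i /=; case: (nxt i (F i)).
have [th [h e]] := IH (fun i => T i.+1) (fun i => c i.+1) (fun i hi => surj i.+1 hi) q hq.
exists (fun i => match i with 0 => pi (c 0) (th 0) | i.+1 => th i end).
by split=> // -[].
Qed.

Section Limit2.
Variables (T : nat -> game_tree) (c : forall i, cover (T i.+1) (T i)) (k : nat).
Hypothesis ck : forall i, kcover (k + i) (c i).

(** Stage [i] is an isomorphism up to length [k + i], so positions of a given length are eventually
    the same at all stages; a thread records such a position through its images. *)
Definition thr := {th : forall i, T i | thread c th}.
Definition thr_par (t : thr) : thr.
Proof. by exists (fun i => par (sval t i)) => i; rewrite pi_par (svalP t). Defined.
Definition thr_root : thr.
Proof.
exists (fun i => root (T i)) => i; apply: root_uniq; by rewrite pi_sz sz_root.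
Defined.

Lemma thrP (t t' : thr) : (forall i, sval t i = sval t' i) -> t = t'.
Proof. by move=> h; apply: sval_inj; apply: functional_extensionality_dep. Qed.

Lemma thr_sz (t : thr) i : sz (sval t i) = sz (sval t 0).
Proof. exact: thread_sz (svalP t). Qed.

Lemma thr_surj n J (q : T J) : sz q = n -> (n <= k + J)%N -> exists t : thr, sval t J = q.
Proof.
move=> hq hn; have [|th [h e]] := thread_ex (n := n) (J := J) (T := T) (c := c) _ hq.
  by move=> i Ji p hp; apply: (kc_surj (ck i)); rewrite hp; lia.
by exists (exist _ th h).
Qed.

Lemma thr_inj J (t t' : thr) : (sz (sval t 0) <= k + J)%N -> sval t J = sval t' J -> t = t'.
Proof.
move=> hn e; apply: thrP; apply: (thread_inj (n := sz (sval t 0)) (J := J) _ (svalP t) (svalP t')) => //.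
by move=> i Ji p q hp; apply: (kc_inj (ck i)); rewrite hp; lia.
Qed.

Definition limtree : game_tree.
Proof.
refine (@GameTree thr (fun t => sz (sval t 0)) thr_par thr_root _ _ _ _ _).
- exact: sz_root.
- by move=> t h; apply: thrP => i /=; apply: root_uniq; rewrite thr_sz.
- by apply: thrP => i /=; exact: par_root.
- by move=> t /=; exact: sz_par.
- move=> t; set J := (sz (sval t 0)).+1.
  have [q [sq pq]] := kid_ex (sval t J).
  have [t' e] := thr_surj (n := J) (J := J) (q := q) (etrans sq (congr1 succn (thr_sz _ _))) (leq_addl _ _).
  exists t'; split; first by rewrite -(thr_sz t' J) e sq thr_sz.
  apply: (@thr_inj J); last by rewrite /= e.
  by rewrite /= sz_par -(thr_sz t' J) e sq /= thr_sz /J; lia.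
Defined.

Variables (b : bool).

(** A copy of the limit strategy on the tree at stage [j], faithful only at lengths where the [j]-th
    coordinate is still a bijection; elsewhere any legal move will do. *)
Definition sj_spec (s : limtree -> limtree) (j : nat) (s' : T j -> T j) :=
  strat s' /\ forall t : limtree, (sz t < k + j)%N -> s' (sval t j) = sval (s t) j.

Lemma sj_ex (s : limtree -> limtree) j : strat s -> exists s', @sj_spec s j s'.
Proof.
move=> hs.
have H (p : T j) : exists q, kid q p /\ (forall t : limtree, (sz t < k + j)%N -> p = sval t j -> q = sval (s t) j).
  case: (pselect (exists t : limtree, (sz t < k + j)%N /\ p = sval t j)) => [[t [ht et]]|h].
    exists (sval (s t) j); split.
      by case: (hs t) => e1 e2; rewrite et; split; [rewrite !(thr_sz _ j); exact: e1|rewrite -[in RHS]e2].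
    move=> t' ht' et'; congr (sval (s _) j); apply: (@thr_inj j) => //; last by rewrite -et.
    exact: ltnW.
  have [q hq] := kid_ex p; exists q; split=> // t ht et; exfalso; apply: h; by exists t.
have [f hf] := choice H; exists f; split; first by move=> p; exact: (hf p).1.
by move=> t ht; exact: (hf (sval t j)).2.
Qed.

Definition sj s j : T j -> T j :=
  if pselect (strat s) is left h then proj1_sig (cid (@sj_ex s j h)) else id.

Lemma sjP s j : strat s -> @sj_spec s j (sj s (j := j)).
Proof. by rewrite /sj => hs; case: pselect => // h; case: cid. Qed.

(** Takes the copy at stage [j + d] and pushes it down through [d] coverings. Larger [d] makes the
    result right at longer positions, and [lim_strat] chooses [d] beyond the length of the position
    asked about. *)
Fixpoint lim_iter (s : limtree -> limtree) (d : nat) : forall j, T j -> T j :=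
  match d with
  | 0 => fun j => sj s (j := j)
  | d.+1 => fun j => phi (c j) b (lim_iter s d (j := j.+1))
  end.
Definition lim_strat (s : limtree -> limtree) j (p : T j) := @lim_iter s (sz p).+1 j p.

Lemma lim_iter_strat s d j : strat s -> strat (@lim_iter s d j).
Proof.
by move=> hs; elim: d j => [|d IH] j /=; [exact: (sjP j hs).1|exact: phi_strat].
Qed.

Lemma lim_iterS s d j (p : T j) : strat s -> (sz p < k + j + d)%N ->
  @lim_iter s d.+1 j p = @lim_iter s d j p.
Proof.
move=> hs; elim: d j p => [|d IH] j p hp.
  have [|q eq] := kc_surj (ck j) (p := p); first by lia.
  rewrite -eq /=; have hq : (sz q < k + j)%N by rewrite -(pi_sz (c j)) eq; lia.
  rewrite (kc_phi (ck j)) //; last exact: (sjP _ hs).1.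
  have [|t et] := @thr_surj (sz q) j.+1 q erefl; first by lia.
  rewrite -et (sjP j.+1 hs).2; last by rewrite /= -(thr_sz t j.+1) et; lia.
  by rewrite (svalP t) (sjP j hs).2 ?(svalP (s t)) //= -(thr_sz t j.+1) et.
rewrite /=; apply: (@phi_loc _ _ (c j) b _ _ (sz p)) => //; try exact: lim_iter_strat.
  exact: (@lim_iter_strat s d.+1).
by move=> q hq; apply: IH; lia.
Qed.

Lemma lim_iterE s d j (p : T j) : strat s -> (sz p < k + j + d)%N ->
  @lim_iter s d j p = lim_strat s p.
Proof.
move=> hs hp; rewrite /lim_strat.
have aux m m' : (sz p < k + j + m)%N -> (m <= m')%N -> @lim_iter s m' j p = @lim_iter s m j p.
  move=> h /subnKC <-; elim: (m' - m)%N => [|i IH]; first by rewrite addn0.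
  by rewrite addnS lim_iterS //; lia.
case: (leqP d (sz p).+1) => h; first by rewrite (aux d).
by rewrite (aux (sz p).+1 d) //; lia.
Qed.

Lemma lim_strat_strat s j : strat s -> strat (@lim_strat s j).
Proof. by move=> hs p; exact: lim_iter_strat. Qed.

(** Neighbouring stages match exactly and not only approximately, so [phi_lift] can be applied stage
    after stage to whole plays. *)
Lemma lim_strat_phi s j : strat s ->
  forall p, phi (c j) b (@lim_strat s j.+1) p = lim_strat s p.
Proof.
move=> hs p; rewrite -(@lim_iterE s (sz p).+2) //; last by lia.
rewrite /=; apply: (@phi_loc _ _ (c j) b _ _ (sz p)) => //; first exact: lim_strat_strat.
  exact: (@lim_iter_strat s (sz p).+1).
by move=> q hq; rewrite -(@lim_iterE s (sz p).+1) //; lia.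
Qed.

(** Repeated lifting gives a play at every stage, and its positions of length [n] form a thread.
    That the play obeys [s] is read off at stage [n.+1], where positions of this length are
    represented faithfully. *)
Lemma lim_lift s x : strat s -> play x -> follows b (@lim_strat s 0) x ->
  exists x' : nat -> limtree, [/\ play x', follows b s x' & forall n, sval (x' n) 0 = x n].
Proof.
move=> hs px fx.
pose S j := {y : nat -> T j | play y /\ follows b (@lim_strat s j) y}.
have nxt j (y : S j) : {z : S j.+1 | forall n, pi (c j) (sval z n) = sval y n}.
  have H : exists z, [/\ play z, follows b (@lim_strat s j.+1) z & forall n, pi (c j) (z n) = sval y n].
    apply: phi_lift; [exact: lim_strat_strat|exact: (svalP y).1|].
    by move=> n hn; rewrite lim_strat_phi //; exact: (svalP y).2.
  have [z [h1 h2 h3]] := cid H.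
  by exists (exist _ z (conj h1 h2)).
pose F := fix F j : S j := match j with 0 => exist _ x (conj px fx) | j.+1 => proj1_sig (nxt j (F j)) end.
have th n : thread c (fun j => sval (F j) n) by move=> j /=; case: (nxt j (F j)).
pose x' n : limtree := exist (thread c) _ (th n).
have px' : play x'.
  move=> n; split; first by exact: (px n).1.
  by apply: thrP => j /=; exact: ((svalP (F j)).1 n).2.
exists x'; split=> // n hn; apply: (@thr_inj n.+1); first by rewrite /= (px n.+1).1; lia.
rewrite -(sjP n.+1 hs).2 /=; last by rewrite (px n).1; lia.
rewrite ((svalP (F n.+1)).2 n hn) -(@lim_iterE s 0) //.
by rewrite ((svalP (F n.+1)).1 n).1; lia.
Qed.
End Limit2.

Definition limcover (T : nat -> game_tree) (c : forall i, cover (T i.+1) (T i)) (k : nat)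
  (ck : forall i, kcover (k + i) (c i)) : cover (limtree ck) (T 0).
Proof.
refine (@Cover (limtree ck) (T 0) (fun t => sval t 0) (fun b s => @lim_strat T c k ck b s 0) _ _ _ _ _) => //.
- by move=> b s hs; exact: lim_strat_strat.
- move=> b s s' n hs hs' e p hp.
  rewrite -!(@lim_iterE _ _ _ _ b _ n.+1) //; try lia.
  have aux d : forall j (p : T j), (sz p <= n)%N -> (k + j + d >= n.+1)%N -> 
     @lim_iter _ _ _ ck b s d j p = @lim_iter _ _ _ ck b s' d j p.
    elim: d => [|d IH] j q hq hd.
      rewrite /=; have [|t et] := @thr_surj _ _ _ ck (sz q) j q erefl; first by lia.
      have ht : sz (t : limtree ck) = sz q by rewrite /= -(thr_sz t j) et.
      by rewrite -et (sjP j hs).2 ?(sjP j hs').2 ?e //; rewrite ht; lia.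
    rewrite /=; apply: (@phi_loc _ _ (c j) b _ _ n) => //; try exact: lim_iter_strat.
    by move=> r hr; apply: IH => //; lia.
  by apply: aux => //; lia.
- by move=> b s x hs px fx; exact: lim_lift.
Defined.

Lemma limcover_k T c k ck : kcover k (@limcover T c k ck).
Proof.
split=> /=.
- by move=> p hp; have [|t et] := @thr_surj _ _ _ ck (sz p) 0 p erefl; [lia|exists t].
- by move=> p q hp; apply: (thr_inj ck); rewrite addn0.
- move=> b s t hs ht; rewrite -(@lim_iterE _ _ _ _ b _ 0) //=; last by lia.
  by rewrite (sjP 0 hs).2 //= addn0.
Qed.

(* From [attr], player [b] can force [G], her own moves staying in [S]. *)
Section Attractor.
Variables (T : game_tree) (b : bool) (S G : set T).

Inductive attr : T -> Prop :=
| attr_goal q : G q -> attr q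
| attr_own q r : odd (sz q) = b -> kid r q -> S r -> attr r -> attr q
| attr_other q : odd (sz q) <> b -> (forall r, kid r q -> attr r) -> attr q.

(** The move function is consulted only before [G] is reached and only where its value is a child.
    This lets the induction patch it at single positions without keeping it legal everywhere. *)
Definition attr_strat (q : T) (t : T -> T) := forall x, play x -> x (sz q) = q ->
  (forall n, (sz q <= n)%N -> odd n = b ->
     (forall i, (sz q <= i <= n)%N -> ~ G (x i)) -> kid (t (x n)) (x n) -> x n.+1 = t (x n)) ->
  exists n, [/\ (sz q <= n)%N, G (x n), forall i, (sz q <= i < n)%N -> ~ G (x i) &
    forall j, (sz q <= j < n)%N -> odd j = b -> S (x j.+1)].

Lemma attr_stratP q : attr q -> exists t, attr_strat q t.
Proof.
elim=> {q} [q Gq|q r qb kr Sr _ [t ht]|q qb _ IH].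
- exists id => x px xq _; exists (sz q); split; rewrite ?xq //; lia.
- exists (fun p => if pselect (p = q) then r else t p) => x px xq fx.
  case: (pselect (G q)) => Gq; first by exists (sz q); split; rewrite ?xq //; lia.
  have xr : x (sz r) = r.
    rewrite kr.1 fx //; rewrite ?xq; try by case: pselect.
    by move=> i hi; rewrite (_ : i = sz q) ?xq //; lia.
  have [|n [h1 h2 h3 h4]] := ht x px xr.
    move=> n hn nb hG kt.
    have te : (if pselect (x n = q) then r else t (x n)) = t (x n).
      case: pselect => // e; exfalso; have := congr1 (@sz T) e; rewrite (px n).1; have := kr.1; lia.
    rewrite fx ?te //.
    - by have := kr.1; lia.
    - move=> i hi; case: (leqP (sz r) i) => ri; first by apply: hG; lia.
      by rewrite (_ : i = sz q) ?xq //; have := kr.1; lia.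
  exists n; have e := kr.1; split=> //; first lia.
  - move=> i hi; case: (leqP (sz r) i) => ri; first by apply: h3; lia.
    by rewrite (_ : i = sz q) ?xq //; lia.
  - move=> j hj jb; case: (leqP (sz r) j) => ri; first by apply: h4 => //; lia.
    by rewrite (_ : j.+1 = sz r) ?xr //; lia.
- have H r : exists t, kid r q -> attr_strat r t.
    case: (pselect (kid r q)) => [kr|nk]; first by have [t ht] := IH r kr; exists t.
    by exists id.
  have [f hf] := choice H.
  (* The ancestor one step after [q] reveals which child the opponent chose, hence which strategy
     applies. *)
  exists (fun p => f (anc p (sz q).+1) p) => x px xq fx.
  case: (pselect (G q)) => Gq; first by exists (sz q); split; rewrite ?xq //; lia.
  set r := x (sz q).+1; have kr : kid r q by rewrite -[X in kid _ X]xq; exact: play_kid.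
  have er := kr.1.
  have [||n [h1 h2 h3 h4]] := hf r kr x px; first by rewrite er.
    move=> n hn nb hG kt; have te : anc (x n) (sz q).+1 = r by rewrite anc_play // -er.
    rewrite fx ?te //.
    - by lia.
    - move=> i hi; case: (leqP (sz r) i) => ri; first by apply: hG; lia.
      by rewrite (_ : i = sz q) ?xq //; lia.
  exists n; split=> //; first lia.
  - move=> i hi; case: (leqP (sz r) i) => ri; first by apply: h3; lia.
    by rewrite (_ : i = sz q) ?xq //; lia.
  - move=> j hj jb; case: (leqP (sz r) j) => ri; first by apply: h4 => //; lia.
    by case: qb; rewrite -jb; congr odd; lia.
Qed.

Definition attr_move (q : T) : T -> T :=
  if pselect (exists t, attr_strat q t) is left h then proj1_sig (cid h) else id.

Lemma attr_moveP q : attr q -> attr_strat q (attr_move q).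
Proof.
by move=> /attr_stratP h; rewrite /attr_move; case: pselect => // h'; case: cid.
Qed.
End Attractor.

Lemma nat_min (P : nat -> Prop) (a : nat) : (exists j, (a <= j)%N /\ P j) ->
  exists j, [/\ (a <= j)%N, P j & forall i, (a <= i < j)%N -> ~ P i].
Proof.
move=> [j]; elim/ltn_ind: j => j IH [aj Pj].
case: (pselect (exists i, (a <= i < j)%N /\ P i)) => [[i [ij Pi]]|h].
  by apply: (IH i); [lia|split=> //; lia].
by exists j; split=> // i ij Pi; apply: h; exists i.
Qed.

(* Martin's auxiliary game for the open condition "some position is in [D]".  At
   level K+1 player [false] also proposes a quasi-strategy [S]; at level K+2 player
   [true] answers with a quasi-strategy inside [S] avoiding [D] ([inl]), or with a
   position of [S] that hits [D] and that the play then has to reach ([inr]). *)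
Section Unravel.
Variables (T : game_tree) (K : nat) (D : set T).
Hypothesis Keven : odd K = false.

Definition hits_D (p : T) := exists j, (j <= sz p)%N /\ D (anc p j).
Definition option_move := (set T + T)%type.

(** A quasi-strategy for player [false] beyond length [K]: every move of the opponent, who moves at
    odd lengths, is kept, and at least one own move. *)
Definition quasi_move (S : set T) (p1 : T) := S p1 /\ forall q, S q -> (K < sz q)%N ->
  (odd (sz q) -> forall r, kid r q -> S r) /\
  (~~ odd (sz q) -> exists r, kid r q /\ S r).

Definition legal_option (S : set T) (o : option_move) (p2 : T) := match o with
  | inl V => forall q, V q -> (K.+1 < sz q)%N -> [/\ S q, ~ hits_D q,
       odd (sz q) -> exists r, kid r q /\ V r &
       ~~ odd (sz q) -> forall r, kid r q -> S r -> V r]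
  | inr u => [/\ hits_D u, (K.+1 < sz u)%N, anc u K.+2 = p2 &
       forall j, (K.+2 <= j <= sz u)%N -> S (anc u j)]
  end.

Definition compatible (o : option_move) (p : T) := match o with
  | inl V => V p
  | inr u => if (sz p <= sz u)%N then anc u (sz p) = p else anc p (sz u) = u
  end.

(** An auxiliary move is attached to the position created with it and carried along by all later
    ones; [None] means that it has not been made yet. *)
Definition aux_pos := (T * option (set T) * option option_move)%type.

Definition legal (t : aux_pos) : Prop := let: (p, a, b) := t in
  if (sz p <= K)%N then a = None /\ b = None
  else if sz p == K.+1 then b = None /\ exists S, a = Some S /\ quasi_move S p
  else exists S o, [/\ a = Some S, b = Some o, quasi_move S (anc p K.+1),
     legal_option S o (anc p K.+2) & forall j, (K.+2 <= j <= sz p)%N -> compatible o (anc p j)].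

Definition aux_par (t : aux_pos) : aux_pos := let: (p, a, b) := t in
  (par p, (if (sz p <= K.+1)%N then None else a), (if (sz p <= K.+2)%N then None else b)).

Lemma legal0 p : (sz p <= K)%N -> legal (p, None, None).
Proof. by rewrite /= => ->. Qed.

Lemma legal1 p S : sz p = K.+1 -> quasi_move S p -> legal (p, Some S, None).
Proof. by move=> h q; rewrite /= h ltnn eqxx; split=> //; exists S. Qed.

Lemma legal2 p S o : (K.+1 < sz p)%N -> quasi_move S (anc p K.+1) -> legal_option S o (anc p K.+2) ->
  (forall j, (K.+2 <= j <= sz p)%N -> compatible o (anc p j)) -> legal (p, Some S, Some o).
Proof.
move=> h h1 h2 h3; rewrite /= ifF; last by lia.
by rewrite ifF; [exists S, o|lia].
Qed.

Lemma legal2E p a b : (K.+1 < sz p)%N -> legal (p, a, b) ->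
  exists S o, [/\ a = Some S, b = Some o, quasi_move S (anc p K.+1),
     legal_option S o (anc p K.+2) & forall j, (K.+2 <= j <= sz p)%N -> compatible o (anc p j)].
Proof. by move=> h; rewrite /= ifF ?ifF //; lia. Qed.

Lemma legal_par t : legal t -> legal (aux_par t).
Proof.
case: t => [[p a] b] h /=; rewrite /aux_par.
have [pK|Kp] := leqP (sz p) K.+1.
  by rewrite (leq_trans pK) //; apply: legal0; rewrite sz_par; lia.
have [S [ o [-> -> hQ hO hI]]] := legal2E Kp h.
have sp := sz_par p; have kp := kid_par (leq_trans (ltn0Sn _) Kp).
have aE j : (j < sz p)%N -> anc (par p) j = anc p j.
  by move=> hj; rewrite (anc_kid kp) // sp; lia.
case: (leqP (sz p) K.+2) => p2; last first.
  apply: legal2; rewrite ?aE //; try lia.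
  by move=> j hj; rewrite aE; [apply: hI|]; lia.
apply: legal1; first by lia.
by have := hQ; rewrite -(aE K.+1) //; rewrite /anc sp (_ : (_ - _)%N = 0%N) //; lia.
Qed.

Definition legal_pos := {t : aux_pos | legal t}.

Lemma legal_root : legal (root T, None, None).
Proof. by apply: legal0; rewrite sz_root. Qed.

Definition mk (t : aux_pos) : legal_pos :=
  if pselect (legal t) is left h then exist _ t h else exist _ _ legal_root.

Lemma mkK t : legal t -> sval (mk t) = t.
Proof. by rewrite /mk; case: pselect. Qed.

Lemma legal_pos_inj (t t' : legal_pos) : sval t = sval t' -> t = t'.
Proof. exact: sval_inj. Qed.

(** The point in doubt is the answer at length [K + 2]. If some position beyond the new one hits [D]
    along a path in [S], it is a legal [inr]; if there is none, the positions reachable inside [S]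
    form a legal [inl]. At length [K + 1] the proposal [setT] is legal. *)
Lemma ukid_ex (t : aux_pos) : legal t -> exists t', [/\ legal t', sz t'.1.1 = (sz t.1.1).+1 & aux_par t' = t].
Proof.
case: t => [[p a] b] h /=.
have [pK|Kp] := ltnP (sz p) K.
  have [r [sr pairN]] := kid_ex p; exists (r, None, None); split=> //; first by apply: legal0; lia.
  rewrite /aux_par pairN; have := h; rewrite /= (ltnW pK) => -[-> ->]; congr (_, _, _); case: ifP => //; lia.
case: (ltngtP (sz p) K.+1) => pK; last first.
- have := h; rewrite /= pK ltnn eqxx => -[-> [S [-> QS]]].
  have [r kr] := kid_ex p.
  have Sr : S r by apply: (QS.2 p QS.1 _).1 kr; rewrite ?pK //= Keven.
  have sr : sz r = K.+2 by rewrite kr.1 pK.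
  have ar : anc r K.+2 = r by rewrite -sr anc_sz.
  have ar1 : anc r K.+1 = p by rewrite (anc_kid kr) ?pK // -pK anc_sz.
  have goal o : legal_option S o r -> compatible o r -> exists t', [/\ legal t', sz t'.1.1 = K.+2 & aux_par t' = (p, Some S, None)].
    move=> h1 h2; exists (r, Some S, Some o); split=> //; last first.
      by rewrite /aux_par kr.2 sr leqnn ifF //; lia.
    apply: legal2; rewrite ?ar ?ar1 ?sr //.
    by move=> j hj; rewrite (_ : j = K.+2) ?ar //; lia.
  case: (pselect (exists u, legal_option S (inr u) r)) => [[u hu]|hu].
    apply: (goal (inr u)) => //=; case: hu => _ h1 h2 _; rewrite sr h1 //.
  pose V : set T := [set q | [/\ S q, (K.+1 < sz q)%N, anc q K.+2 = r & forall j, (K.+2 <= j <= sz q)%N -> S (anc q j)]].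
  have Vk q q' : V q -> kid q' q -> S q' -> V q'.
    case=> Sq q2 aq hq kq Sq'; split=> //; first by rewrite kq.1; lia.
      by rewrite (anc_kid kq).
    move=> j hj; have := kq.1 => e; case: (leqP j (sz q)) => jq; last by rewrite (_ : j = sz q') ?anc_sz //; lia.
    by rewrite (anc_kid kq) //; apply: hq; lia.
  apply: (goal (inl V)).
    move=> q Vq q2; have [Sq _ aq hq] := Vq; split=> //.
    - by move=> Dq; apply: hu; exists q.
    - move=> oq; have [r' kr'] := kid_ex q; exists r'; split=> //; apply: (Vk q) => //.
      by apply: (QS.2 q Sq _).1 => //; lia.
    - by move=> oq r' kr' Sr'; exact: (Vk q).
  split=> //; first by rewrite sr.
  by move=> j hj; rewrite (_ : j = K.+2) ?ar //; lia.
- have [S [ o [-> -> hQ hO hI]]] := legal2E pK h.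
  have aS q : kid q p -> forall j, (j < sz q)%N -> anc q j = anc p j.
    by move=> kq j; rewrite kq.1 ltnS; exact: anc_kid.
  have QS := hQ.2.
  have goal r : kid r p -> compatible o r -> exists t', [/\ legal t', sz t'.1.1 = (sz p).+1 & aux_par t' = (p, Some S, Some o)].
    move=> kr h2; have := kr.1 => er; exists (r, Some S, Some o); split=> //; last first.
      rewrite /aux_par kr.2; congr (_, _, _); case: ifP => //; lia.
    apply: legal2; rewrite ?(aS r) //; try lia.
    move=> j hj; case: (leqP (sz r) j) => jr; first by rewrite (_ : j = sz r) ?anc_sz //; lia.
    by rewrite aS //; apply: hI; lia.
  case: o hO hI goal => [V|u] hO hI goal.
    have Vp : V p by have := hI (sz p); rewrite /= anc_sz; apply; lia.
    have [Sp _ h1 h2] := hO p Vp pK.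
    case op: (odd (sz p)); first by have [r [kr Vr]] := h1 op; exact: (goal r).
    have [|r [kr Sr]] := (QS p Sp _).2 (negbT op); first by lia.
    by apply: (goal r) => //; apply: h2 => //; rewrite op.
  have := hI (sz p); rewrite /= anc_sz pK leqnn => /(_ isT).
  have [pu|up] := ltnP (sz p) (sz u).
    rewrite (ltnW pu) => e; apply: (goal (anc u (sz p).+1)).
      by split; rewrite ?sz_anc // par_anc.
    by rewrite /= sz_anc // pu.
  move=> e; have [r kr] := kid_ex p; apply: (goal r) => //=.
  have := kr.1 => er; rewrite ifF; last by lia.
  move: e; case: ifP => [pu|_].
    rewrite (_ : sz p = sz u) ?anc_sz; last by lia.
    by move=> ->; rewrite (anc_kid kr) ?anc_sz.
  by rewrite (anc_kid kr).
- have {}pK : sz p = K by lia.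
  have := h; rewrite /= pK leqnn => -[-> ->].
  have [r kr] := kid_ex p; have sr : sz r = K.+1 by rewrite kr.1 pK.
  exists (r, Some setT, None); split=> //.
    apply: legal1 => //; split=> // q _ _; split=> // _.
    by have [r' kr'] := kid_ex q; exists r'.
  by rewrite /aux_par kr.2 sr leqnn leqnSn.
Qed.

Definition utree : game_tree.
Proof.
refine (@GameTree legal_pos (fun t => sz (sval t).1.1) (fun t => exist _ _ (legal_par (svalP t)))
  (exist _ _ legal_root) _ _ _ _ _).
- exact: sz_root.
- case=> [[[p a] b] h] /= p0; apply: legal_pos_inj => /=.
  have := h; rewrite /= p0 => -[-> ->]; by rewrite (root_uniq p0).
- by apply: legal_pos_inj; rewrite /= par_root sz_root.
- by case=> [[[p a] b] h] /=; exact: sz_par.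
- case=> t h; have [t' [h1 h2 h3]] := ukid_ex h.
  by exists (exist _ t' h1); split=> //; apply: legal_pos_inj.
Defined.

Definition upi (t : utree) : T := (sval t).1.1.

(** Replaces an illegal move by an arbitrary legal one, so that the induced strategies are total;
    legality of the intended move is then shown only along the plays being lifted. *)
Definition fixk (p r : T) : T :=
  if pselect (kid r p) is left _ then r else proj1_sig (cid (kid_ex p)).
Lemma fixk_kid p r : kid (fixk p r) p.
Proof. by rewrite /fixk; case: pselect => // _; case: cid. Qed.
Lemma fixkE p r : kid r p -> fixk p r = r.
Proof. by rewrite /fixk; case: pselect. Qed.

(* [first_anc a P p u]: u is the shortest ancestor of p of length >= a in P *)
Definition first_anc (a : nat) (P : set T) (p u : T) := exists j,
  [/\ (a <= j <= sz p)%N, u = anc p j, P u & forall i, (a <= i < j)%N -> ~ P (anc p i)].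

Lemma first_anc_uniq a P p u v : first_anc a P p u -> first_anc a P p v -> u = v.
Proof.
move=> [j [j1 ju Pu hj]] [i [i1 iv Pv hi]].
case: (ltngtP i j) => ij; last by rewrite ju iv ij.
  by exfalso; apply: (hj i); [lia|rewrite -iv].
by exfalso; apply: (hi j); [lia|rewrite -ju].
Qed.

Definition getfirst a P p : option T :=
  if pselect (exists u, first_anc a P p u) is left h then Some (proj1_sig (cid h)) else None.

Lemma getfirst_play a (P : set T) x n J : play x -> (a <= J)%N -> P (x J) ->
  (forall i, (a <= i < J)%N -> ~ P (x i)) ->
  getfirst a P (x n) = if (J <= n)%N then Some (x J) else None.
Proof.
move=> px aJ PJ hJ; rewrite /getfirst; case: (leqP J n) => Jn; case: pselect => h.
- congr Some; case: cid => u hu /=; apply: (first_anc_uniq hu).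
  exists J; rewrite (px n).1 anc_play //; split=> //; first lia.
  by move=> i hi; rewrite anc_play //; [exact: hJ|lia].
- exfalso; apply: h; exists (x J), J; rewrite (px n).1 anc_play //; split=> //; first lia.
  by move=> i hi; rewrite anc_play //; [exact: hJ|lia].
- exfalso; case: h => u [j [hj -> ]]; rewrite (px n).1 in hj.
  by rewrite anc_play //; [move=> Pj _; apply: (hJ j) => //; lia|lia].
- by [].
Qed.

Lemma getfirst_none a (P : set T) x n : play x ->
  (forall i, (a <= i <= n)%N -> ~ P (x i)) -> getfirst a P (x n) = None.
Proof.
move=> px h; rewrite /getfirst; case: pselect => // h'; exfalso; case: h' => u [j [hj -> ]]; rewrite (px n).1 in hj.
by rewrite anc_play //; [move=> Pj _; exact: (h j)|lia].
Qed.

(** The answer imputed to player [true] when a strategy of player [false] is brought downstairs.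
    While the play stays in [VI S], this answer is consistent with it. Once the play leaves, [false]
    can force a position [u] that hits [D], after which [true] is taken to have answered [inr u]. *)
Definition VI (S : set T) : set T := [set q | S q /\ ~ attr false S hits_D q].

Definition phiI_ (p : T) (t0 : legal_pos) (g : option (set T) -> option option_move -> legal_pos) : T :=
  if (sz p <= K)%N then upi (g None None) else
  let S := odflt setT (sval t0).1.2 in
  if getfirst K.+2 (attr false S hits_D) p is Some q then
    if getfirst K.+2 hits_D p is Some u then upi (g (Some S) (Some (inr u)))
    else attr_move false S hits_D q p
  else upi (g (Some S) (Some (inl (VI S)))).

(** The positions that a strategy of player [true] announces against some proposal. If [true] can
    force the play into this set, the matching proposal is imputed to [false] afterwards; if not,
    the proposal imputed is [SII], the complement of the attractor. *)
Definition UII (p1 : T) (h : option (set T) -> option option_move -> legal_pos) : set T :=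
  [set u | exists S, quasi_move S p1 /\ (sval (h (Some S) None)).2 = Some (inr u)].
Definition SII (p1 : T) h : set T := [set q | ~ attr true setT (UII p1 h) q].

Definition phiII_ (p : T) (p1 : T) (h g : option (set T) -> option option_move -> legal_pos) : T :=
  if (sz p <= K)%N then upi (g None None) else
  if getfirst K.+1 (attr true setT (UII p1 h)) p is Some q then
    if getfirst K.+1 (UII p1 h) p is Some u then
      if pselect (UII p1 h u) is left e then upi (g (Some (proj1_sig (cid e))) (Some (inr u)))
      else p
    else attr_move true setT (UII p1 h) q p
  else if sz p == K.+1 then upi (g (Some (SII p1 h)) None)
  else upi (g (Some (SII p1 h)) (sval (h (Some (SII p1 h)) None)).2).

Definition uphi (b : bool) (s : utree -> utree) (p : T) : T :=
  fixk p (if b then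
    phiII_ p (anc p K.+1) (fun a o => s (mk (anc p K.+1, a, o))) (fun a o => s (mk (p, a, o)))
  else phiI_ p (s (mk (anc p K, None, None))) (fun a o => s (mk (p, a, o)))).

Lemma sz_mk_le t n : (sz t.1.1 <= n)%N -> (sz (mk t : utree) <= n)%N.
Proof. by rewrite /mk => h; case: pselect => //= _; rewrite sz_root. Qed.

Lemma uphi_loc b s s' n : strat s -> strat s' ->
    (forall p, (sz p <= n)%N -> s p = s' p) ->
    forall p, (sz p <= n)%N -> uphi b s p = uphi b s' p.
Proof.
move=> _ _ e p hp; rewrite /uphi; congr fixk.
have an j : (sz (anc p j) <= n)%N by rewrite sz_iter; lia.
have E q : (sz q <= n)%N -> (fun a o => s (mk (q, a, o))) = (fun a o => s' (mk (q, a, o))).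
  by move=> hq; apply/funext => a; apply/funext => o; apply: e; exact: sz_mk_le.
case: b; first by rewrite (E p hp) (E _ (an K.+1)).
have e0 : s (mk (anc p K, None, None)) = s' (mk (anc p K, None, None)).
  by apply: e; exact: (@sz_mk_le (anc p K, None, None) n (an K)).
by rewrite (E p hp) e0.
Qed.

Lemma skid s t : strat (T := utree) s -> legal t -> let r := sval (s (mk t)) in
  [/\ legal r, aux_par r = t & kid r.1.1 t.1.1].
Proof.
move=> hs it r; have [h1 h2] := hs (mk t).
have e : aux_par r = t by rewrite -[RHS](mkK it) -h2.
split=> //; first exact: svalP.
split; first by have := h1; rewrite /= mkK.
by rewrite -[in RHS]e /aux_par; case: (r) => -[].
Qed.

Lemma skid0 s p : strat (T := utree) s -> (sz p < K)%N ->
  sval (s (mk (p, None, None))) = (upi (s (mk (p, None, None))), None, None).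
Proof.
move=> hs hp; have [|hr _ kr] := @skid s (p, None, None) hs; first by apply: legal0; lia.
rewrite /upi; move: hr kr; case: (sval _) => -[r a] b /= + kr.
by rewrite kr.1 /= hp => -[-> ->].
Qed.

Lemma skid1 s p : strat (T := utree) s -> sz p = K ->
  exists S, sval (s (mk (p, None, None))) = (upi (s (mk (p, None, None))), Some S, None) /\
    quasi_move S (upi (s (mk (p, None, None)))).
Proof.
move=> hs hp; have [|hr _ kr] := @skid s (p, None, None) hs; first by apply: legal0; lia.
rewrite /upi; move: hr kr; case: (sval _) => -[r a] b /= + kr.
by rewrite kr.1 /= hp ltnn eqxx => -[-> [S [-> hS]]]; exists S.
Qed.

Lemma skid2 s p S : strat (T := utree) s -> sz p = K.+1 -> quasi_move S p ->
  exists o, [/\ sval (s (mk (p, Some S, None))) = (upi (s (mk (p, Some S, None))), Some S, Some o),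
    legal_option S o (upi (s (mk (p, Some S, None)))) & compatible o (upi (s (mk (p, Some S, None))))].
Proof.
move=> hs hp hS; have [|hr er kr] := @skid s (p, Some S, None) hs; first exact: legal1.
rewrite /upi; move: hr er kr; case: (sval _) => -[r a] b hr er kr.
have sr : sz r = K.+2 by rewrite kr.1 /= hp.
have [|S' [ o [ea eb h1 h2 h3]]] := legal2E _ hr; first by rewrite sr.
move: er; rewrite /aux_par sr ltnn => -[_ eS _].
have ar : anc r K.+2 = r by rewrite -sr anc_sz.
rewrite ar in h2; move: eS; rewrite ea => -[eS]; subst S'; exists o; rewrite eb; split=> //.
by have := h3 K.+2; rewrite ar sr; apply; rewrite !leqnn.
Qed.

Lemma skid3 s p S o : strat (T := utree) s -> (K.+1 < sz p)%N -> legal (p, Some S, Some o) ->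
  [/\ sval (s (mk (p, Some S, Some o))) = (upi (s (mk (p, Some S, Some o))), Some S, Some o),
    kid (upi (s (mk (p, Some S, Some o)))) p & compatible o (upi (s (mk (p, Some S, Some o))))].
Proof.
move=> hs hp ip; have [hr er kr] := @skid s (p, Some S, Some o) hs ip.
rewrite /upi; move: hr er kr; case: (sval _) => -[r a] b hr er kr.
have sr : sz r = (sz p).+1 by exact: kr.1.
move: er; rewrite /aux_par sr; rewrite ifF ?ifF; try lia; case=> _ ea eb.
have [|S' [ o' [ea' eb' h1 h2 h3]]] := legal2E _ hr; first by rewrite sr; lia.
split=> //=; first by rewrite ea eb.
have := h3 (sz r); rewrite anc_sz sr; move: eb'; rewrite eb => -[->]; apply; lia.
Qed.

Section PlayLift.
Variables (x : nat -> T) (S : set T) (o : option_move).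
Hypothesis (px : play x) (hS : quasi_move S (x K.+1)) (hO : legal_option S o (x K.+2)).

Definition lift_play n : legal_pos := if (n <= K)%N then mk (x n, None, None)
  else if n == K.+1 then mk (x n, Some S, None) else mk (x n, Some S, Some o).

Lemma lft_inv n : (K.+1 < n)%N -> (forall j, (K.+2 <= j <= n)%N -> compatible o (x j)) -> legal (x n, Some S, Some o).
Proof.
move=> hn hI; apply: legal2; rewrite ?(px n).1 //; try (rewrite anc_play //; lia).
by move=> j hj; rewrite anc_play //; [exact: hI|lia].
Qed.

Hypothesis hI : forall j, (K.+2 <= j)%N -> compatible o (x j).

Lemma lftE n : sval (lift_play n) = if (n <= K)%N then (x n, None, None)
  else if n == K.+1 then (x n, Some S, None) else (x n, Some S, Some o).
Proof.
rewrite /lift_play; case: ifP => h1; first by rewrite mkK //; apply: legal0; rewrite (px n).1.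
case: ifP => h2; first by rewrite mkK // (eqP h2); apply: legal1; rewrite ?(px _).1.
by rewrite mkK //; apply: lft_inv => [|j hj]; [lia|apply: hI; lia].
Qed.

Lemma lft_pi n : upi (lift_play n) = x n.
Proof. by rewrite /upi lftE; case: ifP => // _; case: ifP. Qed.

Lemma lft_play : play (T := utree) lift_play.
Proof.
move=> n; split; first by rewrite -[sz _]/(sz (upi (lift_play n))) lft_pi; exact: (px n).1.
apply: legal_pos_inj; rewrite /= !lftE; have px1 := (px n).2; have e1 := (px n.+1).1.
case: (leqP n.+1 K) => nK.
  by rewrite (ltnW nK) /aux_par px1; case: ifP => //; case: ifP.
case: (eqVneq n.+1 K.+1) => [[nK1]|nK1].
  by rewrite nK1 leqnn /aux_par -nK1 px1 e1 nK1 leqnn leqnSn.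
rewrite leqNgt; rewrite (_ : (K < n)%N) /=; last by lia.
case: (eqVneq n K.+1) => nK2; rewrite /aux_par px1 e1; first by rewrite nK2 ltnn leqnn.
by rewrite !ifF //; lia.
Qed.

(** Apart from the moves downstairs, a player makes just one auxiliary choice, the proposal for
    [false] and the option for [true]; all later positions carry it along. *)
Lemma lft_follows b s : strat (T := utree) s ->
  (forall n, odd n = b -> upi (s (lift_play n)) = x n.+1) ->
  (b = false -> (sval (s (lift_play K))).1.2 = Some S) ->
  (b = true -> (sval (s (lift_play K.+1))).2 = Some o) ->
  follows (T := utree) b s lift_play.
Proof.
move=> hs h1 h2 h3 n nb; apply: legal_pos_inj; have := h1 n nb; rewrite lftE.
rewrite /lift_play; case: (ltngtP n K) => nK.
- by move=> <-; rewrite skid0 // ?nK // (px n).1.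
- case: (eqVneq n K.+1) => nK1.
  + move=> <-; rewrite ifF; last by lia.
    have [||o' [e _ _]] := @skid2 s (x n) S hs; [by rewrite (px n).1|by rewrite nK1|].
    rewrite e; congr (_, _, _); have := h3; rewrite -nK1 /lift_play nK1 ltnn eqxx -nK1 e /= => -> //.
    by rewrite -nb nK1 /= Keven.
  + move=> <-; rewrite ifF; last by lia.
    have [||e _ _] := @skid3 s (x n) S o hs; first by rewrite (px n).1; lia.
      by apply: lft_inv => [|j hj]; [lia|apply: hI; lia].
    by [].
- move=> <-; rewrite nK eqxx.
  have [|S' [e _]] := @skid1 s (x K) hs; first exact: (px _).1.
  rewrite e; congr (_, _, _); have := h2; rewrite /lift_play leqnn e /= => -> //.
  by rewrite -nb nK.
Qed.
End PlayLift.

Lemma fixk_s (s : utree -> utree) (q : aux_pos) n x : strat s -> play x -> legal q -> q.1.1 = x n ->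
  x n.+1 = fixk (x n) (upi (s (mk q))) -> upi (s (mk q)) = x n.+1.
Proof. by move=> hs px iq e ->; rewrite fixkE // -e; have [] := skid hs iq. Qed.

Lemma inO_play x J : play x -> forall j, compatible (inr (x J)) (x j).
Proof.
move=> px j /=; rewrite !(px _).1; case: ifP => h; rewrite anc_play //; lia.
Qed.

Lemma inO_skid s x n S J : strat (T := utree) s -> play x -> (K.+1 < n < J)%N ->
  legal (x n, Some S, Some (inr (x J))) -> upi (s (mk (x n, Some S, Some (inr (x J))))) = x n.+1.
Proof.
move=> hs px hn hi; have [|_ kr] := skid3 hs _ hi; first by rewrite (px n).1; lia.
by rewrite /= kr.1 !(px _).1 ifT; [rewrite anc_play //; lia|lia].
Qed.

Lemma VI_opt S p1 p2 : quasi_move S p1 -> legal_option S (inl (VI S)) p2.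
Proof.
move=> [_ hQ] q [Sq nq] hq; have [h1 h2] := hQ q Sq (ltnW hq); split=> //.
- by move=> Dq; apply: nq; exact: attr_goal.
- move=> oq; apply: contrapT => h; apply: nq; apply: attr_other; first by rewrite oq.
  by move=> r kr; apply: contrapT => nr; apply: h; exists r; split=> //; split=> //; exact: h1 kr.
- move=> oq r kr Sr; split=> // ar; apply: nq; apply: attr_own ar => //; exact: negbTE.
Qed.

Lemma uliftI s x : strat (T := utree) s -> play x -> follows false (uphi false s) x ->
  exists x', [/\ play (T := utree) x', follows (T := utree) false s x' & forall n, upi (x' n) = x n].
Proof.
move=> hs px fx.
have [|S [eS QS]] := @skid1 s (x K) hs; first exact: (px K).1.
have F0 n : odd n = false -> (n <= K)%N -> upi (s (mk (x n, None, None))) = x n.+1.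
  move=> nb nK; apply: (fixk_s hs px) => //; first by apply: legal0; rewrite (px n).1.
  by rewrite fx // /uphi /phiI_ (px n).1 nK.
have hS : quasi_move S (x K.+1) by rewrite -F0.
have F n : odd n = false -> (K < n)%N -> x n.+1 = fixk (x n)
  (if getfirst K.+2 (attr false S hits_D) (x n) is Some q then
    if getfirst K.+2 hits_D (x n) is Some u then upi (s (mk (x n, Some S, Some (inr u))))
    else attr_move false S hits_D q (x n)
  else upi (s (mk (x n, Some S, Some (inl (VI S)))))).
  move=> nb nK; rewrite [LHS]fx // /uphi /phiI_ (px n).1 leqNgt nK /= anc_play //; last exact: ltnW.
  by rewrite eS.
have lI n : (K.+1 < n)%N -> (forall j, (K.+2 <= j <= n)%N -> VI S (x j)) ->
    legal (x n, Some S, Some (inl (VI S))).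
  by move=> hn hV; apply: (lft_inv px) => //; exact: VI_opt hS.
have FV n : odd n = false -> (K.+1 < n)%N -> (forall j, (K.+2 <= j <= n)%N -> VI S (x j)) ->
    upi (s (mk (x n, Some S, Some (inl (VI S))))) = x n.+1.
  move=> nb nK hV; apply: (fixk_s hs px) => //; first exact: lI.
  by rewrite F //; [rewrite getfirst_none // => i hi; exact: (hV i hi).2|lia].
have Sreach n : (K < n)%N -> (forall i, (K.+2 <= i < n)%N -> ~ attr false S hits_D (x i)) -> S (x n).
  elim/ltn_ind: n => n IH hn na.
  case: (ltngtP n K.+1) => nK1; [by lia| |by rewrite nK1; exact: hS.1].
  case: n IH hn na nK1 => // m IH hm na mK.
  have Si i : (K < i <= m)%N -> S (x i) by move=> hi; apply: IH => [||j hj]; [lia|lia|apply: na; lia].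
  have [h1 h2] := hS.2 (x m) (Si m ltac:(lia)) ltac:(rewrite (px m).1; lia).
  rewrite (px m).1 in h1 h2; case om: (odd m); first by apply: (h1 om); exact: play_kid.
  have mK2 : (K.+1 < m)%N by case: (eqVneq m K.+1) => [e|]; [move: om; rewrite e /= Keven|lia].
  have hV j : (K.+2 <= j <= m)%N -> VI S (x j) by move=> hj; split; [apply: Si; lia|apply: na; lia].
  have [|_ _] := @skid3 s (x m) S _ hs _ (lI m mK2 hV); first by rewrite (px m).1.
  by rewrite FV // => -[].
(* If the play enters the attractor, [false] forces a position [x J] hitting [D] inside [S], and the
   lift lets the opponent announce exactly this position at length [K + 2]. *)
case: (pselect (exists j, (K.+2 <= j)%N /\ attr false S hits_D (x j))) => [/nat_min [j1 [hj1 aj1 mj1]]|hC].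
  have nD i : (K.+2 <= i < j1)%N -> ~ hits_D (x i) by move=> hi hD; apply: (mj1 i hi); exact: attr_goal.
  have [||J] := @attr_moveP _ _ _ _ _ aj1 x px; rewrite (px j1).1 //.
    move=> n hn nb hG kt; rewrite F //; last by lia.
    rewrite (@getfirst_play _ _ _ _ j1) // hn getfirst_none ?fixkE // => i hi.
    by case: (leqP j1 i) => hi2; [apply: hG; lia|apply: nD; lia].
  move=> [hJ DJ mJ SJ].
  have mJ' i : (K.+2 <= i < J)%N -> ~ hits_D (x i).
    by move=> hi; case: (leqP j1 i) => hi2; [apply: mJ; lia|apply: nD; lia].
  have SS j : (K < j <= J)%N -> S (x j).
    elim: j => [|j IH] hj; first by lia.
    case: (leqP j.+1 j1) => hj2; first by apply: Sreach => [|i hi]; [lia|apply: mj1; lia].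
    case oj: (odd j); last by apply: SJ => //; lia.
    have Sj : S (x j) by apply: IH; lia.
    have [h1 _] := hS.2 (x j) Sj ltac:(rewrite (px j).1; lia).
    by rewrite (px j).1 in h1; apply: (h1 oj); exact: play_kid.
  pose o : option_move := inr (x J).
  have hO : legal_option S o (x K.+2).
    split=> //; first by rewrite (px J).1; lia.
      by rewrite anc_play //; lia.
    by rewrite (px J).1 => j hj; rewrite anc_play //; [apply: SS|]; lia.
  have hI j : (K.+2 <= j)%N -> compatible o (x j) by move=> _; exact: inO_play.
  exists (lift_play x S o); split; [exact: lft_play| |by move=> n; exact: lft_pi].
  apply: lft_follows => //; last by rewrite /lift_play leqnn eS.
  move=> n nb; rewrite /lift_play; case: leqP => hn; first exact: F0.
  rewrite ifF; last by case: (eqVneq n K.+1) => // e; move: nb; rewrite e /= Keven.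
  have hn2 : (K.+1 < n)%N by case: (eqVneq n K.+1) => [e|]; [move: nb; rewrite e /= Keven|lia].
  have In : legal (x n, Some S, Some o) by apply: (lft_inv px) => // j hj; apply: hI; lia.
  case: (ltnP n J) => nJ; first by apply: inO_skid => //; lia.
  apply: (fixk_s hs px) => //; rewrite F // (@getfirst_play _ _ _ _ j1) // (@getfirst_play _ _ _ _ J) //; last by lia.
  by rewrite nJ (leq_trans hJ nJ).
(* Otherwise the play stays in [VI S], which becomes the opponent's answer. *)
have nA j : (K.+2 <= j)%N -> ~ attr false S hits_D (x j) by move=> hj aj; apply: hC; exists j.
have hV j : (K.+2 <= j)%N -> VI S (x j).
  by move=> hj; split; [apply: Sreach => [|i hi]; [lia|apply: nA; lia]|exact: nA].
have hO := VI_opt (x K.+2) hS.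
exists (lift_play x S (inl (VI S))); split; [exact: lft_play| |by move=> n; exact: lft_pi].
apply: lft_follows => //; last by rewrite /lift_play leqnn eS.
move=> n nb; rewrite /lift_play; case: leqP => hn; first exact: F0.
have hn2 : (K.+1 < n)%N by case: (eqVneq n K.+1) => [e|]; [move: nb; rewrite e /= Keven|lia].
rewrite ifF; last by lia.
by apply: FV => // j hj; apply: hV; lia.
Qed.

Lemma uliftII s x : strat (T := utree) s -> play x -> follows true (uphi true s) x ->
  exists x', [/\ play (T := utree) x', follows (T := utree) true s x' & forall n, upi (x' n) = x n].
Proof.
move=> hs px fx.
pose p1 := x K.+1; pose h a o := s (mk (p1, a, o)); pose U := UII p1 h; pose W := attr true setT U.
have sp1 : sz p1 = K.+1 by exact: (px _).1.
have F0 n : odd n -> (n <= K)%N -> upi (s (mk (x n, None, None))) = x n.+1.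
  move=> nb nK; apply: (fixk_s hs px) => //; first by apply: legal0; rewrite (px n).1.
  by rewrite fx // /uphi /phiII_ (px n).1 nK.
have F n : odd n -> (K < n)%N -> x n.+1 = fixk (x n)
  (phiII_ (x n) p1 h (fun a o => s (mk (x n, a, o)))).
  by move=> nb nK; rewrite [LHS]fx // /uphi anc_play.
have UP S u : quasi_move S p1 -> (sval (h (Some S) None)).2 = Some (inr u) ->
    legal_option S (inr u) (upi (h (Some S) None)).
  by move=> QS; have [ o [e h1 _]] := skid2 hs sp1 QS; rewrite {1}/h e /= => -[eo]; subst o.
have Usz u : U u -> (K.+1 < sz u)%N by case=> S [QS hu]; have [] := UP S u QS hu.
have [Fa Fb] : (forall n, (K < n)%N -> odd n -> forall q, getfirst K.+1 W (x n) = Some q ->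
     getfirst K.+1 U (x n) = None -> x n.+1 = fixk (x n) (attr_move true setT U q (x n))) /\
   (forall n, (K < n)%N -> odd n -> getfirst K.+1 W (x n) = None ->
     x n.+1 = fixk (x n) (if sz (x n) == K.+1 then upi (s (mk (x n, Some (SII p1 h), None)))
       else upi (s (mk (x n, Some (SII p1 h), (sval (h (Some (SII p1 h)) None)).2))))).
  split=> n nK nb; [move=> q eq1 eq2|move=> eq1]; rewrite [LHS]F // /phiII_ (px n).1 leqNgt nK /=.
    by rewrite -/U -/W eq1 eq2.
  by rewrite -/U -/W eq1; case: ifP.
case: (pselect (exists j, (K.+1 <= j)%N /\ W (x j))) => [/nat_min [j1 [hj1 aj1 mj1]]|hC].
  have nU i : (K.+1 <= i < j1)%N -> ~ U (x i) by move=> hi hD; apply: (mj1 i hi); exact: attr_goal.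
  have [||J] := @attr_moveP _ _ _ _ _ aj1 x px; rewrite (px j1).1 //.
    move=> n hn nb hG kt; rewrite (Fa n _ _ (x j1)) //; [by rewrite fixkE|by lia| |].
      by rewrite (@getfirst_play _ _ _ _ j1) // hn.
    rewrite getfirst_none // => i hi.
    by case: (leqP j1 i) => hi2; [apply: hG; lia|apply: nU; lia].
  move=> [hJ UJ mJ _].
  have mJ' i : (K.+1 <= i < J)%N -> ~ U (x i).
    by move=> hi; case: (leqP j1 i) => hi2; [apply: mJ; lia|apply: nU; lia].
  have J2 : (K.+1 < J)%N by rewrite -(px J).1; exact: Usz.
  (* The position reached is what [s] announces against some proposal; the lift lets [false] have
     made that proposal all along. *)
  pose S := proj1_sig (cid UJ); have [QS eS] := proj2_sig (cid UJ); rewrite -/S in QS eS.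
  have eo := UP S _ QS eS.
  pose o : option_move := inr (x J).
  have rE : upi (h (Some S) None) = x K.+2 by case: eo => _ _ <- _; rewrite anc_play //; lia.
  have hO : legal_option S o (x K.+2) by rewrite -rE.
  have hI j : (K.+2 <= j)%N -> compatible o (x j) by move=> _; exact: inO_play.
  exists (lift_play x S o); split; [exact: lft_play| |by move=> n; exact: lft_pi].
  apply: lft_follows => //; last by move=> _; rewrite /lift_play ltnn eqxx.
  move=> n nb; rewrite /lift_play; case: leqP => hn; first exact: F0.
  case: eqP => [e|ne]; first by rewrite e.
  have In : legal (x n, Some S, Some o) by apply: (lft_inv px QS hO) => [|j hj]; [lia|apply: hI; lia].
  case: (ltnP n J) => nJ; first by apply: inO_skid => //; lia.
  apply: (fixk_s hs px) => //; rewrite [LHS]F // /phiII_ (px n).1 leqNgt hn /= -/U -/W.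
  rewrite (@getfirst_play _ _ _ _ j1) // (@getfirst_play _ _ _ _ J) //; last by lia.
  rewrite nJ (leq_trans hJ nJ); case: pselect => // e.
  by rewrite (Prop_irrelevance e UJ).
have nW j : (K.+1 <= j)%N -> ~ W (x j) by move=> hj aj; apply: hC; exists j.
pose S := SII p1 h.
have QS : quasi_move S p1.
  split; first by apply: nW; rewrite leqnn.
  move=> q nq hq; split=> oq.
    by move=> r kr ar; apply: nq; apply: attr_own ar.
  apply: contrapT => hx; apply: nq; apply: attr_other; first by move/negbTE: oq => ->.
  by move=> r kr; apply: contrapT => nr; apply: hx; exists r.
have gN n : getfirst K.+1 W (x n) = None by apply: getfirst_none => // i hi; apply: nW; lia.
have K1 : odd K.+1 by rewrite /= Keven.
have [ o [e hO hI0]] := skid2 hs sp1 QS.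
have rE : upi (h (Some S) None) = x K.+2.
  apply: (fixk_s hs px) => //; first exact: legal1.
  by rewrite [LHS]Fb // sp1 eqxx.
rewrite -/(h (Some S) None) rE in hO hI0.
have eo : (sval (h (Some S) None)).2 = Some o by rewrite /h e.
have FV n : odd n -> (K.+1 < n)%N -> (forall j, (K.+2 <= j <= n)%N -> compatible o (x j)) ->
    upi (s (mk (x n, Some S, Some o))) = x n.+1.
  move=> nb nK hV; apply: (fixk_s hs px) => //; first exact: (lft_inv px).
  by rewrite [LHS]Fb //; [rewrite (px n).1 ifF -/S ?eo //; lia|lia].
(* Against [SII] the strategy cannot announce a position: it would lie in [SII] and also be a goal
   of the attractor that [SII] avoids. *)
have [V eV] : exists V, o = inl V.
  case: o e eo hO hI0 FV => [V|u] e eo hO hI0 FV; first by exists V.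
  exfalso; case: hO => _ h1 _ /(_ (sz u)); rewrite anc_sz => h2.
  apply: (h2 ltac:(lia)); apply: attr_goal; exists S; split=> //.
have hI j : (K.+2 <= j)%N -> compatible o (x j).
  elim/ltn_ind: j => j IH hj; case: (eqVneq j K.+2) => [->//|nj].
  case: j IH hj nj => // m IH hm mK.
  have Ii i : (K.+2 <= i <= m)%N -> compatible o (x i) by move=> hi; apply: IH; lia.
  case om: (odd m).
    have [||_ _] := @skid3 s (x m) S o hs; first by rewrite (px m).1; lia.
      by apply: (lft_inv px QS hO) => //; lia.
    by rewrite FV //; lia.
  have := Ii m ltac:(lia); move: hO; rewrite eV /= => hO Vm.
  have [|_ _ _ h4] := hO _ Vm; first by rewrite (px m).1; lia.
  by apply: h4; [rewrite (px m).1 om|exact: play_kid|apply: nW; lia].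
exists (lift_play x S o); split; [exact: lft_play| |by move=> n; exact: lft_pi].
apply: lft_follows => //; last by move=> _; rewrite /lift_play ltnn eqxx.
move=> n nb; rewrite /lift_play; case: leqP => hn; first exact: F0.
case: eqP => [en|ne]; first by rewrite en.
by apply: FV => //; [lia|move=> j hj; apply: hI; lia].
Qed.

Definition ucover : cover utree T.
Proof.
refine (@Cover utree T upi uphi _ _ _ _ _).
- by [].
- by case=> [[[p a] b] h].
- by move=> b s hs p; exact: fixk_kid.
- by move=> b s s' n hs hs' h p; exact: uphi_loc.
- by case; [exact: uliftII|exact: uliftI].
Defined.

Lemma ucover_k : kcover K ucover.
Proof.
have E (p : utree) : (sz p <= K)%N -> p = mk (upi p, None, None).
  move=> hp; apply: legal_pos_inj; rewrite mkK; last exact: legal0.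
  have := svalP p; move: hp; rewrite /upi /=; case: (sval p) => -[q a] b /= hp.
  by rewrite hp => -[-> ->].
split.
- by move=> p hp; exists (mk (p, None, None)); rewrite /= /upi mkK //; exact: legal0.
- by move=> p q hp /= e; rewrite (E p hp) (E q) ?e //; rewrite -[sz q]/(sz (upi q)) -e.
- move=> b s p hs hp /=; have kp := hs p.
  have e : fixk (upi p) (upi (s (mk (upi p, None, None)))) = upi (s p).
    rewrite -E ?(ltnW hp) // fixkE //; split; first exact: kp.1.
    by rewrite -[in RHS]kp.2; case: (s p) => [[[q a] b'] h].
  have hp' : (sz (upi p) <= K)%N by exact: ltnW.
  by rewrite /uphi; case: b; rewrite /phiII_ /phiI_ hp' e.
Qed.

(** An announced position must be reached and hits [D], while an answer [inl V] keeps all later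
    positions off [D]. Thus the open condition is decided at length [K + 2]. *)
Lemma ucover_dec (x : nat -> utree) : play x ->
  (exists n, D (upi (x n))) <-> exists u, (sval (x K.+2)).2 = Some (inr u).
Proof.
move=> px.
have pp : play (fun n => upi (x n)) by exact: (pi_play ucover px).
have iK : legal (sval (x K.+2)) := svalP _.
have [S [ o eK]] : exists S o, sval (x K.+2) = (upi (x K.+2), Some S, Some o).
  move: iK; have := (px K.+2).1; rewrite /upi /=; case: (sval (x K.+2)) => -[p a] b /= sp.
  by rewrite sp ifF ?ifF; try lia; case=> S [ o [-> -> _ _ _]]; exists S, o.
have ex n : (K.+2 <= n)%N -> sval (x n) = (upi (x n), Some S, Some o).
  move/subnKC <-; elim: (n - K.+2)%N => [|m IH]; first by rewrite addn0.
  rewrite addnS; set N := (K.+2 + m)%N; have [h1 h2] := px N; have h3 := (px N.+1).1.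
  have := congr1 sval h2; rewrite IH /upi /=; move: h3 => /=.
  case: (sval (x N.+1)) => -[p a] b /= sp; rewrite sp ifF ?ifF; try by rewrite /N; lia.
  by case=> _ -> ->.
have II n : (K.+2 <= n)%N -> legal_option S o (upi (x K.+2)) /\ compatible o (upi (x n)).
  move=> hn; have := svalP (x n); rewrite ex // => hi.
  have [|S' [ o' [[<-] [<-] _ h1 h2]]] := legal2E _ hi; first by rewrite (pp n).1.
  split; first by rewrite -(anc_play pp hn).
  by have := h2 n; rewrite (anc_play pp) // (pp n).1; apply; lia.
rewrite eK /=; case: o ex II {eK} => [V|u] ex II; split.
- move=> [n Dn]; exfalso; pose N := maxn n K.+2.
  have [h1 h2] := II N ltac:(lia).
  have [|_ h _ _] := h1 _ h2; first by rewrite (pp N).1; lia.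
  by apply: h; exists n; rewrite (pp N).1 (anc_play pp) //; [split=> //; lia|lia].
- by case=> u.
- by exists u.
- move=> _; have [[[j [hj Dj]] h1 _ _] _] := II K.+2 ltac:(lia).
  have [_ /=] := II (sz u) ltac:(lia).
  rewrite (pp (sz u)).1 leqnn anc_sz => e; exists j; move: Dj.
  by rewrite [in anc _ _]e (anc_play pp).
Qed.
End Unravel.

(* The Baire space serves as the universal standard Borel space. *)
Inductive borelN : set (nat -> nat) -> Prop :=
| borelN_cyl n a : borelN [set z | z n = a]
| borelN_setC A : borelN A -> borelN (~` A)
| borelN_bigcup (A : nat -> set (nat -> nat)) : (forall i, borelN (A i)) -> borelN (\bigcup_i A i).

(** * Unravelling of Borel sets, and determinacy *)

Section Determinacy.
Variable T0 : game_tree.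

Definition tree_map (T : game_tree) (f : T -> T0) :=
  (forall p, sz (f p) = sz p) /\ forall p, f (par p) = par (f p).

(* Upstairs, the payoff set is decided by a single finite position. *)
Definition unravels (T : game_tree) (f : T -> T0) (A : set (nat -> T0)) (k : nat) (T' : game_tree)
    (c : cover T' T) := kcover k c /\
  exists (m : nat) (D : set T'), forall x, play x -> A (fun n => f (pi c (x n))) <-> D (x m).

(** Quantifying over all trees above [T0] and all [k] is the strengthening that lets countable
    unions go through: each set is unravelled on top of the trees already built, leaving ever longer
    initial parts untouched. *)
Definition unravelable (A : set (nat -> T0)) := forall (T : game_tree) (f : T -> T0),
  tree_map f -> forall k, exists (T' : game_tree) (c : cover T' T), unravels f A k c.

Lemma unravelable_cyl m (D : set T0) : unravelable [set x | D (x m)].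
Proof.
move=> T f _ k; exists T, (idcover T); split; first exact: kcover_id.
by exists m, [set p | D (f p)].
Qed.

Lemma unravelable_setC A : unravelable A -> unravelable (~` A).
Proof.
move=> hA T f hf k; have [T' [c [h [m [D hD]]]]] := hA T f hf k; exists T', c; split=> //.
by exists m, (~` D) => x px; have := hD x px => /= h'; split=> nA /h'.
Qed.

(** The [A i] are unravelled one after another, stage [i] changing nothing up to length [K + i]. In
    the inverse limit each of them depends on one position, so the union is open there and one
    auxiliary game finishes. Doubling [k] gives the even level which that game starts from. *)
Lemma unravelable_bigcup (A : nat -> set (nat -> T0)) :
  (forall i, unravelable (A i)) -> unravelable (\bigcup_i A i).
Proof.
move=> hA T f hf k; pose K := k.*2.
have Kev : odd K = false by rewrite odd_double.
pose St := {T : game_tree & {f : T -> T0 | tree_map f}}.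
pose tr (s : St) := projT1 s; pose mp (s : St) : tr s -> T0 := proj1_sig (projT2 s).
have nxt i (s : St) : {s' : St & {c : cover (tr s') (tr s) |
    unravels (@mp s) (A i) (K + i) c /\ forall p, mp s' p = mp s (pi c p)}}.
  have [T' /cid [c hc]] := cid (hA i (tr s) (@mp s) (proj2_sig (projT2 s)) (K + i)%N).
  have hm : tree_map (fun p => mp s (pi c p)).
    have [h1 h2] := proj2_sig (projT2 s); split=> p; first by rewrite h1 pi_sz.
    exact: etrans (congr1 _ (pi_par c p)) (h2 _).
  by exists (existT _ T' (exist _ _ hm)), c.
pose F := fix F i : St := match i with 0 => existT _ T (exist _ f hf)
  | i.+1 => projT1 (nxt i (F i)) end.
pose c i : cover (tr (F i.+1)) (tr (F i)) := proj1_sig (projT2 (nxt i (F i))).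
have hc i : unravels (@mp (F i)) (A i) (K + i) (c i) /\ forall p, mp (F i.+1) p = mp (F i) (pi (c i) p).
  exact: (proj2_sig (projT2 (nxt i (F i)))).
have ck i : kcover (K + i) (c i) by exact: (hc i).1.1.
pose L := limtree ck.
have thE (t : L) i : mp (F i) (sval t i) = f (sval t 0).
  by elim: i => // i IH; rewrite (hc i).2 (svalP t i).
pose m i := proj1_sig (cid (hc i).1.2); pose D i := proj1_sig (cid (proj2_sig (cid (hc i).1.2))).
have hD i := proj2_sig (cid (proj2_sig (cid (hc i).1.2))).
rewrite -/(D _) -/(m _) in hD.
pose D' : set L := [set p : L | exists i, sz p = m i /\ D i (sval p i.+1)].
exists (utree D' Kev), (compcover (ucover D' Kev) (limcover ck)); split.
  by apply: (@kcover_le k K); [rewrite /K; lia|apply: kcover_comp; [exact: ucover_k|exact: limcover_k]].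
exists K.+2, [set p | exists u, (sval p).2 = Some (inr u)] => x px.
apply: iff_trans (@ucover_dec _ _ D' Kev x px) => /=.
have pp : play (fun n => upi (x n)) by exact: (pi_play (ucover D' Kev) px).
have AE i : A i (fun n => f (sval (upi (x n)) 0)) <-> D i (sval (upi (x (m i))) i.+1).
  have := hD i (fun n => sval (upi (x n)) i.+1) _; rewrite -/(D i) -/(m i) => <- //; last first.
    move=> n; split; first by rewrite thr_sz; exact: (pp n).1.
    by have := congr1 sval (pp n).2 => /= <-.
  suff -> : (fun n => f (sval (upi (x n)) 0)) = (fun n => mp (F i) (pi (c i) (sval (upi (x n)) i.+1))) by [].
  by apply/funext => n; rewrite (svalP (upi (x n)) i) thE.
split=> [[i _ /AE h]|[n [i [e h]]]].
  by exists (m i), i; split=> //; exact: (pp _).1.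
by exists i => //; apply/AE; rewrite -e (pp n).1.
Qed.

(** Every play passes length [m], where the outcome is settled. Outside the attractor of the winning
    positions player [true] can always stay outside. *)
Lemma clopen_determined (T : game_tree) m (D : set T) :
  (exists s, strat s /\ forall x, play x -> follows false s x -> D (x m)) \/
  (exists s, strat s /\ forall x, play x -> follows true s x -> ~ D (x m)).
Proof.
pose G : set T := [set p | sz p = m /\ D p]; pose W := attr false setT G.
case: (pselect (W (root T))) => hW; [left|right].
  exists (fun p => fixk p (attr_move false setT G (root T) p)); split.
    by move=> p; exact: fixk_kid.
  move=> x px fx; have := attr_moveP hW px; rewrite sz_root (play0 px) => hm; have [|n [_ [e Dn] _ _]] := hm erefl.
    by move=> n _ nb _ kt; rewrite fx // fixkE.
  by rewrite -e (px n).1.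
have H (p : T) : exists r, kid r p /\ (odd (sz p) -> ~ W p -> ~ W r).
  case: (pselect (exists r, kid r p /\ ~ W r)) => [[r [h1 h2]]|h]; first by exists r.
  have [r kr] := kid_ex p; exists r; split=> // op nW; exfalso; apply: nW; apply: attr_other.
    by rewrite op.
  by move=> r' kr'; apply: contrapT => nr; apply: h; exists r'.
have [s hs] := choice H; exists s; split; first by move=> p; exact: (hs p).1.
move=> x px fx Dm.
have nW n : ~ W (x n).
  elim: n => [|n IH]; first by rewrite (play0 px).
  case on: (odd n); first by rewrite fx //; apply: (hs (x n)).2 => //; rewrite (px n).1.
  by move=> h; apply: IH; apply: attr_own h => //; [rewrite (px n).1|exact: play_kid].
by apply: (nW m); apply: attr_goal; split=> //; exact: (px m).1.
Qed.

Lemma unravelable_determined A : unravelable A ->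
  (exists s, strat s /\ forall x, play x -> follows false s x -> A x) \/
  (exists s, strat s /\ forall x, play x -> follows true s x -> ~ A x).
Proof.
move=> hA; have [T' [c [_ [m [D hD]]]]] := hA T0 id (conj (fun=> erefl) (fun=> erefl)) 0.
case: (clopen_determined m D) => [[s [hs h]]|[s [hs h]]]; [left; exists (phi c false s)|right; exists (phi c true s)].
  split=> [|x px fx]; first exact: phi_strat.
  have [x' [px' fx' ex]] := phi_lift hs px fx.
  suff -> : x = (fun n => id (pi c (x' n))) by apply/(hD x' px'); exact: h.
  by apply/funext => n; rewrite ex.
split=> [|x px fx]; first exact: phi_strat.
have [x' [px' fx' ex]] := phi_lift hs px fx.
suff -> : x = (fun n => id (pi c (x' n))) by move/(hD x' px'); exact: h.
by apply/funext => n; rewrite ex.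
Qed.
End Determinacy.

(** * Games on integer sequences with an arbitrary order of turns *)

Definition seqtree : game_tree.
Proof.
refine (@GameTree (seq nat) size (fun p => take (size p).-1 p) [::] _ _ _ _ _) => //.
- by case.
- by move=> p; rewrite size_take; case: ltnP => //; lia.
- by move=> p; exists (rcons p 0); rewrite size_rcons -cats1 take_size_cat.
Defined.

Lemma mkseq_play (z : nat -> nat) : play (T := seqtree) (mkseq z).
Proof.
move=> n; split; first exact: size_mkseq.
change (take (size (mkseq z n.+1)).-1 (mkseq z n.+1) = mkseq z n).
by rewrite size_mkseq mkseqS -cats1 take_size_cat ?size_mkseq.
Qed.

Lemma borelN_unravelable B : borelN B ->
  @unravelable seqtree [set x | B (fun n => nth 0 (x n.+1) n)].
Proof.
elim=> {B} [n a|A _ IH|A _ IH].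
- exact: (@unravelable_cyl seqtree n.+1 [set p | nth 0 p n = a]).
- exact: (unravelable_setC IH).
- suff -> : [set x | (\bigcup_i A i) (fun n => nth 0 (x n.+1) n)] =
     \bigcup_i [set x : nat -> seqtree | A i (fun n => nth 0 (x n.+1) n)] by exact: unravelable_bigcup.
  by apply/seteqP; split=> x [i _ h]; exists i.
Qed.

Lemma borelN_preim (f : (nat -> nat) -> nat -> nat) B :
  (forall n a, borelN [set z | f z n = a]) -> borelN B -> borelN [set z | B (f z)].
Proof.
move=> hf; elim=> {B} [n a|A _ IH|A _ IH]; [exact: hf|exact: (borelN_setC IH)|].
suff -> : [set z | (\bigcup_i A i) (f z)] = \bigcup_i [set z | A i (f z)] by exact: borelN_bigcup.
by apply/seteqP; split=> x [i _ h]; exists i.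
Qed.

Section Turns.
Variables (who : nat -> bool) (B : set (nat -> nat)).
Hypothesis hB : borelN B.

Definition wins (b : bool) (s : seq nat -> nat) (P : set (nat -> nat)) := forall z,
  (forall n, who n = b -> z n = s (mkseq z n)) -> P z.

Section Ext.
Variables (b : bool) (s : seq nat -> nat).
(* The player not on turn makes a dummy move. *)
Fixpoint ext (z : nat -> nat) (n : nat) : seq nat :=
  if n is m.+1 then
    let e := ext z m in
    let e1 := rcons e (if b then (if who m then 0 else z m) else s e) in
    rcons e1 (if b then s e1 else (if who m then z m else 0))
  else [::].

Lemma size_ext z n : size (ext z n) = n.*2.
Proof. by elim: n => //= n IH; rewrite !size_rcons IH. Qed.

Lemma ext_eq z z' n : (forall i, (i < n)%N -> who i <> b -> z i = z' i) -> ext z n = ext z' n.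
Proof.
elim: n => //= n IH h; rewrite IH => [|i hi]; last by apply: h; lia.
by case: (b) h => h; case w: (who n) => //; rewrite h // w.
Qed.

Definition ext_play z k := nth 0 (ext z k.+1) k.

Lemma ext_extf z n : ext z n = mkseq (ext_play z) n.*2.
Proof.
have aux k m i : (k < m.*2)%N -> nth 0 (ext z (m + i)) k = nth 0 (ext z m) k.
  move=> h; elim: i => [|i IH]; first by rewrite addn0.
  rewrite addnS -IH; set N := (m + i)%N.
  by rewrite /= nth_rcons size_rcons size_ext ifT ?nth_rcons ?size_ext ?ifT //; lia.
have E m k : (k < m.*2)%N -> nth 0 (ext z m) k = ext_play z k.
  move=> h; rewrite /ext_play; case: (leqP m k.+1) => mk.
    by rewrite -(subnKC mk) aux.
  by rewrite -[in LHS](subnKC (ltnW mk)) aux //; lia.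
apply: (@eq_from_nth _ 0); rewrite size_ext ?size_mkseq // => k hk.
by rewrite E // nth_mkseq.
Qed.

Lemma extf_step z n : ext_play z n.*2 = (if b then (if who n then 0 else z n) else s (ext z n)) /\
  ext_play z n.*2.+1 = (if b then s (mkseq (ext_play z) n.*2.+1) else (if who n then z n else 0)).
Proof.
have := ext_extf z n.+1; rewrite [LHS]/= doubleS !mkseqS -ext_extf.
move=> /rcons_inj [/rcons_inj [h1] h2]; split; first by rewrite -h1.
by rewrite -h2 -h1.
Qed.
End Ext.

(** Round [n] becomes the two moves [2n] and [2n + 1] of an alternating game; [who n], read as a
    number, selects the genuine one. *)
Definition merge (x : nat -> nat) n := x (who n + n.*2).

Definition response b s (h : seq nat) : nat :=
  nth 0 (ext b s (nth 0 h) (size h).+1) (b + (size h).*2).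

Lemma response_wins b s (P : set (nat -> nat)) :
  (forall x, (forall n, odd n = b -> x n = s (mkseq x n)) -> P (merge x)) ->
  wins b (response b s) P.
Proof.
move=> h z hz; have [x0 x1] := (fun n => (extf_step b s z n).1, fun n => (extf_step b s z n).2).
have -> : z = merge (ext_play b s z).
  apply/funext => n; rewrite /merge; case: (eqVneq (who n) b) => [wb|].
    rewrite hz // /response size_mkseq wb (@ext_eq b s _ z n.+1) => [|i hi wi].
      by rewrite ext_extf nth_mkseq //; case: (b); lia.
    by rewrite nth_mkseq //; case: (eqVneq i n) wi => [->|]; [rewrite wb|lia].
  by move: (x0 n) (x1 n); case: (who n); case: (b) => //= ->.
apply: h => n nb; have := odd_double_half n; rewrite nb => en.
move: (x0 n./2) (x1 n./2) en; rewrite ext_extf; case: (b); rewrite ?add0n ?add1n => e0 e1 en.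
  by rewrite en in e1.
by rewrite en in e0.
Qed.

Theorem determined : (exists s, wins false s B) \/ (exists s, wins true s (~` B)).
Proof.
have hM : borelN [set x | B (merge x)] by apply: borelN_preim => // n a; exact: borelN_cyl.
have stE (st : seqtree -> seqtree) : strat st -> forall h, st h = rcons h (last 0 (st h)).
  move=> hs h; have [/= h1 h2] := hs h; case: (lastP (st h)) h1 h2 => //= p a.
  by rewrite size_rcons last_rcons /= -cats1 take_size_cat // => _ ->; rewrite cats1.
have fol (st : seqtree -> seqtree) b x : strat st ->
    (forall n, odd n = b -> x n = last 0 (st (mkseq x n))) -> follows (T := seqtree) b st (mkseq x).
  by move=> hs hx n nb; rewrite stE // -hx // mkseqS.
have E x : (fun n => nth 0 (mkseq x n.+1) n) = x by apply/funext => n; rewrite nth_mkseq.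
have [[st [hs h]]|[st [hs h]]] := unravelable_determined (borelN_unravelable hM); [left|right].
  exists (response false (fun h => last 0 (st h))); apply: response_wins => x hx.
  by have := h _ (mkseq_play x) (fol _ _ _ hs hx); rewrite /= E.
exists (response true (fun h => last 0 (st h))); apply: response_wins => x hx.
by have := h _ (mkseq_play x) (fol _ _ _ hs hx); rewrite /= E.
Qed.
End Turns.

(** * Borel sets and codes *)

Record sigalg (T : Type) (S : set (set T)) : Prop := Sigalg {
  sg_setC : forall A, S A -> S (~` A);
  sg_bigcup : forall A : nat -> set T, (forall i, S (A i)) -> S (\bigcup_i A i);
  sg_ex : exists A, S A }.

Lemma borelN_sig : sigalg borelN.
Proof.
split; [exact: borelN_setC|exact: borelN_bigcup|by exists [set z | z 0 = 0]; exact: borelN_cyl].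
Qed.

Section Sigalg.
Variables (T : Type) (S : set (set T)).
Hypothesis hS : sigalg S.

Lemma s_const (P : Prop) : S [set x | P].
Proof.
have hT : S setT.
  have [A SA] := sg_ex hS; rewrite -(setUv A).
  suff -> : A `|` ~` A = \bigcup_i (if i is 0 then A else ~` A).
    by apply: (sg_bigcup hS) => -[|i] //; exact: (sg_setC hS).
  apply/seteqP; split=> x; first by case: (pselect (A x)) => h _; [exists 0|exists 1].
  by move=> _; exact: EM.
case: (pselect P) => h; first by rewrite (_ : [set x | P] = setT) //; apply/seteqP; split=> x.
by rewrite (_ : [set x | P] = ~` setT); [exact: (sg_setC hS)|apply/seteqP; split=> // x []].
Qed.

Lemma s_not P : S [set x | P x] -> S [set x | ~ P x].
Proof. exact: (sg_setC hS). Qed.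

Lemma s_ex (I : countType) (P : I -> T -> Prop) :
  (forall i, S [set x | P i x]) -> S [set x | exists i, P i x].
Proof.
move=> h; rewrite (_ : mkset _ = \bigcup_n [set x | if unpickle n is Some i then P i x else False]).
  by apply: (sg_bigcup hS) => n; case: (unpickle n) => [i|]; [exact: h|exact: s_const].
apply/seteqP; split=> x /= => [[i Pi]|[n _ /=]]; first by exists (pickle i); rewrite //= pickleK.
by case: (unpickle n) => // i; exists i.
Qed.

Lemma s_all (I : countType) (P : I -> T -> Prop) :
  (forall i, S [set x | P i x]) -> S [set x | forall i, P i x].
Proof.
move=> h; rewrite (_ : mkset _ = [set x | ~ exists i, ~ P i x]).
  by apply: s_not; apply: s_ex => i; apply: s_not.
by apply/seteqP; split=> x /= => [h' [i]|h' i]; [apply|apply: contrapT => n; apply: h'; exists i].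
Qed.

Lemma s_and P Q : S [set x | P x] -> S [set x | Q x] -> S [set x | P x /\ Q x].
Proof.
move=> hP hQ; rewrite (_ : mkset _ = [set x | forall b : bool, if b then P x else Q x]).
  by apply: s_all => -[].
by apply/seteqP; split=> x /= => [[h1 h2] []|h] //; split; [exact: (h true)|exact: (h false)].
Qed.

Lemma s_or P Q : S [set x | P x] -> S [set x | Q x] -> S [set x | P x \/ Q x].
Proof.
move=> hP hQ; rewrite (_ : mkset _ = [set x | exists b : bool, if b then P x else Q x]).
  by apply: s_ex => -[].
by apply/seteqP; split=> x /= => [[h|h]|[[] h]]; [exists true|exists false|left|right].
Qed.

Lemma s_imp P Q : S [set x | P x] -> S [set x | Q x] -> S [set x | P x -> Q x].
Proof.
move=> hP hQ; rewrite (_ : mkset _ = [set x | ~ P x \/ Q x]).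
  by apply: s_or => //; exact: s_not.
apply/seteqP; split=> x /= => [h|[//|h _ //]]; case: (pselect (P x)) => hp; [by right; apply: h|by left].
Qed.

Lemma s_iff P Q : S [set x | P x] -> S [set x | Q x] -> S [set x | P x <-> Q x].
Proof. by move=> hP hQ; apply: s_and; exact: s_imp. Qed.

Lemma s_if P Q1 Q2 : S [set x | P x] -> S [set x | Q1 x] -> S [set x | Q2 x] ->
  S [set x | if pselect (P x) then Q1 x else Q2 x].
Proof.
move=> h h1 h2; rewrite (_ : mkset _ = [set x | (P x /\ Q1 x) \/ (~ P x /\ Q2 x)]).
  by apply: s_or; apply: s_and => //; exact: s_not.
by apply/seteqP; split=> x /=; case: pselect => p; [left|right|case=> -[]|case=> -[]].
Qed.
End Sigalg.

Definition mfun (T U : Type) (S : set (set T)) (S' : set (set U)) (f : T -> U) :=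
  forall B, S' B -> S (f @^-1` B).

Lemma mfun_comp T U V S S' S'' (f : T -> U) (g : U -> V) :
  mfun S S' f -> mfun S' S'' g -> mfun S S'' (g \o f).
Proof. by move=> hf hg B hB; apply: (hf (g @^-1` B)); exact: hg. Qed.

Lemma mfunN T S (f : T -> nat -> nat) : sigalg S ->
  (forall n a, S [set x | f x n = a]) -> mfun S borelN f.
Proof.
move=> hS h B; elim=> {B} [n a|A _ IH|A _ IH]; [exact: h|exact: (sg_setC hS)|].
rewrite preimage_bigcup; exact: (sg_bigcup hS).
Qed.

Lemma mfunN_at T S (f : T -> nat -> nat) n a : mfun S borelN f -> S [set x | f x n = a].
Proof. by move=> hf; apply: (hf [set z | z n = a]); exact: borelN_cyl. Qed.

Lemma mfun_reindex (i : nat -> nat) : mfun borelN borelN (fun z => z \o i).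
Proof. apply: mfunN; [exact: borelN_sig|move=> n a; exact: borelN_cyl]. Qed.

(** A Borel isomorphism with a Borel subset of the Baire space; the last clause says that all sets
    of the sigma-algebra are pulled back along the code. *)
Definition coded (X : Type) (S : set (set X)) (c : X -> nat -> nat) :=
  [/\ injective c, borelN (range c), mfun S borelN c &
    forall A, S A -> exists B, borelN B /\ A = c @^-1` B].

Lemma mfun_coded T S X SX (c : X -> nat -> nat) (f : T -> X) :
  coded SX c -> mfun S borelN (c \o f) -> mfun S SX f.
Proof. by move=> [_ _ _ h] hf A /h [B [hB ->]]; exact: (hf B hB). Qed.

Lemma mfun_code T S X SX (c : X -> nat -> nat) (f : T -> X) :
  coded SX c -> mfun S SX f -> mfun S borelN (c \o f).
Proof. by move=> [_ _ h _] hf; apply: mfun_comp hf h. Qed.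

Lemma coded_sig X SX (c : X -> nat -> nat) : coded SX c -> sigalg SX.
Proof.
move=> [_ _ h1 h2]; split.
- by move=> A /h2 [B [hB ->]]; apply: (h1 (~` B)); exact: borelN_setC.
- move=> A hA; have [B hB] := choice (fun i => h2 _ (hA i)).
  rewrite (_ : \bigcup_i A i = c @^-1` (\bigcup_i B i)).
    by apply: h1; apply: borelN_bigcup => i; exact: (hB i).1.
  by rewrite preimage_bigcup; apply: eq_bigcupr => i _; exact: (hB i).2.
- by exists (c @^-1` [set z | z 0 = 0]); apply: h1; exact: borelN_cyl.
Qed.

Lemma s_eq T S X SX (c : X -> nat -> nat) (f g : T -> X) : sigalg S -> coded SX c ->
  mfun S SX f -> mfun S SX g -> S [set t | f t = g t].
Proof.
move=> hS hc hf hg; rewrite (_ : mkset _ = [set t | forall n, exists a, c (f t) n = a /\ c (g t) n = a]).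
  apply: (s_all hS) => n; apply: (s_ex hS) => a; apply: (s_and hS); exact: (mfunN_at _ _ (mfun_code hc _)).
apply/seteqP; split=> t /= => [-> n|h]; first by exists (c (g t) n).
have [ci _ _ _] := hc; apply: ci; apply/funext => n; by have [a [-> ->]] := h n.
Qed.

Lemma codedN : coded borelN (fun z : nat -> nat => z).
Proof.
split=> //; last by move=> A; exists A.
by rewrite (_ : range _ = [set x | True]); [exact: (s_const borelN_sig)|apply/seteqP; split=> // z _; exists z].
Qed.

Lemma s_eqN T S (f g : T -> nat -> nat) : sigalg S -> mfun S borelN f -> mfun S borelN g ->
  S [set t | f t = g t].
Proof. by move=> hS; apply: (s_eq hS codedN). Qed.

Definition pairN (x y : nat -> nat) n := if odd n then y n./2 else x n./2.
Definition evens (z : nat -> nat) n := z n.*2.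
Definition odds (z : nat -> nat) n := z n.*2.+1.
Lemma evens_pairN x y : evens (pairN x y) = x.
Proof. by apply/funext => n; rewrite /evens /pairN odd_double doubleK. Qed.
Lemma odds_pairN x y : odds (pairN x y) = y.
Proof. by apply/funext => n; rewrite /odds /pairN /= odd_double /= uphalf_double. Qed.
Lemma pairN_evens_odds z : pairN (evens z) (odds z) = z.
Proof.
apply/funext => n; rewrite /pairN /evens /odds -[n in RHS]odd_double_half; by case: (odd n).
Qed.
Lemma mfun_pairN T S (f g : T -> nat -> nat) : sigalg S -> mfun S borelN f -> mfun S borelN g ->
  mfun S borelN (fun t => pairN (f t) (g t)).
Proof.
move=> hS hf hg; apply: mfunN => // n a; rewrite /pairN; case: (odd n); [exact: (mfunN_at n./2 a hg)|exact: (mfunN_at n./2 a hf)].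
Qed.
Lemma mfun_evens : mfun borelN borelN evens. Proof. exact: (mfun_reindex double). Qed.
Lemma mfun_odds : mfun borelN borelN odds. Proof. exact: (mfun_reindex (fun n => n.*2.+1)). Qed.

Definition closed_graph (w : (nat -> nat) -> nat -> nat) := forall z v,
  (forall n, exists z', forall i, (i < n)%N -> z' i = z i /\ w z' i = v i) -> w z = v.

(* A finer zero-dimensional Polish topology in which [B] is clopen: [w] has closed
   graph, and its first coordinate decides [B]. *)
Lemma borelN_clopen B : borelN B -> exists w, [/\ mfun borelN borelN w, closed_graph w & forall z, B z <-> w z 0 = 1].
Proof.
elim=> {B} [n a|A _ [w [hw cw Aw]]|A _ IH].
- exists (fun z k => if k is 0 then nat_of_bool (z n == a) else 0); split.
  + apply: (mfunN borelN_sig) => -[|k] b; last exact: (s_const borelN_sig).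
    rewrite (_ : mkset _ = [set z | if pselect (z n = a) then 1 = b else 0 = b]).
      by apply: (s_if borelN_sig); [exact: borelN_cyl|exact: (s_const borelN_sig)|exact: (s_const borelN_sig)].
    by apply/seteqP; split=> z /=; (case: pselect => /= e; [rewrite e eqxx|rewrite (introF eqP e)]).
  + move=> z v h; apply/funext => k; have [z' hz] := h (maxn n k).+1.
    have [e1 e2] := hz n ltac:(lia); have [_ <-] := hz k ltac:(lia); by rewrite -e1.
  + by move=> z; split=> [->|]; [rewrite eqxx|case: eqP].
- exists (fun z k => if k is k'.+1 then w z k' else nat_of_bool (w z 0 != 1)); split.
  + apply: (mfunN borelN_sig) => -[|k] b; last exact: (mfunN_at _ _ hw).
    rewrite (_ : mkset _ = [set z | if pselect (w z 0 = 1) then 0 = b else 1 = b]).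
      by apply: (s_if borelN_sig); [exact: (mfunN_at _ _ hw)|exact: (s_const borelN_sig)|exact: (s_const borelN_sig)].
    by apply/seteqP; split=> z /=; (case: pselect => /= e; [rewrite e|rewrite (introF eqP e)]).
  + move=> z v h; have e : w z = fun k => v k.+1.
      apply: cw => n; have [z' hz] := h n.+1; exists z' => i hi; split; first by apply: (hz i _).1; lia.
      exact: (hz i.+1 hi).2.
    apply/funext => -[|k]; last by rewrite e.
    have [z' hz] := h 2; rewrite e -(hz 0 isT).2 -(hz 1 isT).2 //.
  + by move=> z; rewrite /= Aw; case: eqP.
- have [w hw] := choice IH.
  have hw1 i : mfun borelN borelN (w i) by have [] := hw i.
  have hw2 i : closed_graph (w i) by have [] := hw i.
  have hw3 i z : A i z <-> w i z 0 = 1 by have [] := hw i.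
  pose P z i := `[< w i z 0 = 1 >].
  have least z : exists m : nat * nat, (m.1 = 1 /\ P z m.2 /\ forall j, (j < m.2)%N -> ~~ P z j) \/
      (m = (0, 0) /\ forall j, ~~ P z j).
    case: (pselect (exists j, P z j)) => [h|h]; last by exists (0, 0); right; split=> // j; apply/negP => p; apply: h; exists j.
    exists (1, ex_minn h); left; case: ex_minnP => m hm mm; split=> //=; split=> // j hj.
    by apply/negP => /mm; lia.
  have [m hm] := choice least.
  (* [W] records whether some [A i] contains [z], the least such [i], and every entry of every
     [w i]. The latter entries force limits of graph points to agree also in the first two. *)
  pose W z k := match k with 0 => (m z).1 | 1 => (m z).2 | k.+2 =>
    if unpickle k is Some (i, l) then w i z l else 0 end.
  have bP i : borelN [set z | P z i].
    by rewrite (_ : mkset _ = [set z | w i z 0 = 1]); [exact: (mfunN_at _ _ (hw1 i))|apply/seteqP; split=> z /asboolP].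
  exists W; split.
  + have bm a b : borelN [set z | m z = (a, b)].
      rewrite (_ : mkset _ = [set z | (a = 1 /\ P z b /\ forall j, (j < b)%N -> ~ P z j) \/
         (a = 0 /\ b = 0 /\ forall j, ~ P z j)]).
        apply: (s_or borelN_sig); apply: (s_and borelN_sig); try exact: (s_const borelN_sig);
          apply: (s_and borelN_sig) => //; try exact: (s_const borelN_sig); apply: (s_all borelN_sig) => j.
          by apply: (s_imp borelN_sig); [exact: (s_const borelN_sig)|exact: (s_not borelN_sig)].
        exact: (s_not borelN_sig).
      apply/seteqP; split=> z /=.
        case: (hm z) => [[h1 [h2 h3]] e|[-> h] [<- <-]]; [left|right; split=> //; split=> // j; exact/negP].
        by move: h1 h2 h3; rewrite e /= => -> h2 h3; split=> //; split=> // j /h3 /negP.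
      case=> [[-> [Pb hb]]|[-> [-> h]]]; case: (hm z) => [[h1 [h2 h3]]|[h1 h2]] //; last first.
      * by exfalso; apply: (h _ h2).
      * by exfalso; move: (h2 b); rewrite Pb.
      rewrite [m z]surjective_pairing h1; congr (_, _).
      case: (ltngtP (m z).2 b) => // l; first by exfalso; apply: (hb _ l).
      by move: (h3 _ l); rewrite Pb.
    apply: (mfunN borelN_sig) => -[|[|k]] a /=.
    * rewrite (_ : mkset _ = [set z | exists b, m z = (a, b)]); first by apply: (s_ex borelN_sig) => b.
      by apply/seteqP; split=> z /=; [move=> <-; exists (m z).2; case: (m z)|case=> b ->].
    * rewrite (_ : mkset _ = [set z | exists b, m z = (b, a)]); first by apply: (s_ex borelN_sig) => b.
      by apply/seteqP; split=> z /=; [move=> <-; exists (m z).1; case: (m z)|case=> b ->].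
    * case: (unpickle k) => [[i l]|]; last exact: (s_const borelN_sig).
      by exact: (mfunN_at _ _ (hw1 i)).
  + move=> z v h.
    have hi i l : w i z l = v (pickle (i, l)).+2.
      have e : w i z = fun l => v (pickle (i, l)).+2.
        apply: hw2 => n; have [M hM] : exists M, forall l, (l < n)%N -> (pickle (i, l) < M)%N.
          elim: n => [|n [M hM]]; first by exists 0.
          exists (maxn M (pickle (i, n)).+1) => l'; rewrite ltnS leq_eqVlt => /orP[/eqP ->|/hM]; lia.
        have [z' hz] := h (maxn n M.+2); exists z' => l' hl; split; first by apply: (hz l' _).1; lia.
        have [|_ <-] := hz (pickle (i, l')).+2; first by have := hM l' hl; lia.
        by rewrite /W /= pickleK.
      by rewrite e.
    have eP i z' : w i z' 0 = v (pickle (i, 0)).+2 -> P z' i = P z i.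
      by rewrite /P hi => ->.
    have [k0 hk0] : exists k0, forall j, (j <= v 1)%N -> (pickle (j, 0) < k0)%N.
      elim: (v 1) => [|n [M hM]]; first by exists (pickle (0, 0)).+1 => j; rewrite leqn0 => /eqP ->.
      exists (maxn M (pickle (n.+1, 0)).+1) => l'; rewrite leq_eqVlt => /orP[/eqP ->|/hM]; lia.
    have em : m z = (v 0, v 1).
      have [z' hz] := h k0.+2; have e0 := (hz 0 isT).2; have e1 := (hz 1 isT).2.
      rewrite /W in e0 e1.
      have eqP' j : (j <= v 1)%N -> P z' j = P z j.
        move=> hj; apply: eP; have [|_ <-] := hz (pickle (j, 0)).+2; first by have := hk0 j hj; lia.
        by rewrite /W pickleK.
      case: (hm z') => [[h1 [h2 h3]]|[h1 h2]].
        rewrite [RHS](_ : _ = m z'); last by rewrite -e0 -e1; case: (m z').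
        case: (hm z) => [[g1 [g2 g3]]|[g1 g2]]; last by move: (g2 (v 1)); rewrite -eqP' // -e1 h2.
        rewrite [m z]surjective_pairing [m z']surjective_pairing h1 g1; congr (_, _).
        case: (ltngtP (m z).2 (m z').2) => // l.
          by move: (h3 _ l); rewrite eqP' ?g2 //; lia.
        by move: (g3 _ l); rewrite -eqP' ?h2 //; lia.
      case: (hm z) => [[g1 [g2 g3]]|[g1 g2]]; last by rewrite -e0 -e1 h1 g1.
      (* Approximants with no index contradict a least index of [z]: look far enough to see the
         entry that puts [z] into that [A i]. *)
      exfalso; have [z2 hz2] := h (pickle ((m z).2, 0)).+3.
      have [|_ f] := hz2 (pickle ((m z).2, 0)).+2; first by lia.
      have f0 := (hz2 0 isT).2; rewrite /W pickleK in f f0.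
      case: (hm z2) => [[k1 _]|[_ k2]]; first by move: k1; rewrite f0 -e0 h1.
      by move: (k2 (m z).2); rewrite (eP _ z2) // g2.
    apply/funext => -[|[|k]]; rewrite /W ?em //.
    case ek: (unpickle k) => [[i l]|].
      rewrite hi; have [z2 hz2] := h (maxn k (pickle (i, l))).+3.
      have [|_ <-] := hz2 k.+2; first by lia.
      have [|_ <-] := hz2 (pickle (i, l)).+2; first by lia.
      by rewrite /W ek pickleK.
    have [z2 hz2] := h k.+3; have [|_ <-] := hz2 k.+2; first by lia.
    by rewrite /W ek.
  + move=> z; rewrite /W; split=> [[i _ /hw3 Ai]|].
      case: (hm z) => [[->]//|[_ /(_ i)]]; rewrite /P => /asboolP /(_ Ai) [].
    case: (hm z) => [[_ [/asboolP h _]] _|[-> //]]; exists (m z).2 => //; exact/hw3.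
Qed.

Definition closedN (F : set (nat -> nat)) := forall z,
  (forall n, exists z', F z' /\ mkseq z' n = mkseq z n) -> F z.

Lemma mkseq_eq (z z' : nat -> nat) n : mkseq z' n = mkseq z n <-> forall i, (i < n)%N -> z' i = z i.
Proof.
split=> [e i hi|h]; first by rewrite -(nth_mkseq 0 z' hi) e nth_mkseq.
apply: (@eq_from_nth _ 0); rewrite !size_mkseq // => i hi; by rewrite !nth_mkseq ?h.
Qed.

(* A Borel set is an injective projection of a closed set. *)
Lemma borelN_code R : borelN R -> exists C, [/\ mfun borelN borelN C, forall u, evens (C u) = u &
  closedN [set C u | u in R]].
Proof.
move=> /borelN_clopen [w [hw cw Rw]]; exists (fun u => pairN u (w u)); split.
- by apply: (mfun_pairN borelN_sig) => // B.
- by move=> u; rewrite evens_pairN.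
move=> z h; have e : w (evens z) = odds z.
  apply: cw => n; have [z' [[u Ru <-] /mkseq_eq hz]] := h n.*2.+2; exists u => i hi.
  by split; rewrite -?(hz i.*2) -?(hz i.*2.+1) ?/evens ?/odds -?hz /pairN ?odd_double ?doubleK /= ?odd_double ?uphalf_double //; lia.
exists (evens z); last by rewrite e pairN_evens_odds.
apply/Rw; have [z' [[u /Rw wu <-] /mkseq_eq hz]] := h 2.
by have := hz 1 isT; rewrite /pairN /= wu e => ->.
Qed.

Lemma seq_branch (s : nat -> seq nat) : s 0 = [::] -> (forall n, exists a, s n.+1 = rcons (s n) a) ->
  exists z, forall n, s n = mkseq z n.
Proof.
move=> s0 /choice [z hz]; exists z; elim=> [//|n IH]; by rewrite hz IH mkseqS.
Qed.

(** * Lusin separation and injective images of Borel sets *)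

Section Lusin.
Variables (F F' : set (nat -> nat)) (i i' : nat -> nat).
Definition separated (p : seq nat * seq nat) := exists B, [/\ borelN B,
  forall z, F z -> mkseq z (size p.1) = p.1 -> B (z \o i) &
  forall z, F' z -> mkseq z (size p.2) = p.2 -> ~ B (z \o i')].

Lemma separated_step s s' : (forall a a', separated (rcons s a, rcons s' a')) -> separated (s, s').
Proof.
move=> h; have [B hB] := choice (fun p : nat * nat => h p.1 p.2).
exists [set x | exists a, forall a', B (a, a') x]; split=> /=.
- apply: (s_ex borelN_sig) => a; apply: (s_all borelN_sig) => a'; by have [] := hB (a, a').
- move=> z Fz e; exists (z (size s)) => a'; have [_ + _] := hB (z (size s), a'); apply=> //=.
  by rewrite size_rcons mkseqS e.
- move=> z Fz e [a /(_ (z (size s')))]; have [_ _] := hB (a, z (size s')); apply=> //=.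
  by rewrite size_rcons mkseqS e.
Qed.

(** If the whole sets were inseparable, some pair of one-step extensions would be inseparable again,
    and so on. The two branches obtained lie in [F] and [F'], so their images differ at some
    coordinate, where a cylinder separates after all. *)
Lemma lusin_clos : closedN F -> closedN F' -> (forall z z', F z -> F' z' -> z \o i <> z' \o i') ->
  exists B, [/\ borelN B, forall z, F z -> B (z \o i) & forall z, F' z -> ~ B (z \o i')].
Proof.
move=> cF cF' dis; suff [B [h1 h2 h3]] : separated ([::], [::]) by exists B; split=> // z h; [exact: h2|exact: h3].
apply: contrapT => n0.
have st (p : seq nat * seq nat) : exists q : nat * nat, ~ separated p -> ~ separated (rcons p.1 q.1, rcons p.2 q.2).
  case: (pselect (separated p)) => sp; first by exists (0, 0).
  apply: contrapT => h; apply: sp; case: p h => s s' h; apply: separated_step => a a'.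
  by apply: contrapT => h'; apply: h; exists (a, a').
have [f hf] := choice st.
pose P := fix P n := if n is m.+1 then (rcons (P m).1 (f (P m)).1, rcons (P m).2 (f (P m)).2) else ([::], [::]).
have nP n : ~ separated (P n) by elim: n => // n IH; exact: hf.
have [|n|z hz] := @seq_branch (fun n => (P n).1); [by []|by exists (f (P n)).1|].
have [|n|z' hz'] := @seq_branch (fun n => (P n).2); [by []|by exists (f (P n)).2|].
have Fz : F z.
  apply: cF => n; apply: contrapT => h; apply: (nP n); exists [set x | False]; split=> [|y Fy|y _ _ []].
    exact: (s_const borelN_sig).
  by rewrite hz size_mkseq => e; exfalso; apply: h; exists y.
have Fz' : F' z'.
  apply: cF' => n; apply: contrapT => h; apply: (nP n); exists [set x | True]; split=> [|//|y Fy].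
    exact: (s_const borelN_sig).
  by rewrite hz' size_mkseq => e; exfalso; apply: h; exists y.
have [k hk] : exists k, z (i k) <> z' (i' k).
  by apply: contrapT => h; apply: (dis z z') => //; apply/funext => k; apply: contrapT => h'; apply: h; exists k.
have [N [hN hN']] : exists N, (i k < N)%N /\ (i' k < N)%N by exists (maxn (i k) (i' k)).+1; lia.
apply: (nP N); exists [set x | x k = z (i k)]; split=> /=.
- exact: borelN_cyl.
- by move=> y _; rewrite hz size_mkseq => /mkseq_eq h; rewrite h //; lia.
- by move=> y _; rewrite hz' size_mkseq => /mkseq_eq h; rewrite h //; exact/nesym.
Qed.
End Lusin.

Lemma lusin (D D' : set (nat -> nat)) (i i' : nat -> nat) : borelN D -> borelN D' ->
  (forall u u', D u -> D' u' -> u \o i <> u' \o i') ->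
  exists B, [/\ borelN B, forall u, D u -> B (u \o i) & forall u, D' u -> ~ B (u \o i')].
Proof.
move=> /borelN_code [C [_ eC cC]] /borelN_code [C' [_ eC' cC']] dis.
have E (c : (nat -> nat) -> nat -> nat) j u : evens (c u) = u -> c u \o (fun k => (j k).*2) = u \o j.
  by move=> e; rewrite -[in RHS]e.
have [|B [h1 h2 h3]] := @lusin_clos _ _ (fun k => (i k).*2) (fun k => (i' k).*2) cC cC'.
  by move=> _ _ [u Du <-] [u' Du' <-]; rewrite !E //; exact: dis.
by exists B; split=> // u Du; [rewrite -(E _ C) //; apply: h2|rewrite -(E _ C') //; apply: h3]; exists u.
Qed.

Lemma s_mkseq T S (f : T -> nat -> nat) n s : sigalg S -> mfun S borelN f -> S [set x | mkseq (f x) n = s].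
Proof.
move=> hS hf; rewrite (_ : mkset _ = [set x | size s = n /\ forall k, (k < n)%N -> f x k = nth 0 s k]).
  apply: (s_and hS); first exact: (s_const hS).
  by apply: (s_all hS) => k; apply: (s_imp hS); [exact: (s_const hS)|exact: (mfunN_at _ _ hf)].
apply/seteqP; split=> x /= => [<-|[sn h]].
  by split=> [|k hk]; rewrite ?size_mkseq ?nth_mkseq.
by apply: (@eq_from_nth _ 0); rewrite size_mkseq // => k hk; rewrite nth_mkseq // h.
Qed.

Section LusinSouslin.
Variables (D : set (nat -> nat)) (i : nat -> nat).
Hypothesis (hD : borelN D) (inj : forall u u', D u -> D u' -> u \o i = u' \o i -> u = u').

(** By injectivity the images of the pieces [Ds s] for [s] of one length are disjoint analytic sets,
    hence separated by Borel sets. A point in the resulting scheme then selects a unique branch,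
    which closedness of the coded set turns into a preimage. *)
Lemma lusin_souslin : borelN [set u \o i | u in D].
Proof.
have [C [hC eC cC]] := borelN_code hD.
pose Ds s := [set u | D u /\ mkseq (C u) (size s) = s].
have bDs s : borelN (Ds s) by apply: (s_and borelN_sig) => //; exact: (s_mkseq _ _ borelN_sig).
have sep (p : seq nat * seq nat) : exists B, borelN B /\ (size p.1 = size p.2 -> p.1 <> p.2 ->
    (forall u, Ds p.1 u -> B (u \o i)) /\ forall u, Ds p.2 u -> ~ B (u \o i)).
  case: (pselect (size p.1 = size p.2 /\ p.1 <> p.2)) => [[e n]|h]; last first.
    by exists [set x | True]; split=> [|e n]; [exact: (s_const borelN_sig)|exfalso; exact: h].
  have [|B [h1 h2 h3]] := @lusin _ _ i i (bDs p.1) (bDs p.2); last by exists B.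
  by move=> u u' [Du eu] [Du' eu'] /(inj Du Du') uu; apply: n; rewrite -eu -eu' uu e.
have [B hB] := choice sep.
pose E s := [set x | forall t, size t = size s -> t <> s -> B (s, t) x /\ ~ B (t, s) x].
have Dx s u : Ds s u -> E s (u \o i).
  move=> Du t e n; split; first by apply: ((hB (s, t)).2 (esym e) (nesym n)).1.
  by apply: ((hB (t, s)).2 e n).2.
have uE s t x : size s = size t -> E s x -> E t x -> s = t.
  move=> e Es Et; apply: contrapT => n; have [h _] := Es t (esym e) (nesym n).
  by have [_ +] := Et s e n; apply.
(* The closure of the image of [Ds s]; it supplies points of the piece close to [x], which
   separation alone does not. *)
pose cl s := [set x | forall k, exists q, mkseq x k = q /\ exists u, Ds s u /\ mkseq (u \o i) k = q].
have Dc s u : Ds s u -> cl s (u \o i) by move=> Du k; exists (mkseq (u \o i) k); split=> //; exists u.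
rewrite (_ : [set u \o i | u in D] = [set x | forall n, exists s, size s = n /\
    forall m, (m <= n)%N -> E (take m s) x /\ cl (take m s) x]).
  apply: (s_all borelN_sig) => n; apply: (s_ex borelN_sig) => s; apply: (s_and borelN_sig); first exact: (s_const borelN_sig).
  apply: (s_all borelN_sig) => m; apply: (s_imp borelN_sig); first exact: (s_const borelN_sig).
  apply: (s_and borelN_sig).
    apply: (s_all borelN_sig) => t; do 2 (apply: (s_imp borelN_sig); first exact: (s_const borelN_sig)).
    by apply: (s_and borelN_sig); [exact: (hB _).1|apply: (s_not borelN_sig); exact: (hB _).1].
  apply: (s_all borelN_sig) => k; apply: (s_ex borelN_sig) => q; apply: (s_and borelN_sig); last exact: (s_const borelN_sig).
  by apply: (s_mkseq (f := id) _ _ borelN_sig) => A.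
apply/seteqP; split=> x => [[u Du <-] n|h].
  exists (mkseq (C u) n); rewrite size_mkseq; split=> // m mn.
  have -> : take m (mkseq (C u) n) = mkseq (C u) m by rewrite /mkseq -map_take take_iota (minn_idPl mn).
  by split; [apply: Dx|apply: Dc]; split=> //; rewrite size_mkseq.
have [s hs] := choice h.
have [|n|z hz] := @seq_branch s.
- by apply: size0nil; exact: (hs 0).1.
- have [e1 h1] := hs n; have [e2 h2] := hs n.+1.
  suff -> : s n = take n (s n.+1).
    by exists (nth 0 (s n.+1) n); rewrite -take_nth ?e2 // take_oversize ?e2.
  apply: (@uE _ _ x); first by rewrite size_take e1 e2 ltnS leqnn.
    by have [] := h1 n (leqnn n); rewrite take_oversize ?e1.
  exact: (h2 n (leqnSn n)).1.
have hc n : cl (mkseq z n) x by have [_ /(_ n (leqnn n))[_]] := hs n; rewrite hz take_oversize ?size_mkseq.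
have [|u Du eu] := cC z.
  move=> n; have [q [_ [u [[Du eu] _]]]] := hc n 0; exists (C u); rewrite size_mkseq in eu.
  by split=> //; exists u.
exists u => //; apply/funext => k; rewrite /=.
have [q [e1 [u' [[Du' eu'] e2]]]] := hc (i k).*2.+1 k.+1.
move: e1; rewrite -e2 => /mkseq_eq /(_ k (ltnSn k)) => e1; rewrite e1 /=.
rewrite size_mkseq in eu'; move/mkseq_eq: eu' => /(_ (i k).*2 (ltnSn _)); rewrite -eu.
by rewrite -[C u' _]/(evens (C u') (i k)) -[C u _]/(evens (C u) (i k)) !eC => ->.
Qed.
End LusinSouslin.

(** * Borel sets with countable sections *)

(* [evens] and [odds] are the coordinates of a plane; a thin set is a graph. *)
Definition thin (Q : set (nat -> nat)) := forall z z', Q z -> Q z' -> evens z = evens z' -> z = z'.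

(** On an analytic graph, the points whose entry at [p.1] is [p.2] and those where it is not have
    disjoint projections. Borel sets separating these projections, for all [p], define a Borel graph
    around the given one. *)
Lemma thin_analytic (D : set (nat -> nat)) (i : nat -> nat) : borelN D ->
  thin [set u \o i | u in D] -> exists Q, [/\ borelN Q, thin Q & forall u, D u -> Q (u \o i)].
Proof.
move=> hD th; pose Dn (p : nat * nat) := [set u | D u /\ u (i p.1) = p.2].
pose Dn' (p : nat * nat) := [set u | D u /\ ~ u (i p.1) = p.2].
have sep p : exists B, [/\ borelN B, forall u, Dn p u -> B (u \o (i \o double)) &
    forall u, Dn' p u -> ~ B (u \o (i \o double))].
  apply: lusin.
  - by apply: (s_and borelN_sig) => //; exact: borelN_cyl.
  - by apply: (s_and borelN_sig) => //; apply: (s_not borelN_sig); exact: borelN_cyl.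
  move=> u u' [Du eu] [Du' eu'] e; apply: eu'; rewrite -eu.
  by have /(congr1 (fun f => f p.1)) /= -> := th (u \o i) (u' \o i) (imageP _ Du) (imageP _ Du') e.
have [B hB] := choice sep.
exists [set u | forall p : nat * nat, u p.1 = p.2 <-> B p (evens u)]; split.
- apply: (s_all borelN_sig) => p; apply: (s_iff borelN_sig); first exact: borelN_cyl.
  by apply: mfun_evens; have [] := hB p.
- move=> z z' h h' e; apply/funext => n; apply/esym.
  by apply/(h' (n, z n)); rewrite -e; apply/(h (n, z n)).
- move=> u Du p; have [_ h1 h2] := hB p; split=> [e|]; first by apply: (h1 u).
  by move=> Bu; apply: contrapT => ne; apply: (h2 u).
Qed.

Section ThinCover.
Variable R : set (nat -> nat).
Hypothesis bR : borelN R.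
Variable C : (nat -> nat) -> nat -> nat.
Hypotheses (hC : mfun borelN borelN C) (eC : forall u, evens (C u) = u) (cC : closedN [set C u | u in R]).

Definition fibre (r : nat) (L : nat -> seq nat) (v : nat -> nat -> nat) :=
  forall i, (i < r)%N -> [/\ R (v i), mkseq (C (v i)) (size (L i)) = L i & evens (v i) = evens (v 0)].

(* [small r L]: countably many thin Borel sets meet every tuple of points of R
   in a common fibre whose i-th entry has a code extending [L i]. *)
Definition small r L := exists Q : nat -> set (nat -> nat), (forall k, borelN (Q k) /\ thin (Q k)) /\
  forall v, fibre r L v -> exists i, (i < r)%N /\ exists k, Q k (v i).

Definition tuple_ext (s t : seq nat) := take (size s) t = s /\ (size s < size t)%N.
Definition incompatible (s t : seq nat) := exists k,
  [/\ (k.*2 < size s)%N, (k.*2 < size t)%N & nth 0 s k.*2 <> nth 0 t k.*2].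
Definition update (L : nat -> seq nat) p t i := if i == p then t else L i.

Lemma update_eq L p t : update L p t p = t. Proof. by rewrite /update eqxx. Qed.
Lemma update_ne L p t i : i <> p -> update L p t i = L i. Proof. by rewrite /update; case: eqP. Qed.

Lemma small_cnt (I : countType) (Q : I -> set (nat -> nat)) r L :
  (forall k, borelN (Q k) /\ thin (Q k)) ->
  (forall v, fibre r L v -> exists i, (i < r)%N /\ exists k, Q k (v i)) -> small r L.
Proof.
move=> hQ h; exists (fun n => if unpickle n is Some k then Q k else [set x | False]); split.
  by move=> n; case: (unpickle n) => [k|] //; split=> //; exact: (s_const borelN_sig).
by move=> v /h [i [hi [k Qk]]]; exists i; split=> //; exists (pickle k); rewrite pickleK.
Qed.

(** If all splittings of entry [p] were small, discard the tuples met by their countably many thin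
    sets. Two remaining tuples over the same point could not differ in entry [p], so these entries
    form an analytic thin set, and one more thin Borel set covers them. *)
Lemma small_split r L p : (p < r)%N -> ~ small r L -> exists t0 t1,
  [/\ tuple_ext (L p) t0, tuple_ext (L p) t1, incompatible t0 t1 & ~ small r.+1 (update (update L p t0) r t1)].
Proof.
move=> pairN nS; apply: contrapT => hn; apply: nS.
have small01 (t : seq nat * seq nat) : exists Q : nat -> set (nat -> nat), (forall k, borelN (Q k) /\ thin (Q k)) /\
    (tuple_ext (L p) t.1 -> tuple_ext (L p) t.2 -> incompatible t.1 t.2 ->
     forall v, fibre r.+1 (update (update L p t.1) r t.2) v -> exists i, (i < r.+1)%N /\ exists k, Q k (v i)).
  case: (pselect (small r.+1 (update (update L p t.1) r t.2))) => [[Q [h1 h2]]|ns]; first by exists Q.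
  exists (fun _ => [set x | False]); split.
    by split=> //; exact: (s_const borelN_sig).
  by move=> e0 e1 ic; exfalso; apply: hn; exists t.1, t.2.
have [Q hQ] := choice small01.
pose dec (v : nat -> nat) (i : nat) := v \o (fun n : nat => pickle (i, n)).
have mdec i : mfun borelN borelN (dec ^~ i) by exact: mfun_reindex.
pose D := [set v | fibre r L (dec v) /\ forall i, (i < r)%N -> forall t k, ~ Q t k (dec v i)].
have bD : borelN D.
  apply: (s_and borelN_sig).
    apply: (s_all borelN_sig) => i; apply: (s_imp borelN_sig); first exact: (s_const borelN_sig).
    rewrite (_ : mkset _ = [set v | R (dec v i) /\ mkseq (C (dec v i)) (size (L i)) = L i /\ evens (dec v i) = evens (dec v 0)]).
      apply: (s_and borelN_sig); first exact: (mdec i _ bR).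
      apply: (s_and borelN_sig); first by apply: (s_mkseq _ _ borelN_sig); exact: mfun_comp (mdec i) hC.
      by apply: (s_eqN borelN_sig); [exact: mfun_comp (mdec i) mfun_evens|exact: mfun_comp (mdec 0) mfun_evens].
    by apply/seteqP; split=> v /= [h1]; [move=> h2 h3; split|case=> h2 h3; split].
  apply: (s_all borelN_sig) => i; apply: (s_imp borelN_sig); first exact: (s_const borelN_sig).
  do 2 apply: (s_all borelN_sig) => ?; apply: (s_not borelN_sig); apply: (mdec i); exact: ((hQ _).1 _).1.
have th : thin [set u \o (fun n => pickle (p, n)) | u in D].
  move=> _ _ [a [fa na] <-] [b [fb nb] <-]; rewrite -/(dec a p) -/(dec b p) => e.
  apply: contrapT => ne.
  have [k hk] : exists k, dec a p k <> dec b p k.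
    by apply: contrapT => h; apply: ne; apply/funext => k; apply: contrapT => h'; apply: h; exists k.
  have [_ ea xa] := fa p pairN; have [_ eb xb] := fb p pairN.
  pose N := (maxn (size (L p)) k.*2).+1.
  pose t0 := mkseq (C (dec a p)) N; pose t1 := mkseq (C (dec b p)) N.
  have tk c : take (size (L p)) (mkseq c N) = mkseq c (size (L p)).
    rewrite /mkseq -map_take take_iota (minn_idPl _) // /N; lia.
  have x0 : tuple_ext (L p) t0 by split; rewrite ?tk // size_mkseq /N; lia.
  have x1 : tuple_ext (L p) t1 by split; rewrite ?tk // size_mkseq /N; lia.
  have kN : (k.*2 < N)%N by rewrite /N; lia.
  have ic : incompatible t0 t1.
    exists k; rewrite !size_mkseq; split=> //; rewrite !nth_mkseq //.
    by rewrite -[C _ _]/(evens (C _) k) -[C (dec b p) _]/(evens (C _) k) !eC.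
  have [|i [hi [m Qm]]] := (hQ (t0, t1)).2 x0 x1 ic (fun i => if i == r then dec b p else dec a i).
    have z0 : (0 == r) = false by lia.
    move=> i; rewrite /update z0; case: (eqVneq i r) => [-> _|nir hi].
      by have [Rb _ _] := fb p pairN; split=> //; rewrite ?size_mkseq // -e.
    have [|Ra ea' xa'] := fa i; [lia|split=> //].
    by case: eqP => [->|_] //; rewrite size_mkseq.
  case: (eqVneq i r) Qm => [_|ni] Qm; first exact: (nb p pairN (t0, t1) m).
  by apply: (na i _ (t0, t1) m) => //; lia.
have [Q' [bQ' tQ' hQ']] := thin_analytic bD th.
apply: (@small_cnt (option ((seq nat * seq nat) * nat)%type)
  (fun o => if o is Some q then Q q.1 q.2 else Q')).
  by case=> [[t k]|] //=; exact: (hQ t).1.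
move=> v fv; apply: contrapT => h.
pose a n := if (unpickle n : option (nat * nat)) is Some ik then v ik.1 ik.2 else 0.
have da i : dec a i = v i by apply/funext => n; rewrite /dec /a /= pickleK.
have Da : D a.
  split; first by move=> i ir; rewrite !da; exact: fv.
  by move=> i ir t k; rewrite da => Qt; apply: h; exists i; split=> //; exists (Some (t, k)).
by apply: h; exists p; split=> //; exists None; rewrite -da; exact: hQ'.
Qed.

Lemma small_level r L : ~ small r L -> exists L', ~ small (r + r) L' /\
  forall p, (p < r)%N -> [/\ tuple_ext (L p) (L' p), tuple_ext (L p) (L' (r + p)%N) & incompatible (L' p) (L' (r + p)%N)].
Proof.
move=> nS; suff H j : (j <= r)%N -> exists L', [/\ ~ small (r + j) L',
    forall p, (p < j)%N -> [/\ tuple_ext (L p) (L' p), tuple_ext (L p) (L' (r + p)%N) & incompatible (L' p) (L' (r + p)%N)] &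
    forall p, (j <= p < r)%N -> L' p = L p].
  by have [L' [h1 h2 _]] := H r (leqnn r); exists L'.
elim: j => [|j IH] hj; first by exists L; rewrite addn0.
have [L' [h1 h2 h3]] := IH (ltnW hj).
have [|t0 [t1 [e0 e1 ic nS']]] := @small_split (r + j) L' j _ h1; first by lia.
rewrite h3 in e0 e1; last by lia.
exists (update (update L' j t0) (r + j)%N t1); split; first by rewrite addnS.
  move=> p; rewrite ltnS leq_eqVlt => /orP[/eqP ->|].
    by rewrite (update_ne _ t1) ?update_eq //; lia.
  move=> pj; rewrite (update_ne _ t1 (i := p)) ?(update_ne _ t0 (i := p)); try lia.
  by rewrite (update_ne _ t1) ?(update_ne _ t0); try lia; exact: h2.
move=> p hp; rewrite (update_ne _ t1) ?(update_ne _ t0); try lia.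
by apply: h3; lia.
Qed.

Hypothesis cnt : forall x, exists e : nat -> nat -> nat, forall u, R u -> evens u = x -> exists n, u = e n.

(** Otherwise repeated splitting builds a binary tree of code segments whose branches are points of
    [R] in one common fibre. A branch can avoid any given sequence, against countability of the
    fibres. *)
Lemma small_all : small 1 (fun=> [::]).
Proof.
apply: contrapT => nS0.
have st (q : nat * (nat -> seq nat)) : exists L', ~ small q.1 q.2 -> ~ small (q.1 + q.1) L' /\
  forall p, (p < q.1)%N -> [/\ tuple_ext (q.2 p) (L' p), tuple_ext (q.2 p) (L' (q.1 + p)%N) & incompatible (L' p) (L' (q.1 + p)%N)].
  case: (pselect (small q.1 q.2)) => h; first by exists q.2.
  by have [L' hL] := small_level h; exists L'.
have [f hf] := choice st.
pose F := fix F n := if n is m.+1 then f (2 ^ m, F m) else fun=> [::].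
have nS n : ~ small (2 ^ n) (F n).
  by elim: n => //= n IH; rewrite expnS mul2n -addnn; exact: (hf (2 ^ n, F n) IH).1.
have FS n p : (p < 2 ^ n)%N -> [/\ tuple_ext (F n p) (F n.+1 p), tuple_ext (F n p) (F n.+1 (2 ^ n + p)%N)
    & incompatible (F n.+1 p) (F n.+1 (2 ^ n + p)%N)] by move=> hp; exact: (hf (2 ^ n, F n) (nS n)).2.
have inh n : exists v, fibre (2 ^ n) (F n) v.
  apply: contrapT => h; apply: (nS n); exists (fun=> [set x | False]); split.
    by split=> //; exact: (s_const borelN_sig).
  by move=> v fv; exfalso; apply: h; exists v.
pose path (q : nat -> nat) := q 0 = 0 /\ forall n, q n.+1 = q n \/ q n.+1 = (2 ^ n + q n)%N.
have plt q n : path q -> (q n < 2 ^ n)%N.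
  by move=> [q0 qs]; elim: n => [|n IH]; [rewrite q0|rewrite expnS; case: (qs n) => ->; lia].
have pex q n : path q -> tuple_ext (F n (q n)) (F n.+1 (q n.+1)).
  by move=> pq; have [h1 h2 _] := FS n _ (plt q n pq); case: (pq.2 n) => ->.
have lim q : path q -> exists u, R u /\ forall n, mkseq (C u) (size (F n (q n))) = F n (q n).
  move=> pq; pose z i := nth 0 (F i.+1 (q i.+1)) i.
  have ssz n : (n <= size (F n (q n)))%N by elim: n => // n IH; have [_ h] := pex q n pq; lia.
  have tk n m : take (size (F n (q n))) (F (n + m) (q (n + m)%N)) = F n (q n) /\
      (size (F n (q n)) <= size (F (n + m) (q (n + m)%N)))%N.
    elim: m => [|m [IH IHs]]; first by rewrite addn0 take_size.
    rewrite addnS; have [h1 h2] := pex q (n + m)%N pq; split; last by lia.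
    by rewrite -[RHS]IH -[in RHS]h1 take_takel.
  have zE n : mkseq z (size (F n (q n))) = F n (q n).
    apply: (@eq_from_nth _ 0); rewrite size_mkseq // => i hi; rewrite nth_mkseq // /z.
    case: (leqP n i.+1) => ni.
      by have [<- _] := tk n (i.+1 - n)%N; rewrite subnKC // nth_take.
    have [<- _] := tk i.+1 (n - i.+1)%N; rewrite subnKC ?(ltnW ni) // nth_take //; exact: ssz.
  have [|u Ru eu] := cC (z := z); last by exists u; rewrite eu.
  move=> n; have [v fv] := inh n; have [Rv ev' _] := fv (q n) (plt q n pq).
  exists (C (v (q n))); split; first by exists (v (q n)).
  have /mkseq_eq h := etrans ev' (esym (zE n)).
  by apply/mkseq_eq => i hi; apply: h; have := ssz n; lia.
have evE q q' u u' : path q -> path q' ->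
    (forall n, mkseq (C u) (size (F n (q n))) = F n (q n)) ->
    (forall n, mkseq (C u') (size (F n (q' n))) = F n (q' n)) -> evens u = evens u'.
  move=> pq pq' hu hu'; apply/funext => k; pose n := (k.*2.*2).+1.
  have [v fv] := inh n; have [_ e1 x1] := fv _ (plt q n pq); have [_ e2 x2] := fv _ (plt q' n pq').
  have ssz q2 : path q2 -> forall n, (n <= size (F n (q2 n)))%N.
    by move=> pq2; elim=> // m IH; have [_ h] := pex q2 m pq2; lia.
  have C1 : C u k.*2.*2 = C (v (q n)) k.*2.*2.
    by have /mkseq_eq := etrans (hu n) (esym e1); apply; have := ssz q pq n; rewrite /n; lia.
  have C2 : C u' k.*2.*2 = C (v (q' n)) k.*2.*2.
    by have /mkseq_eq := etrans (hu' n) (esym e2); apply; have := ssz q' pq' n; rewrite /n; lia.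
  rewrite -(eC u) -(eC u') /evens C1 C2 -[C _ _]/(evens (C (v (q n))) k.*2) -[C _ _]/(evens (C (v (q' n))) k.*2) !eC.
  by have := congr1 (fun g => g k) (etrans x1 (esym x2)).
have p0 : path (fun=> 0) by split=> // n; left.
have [u0 [Ru0 hu0]] := lim _ p0.
have [e he] := cnt (evens u0).
pose comp t u := forall k, (k.*2 < size t)%N -> nth 0 t k.*2 = u k.
(* Diagonalization: at level [m] the branch takes a sibling incompatible with [e m]. *)
pose q := fix q n := if n is m.+1 then
  if `[< comp (F m.+1 (2 ^ m + q m)%N) (e m) >] then q m else (2 ^ m + q m)%N else 0.
have pq : path q by split=> // n /=; case: ifP => _; [left|right].
have [u [Ru hu]] := lim _ pq.
have [n un] := he u Ru (evE _ _ _ _ pq p0 hu hu0).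
have cu : comp (F n.+1 (q n.+1)) u.
  move=> k hk; rewrite -(hu n.+1) nth_mkseq //; by rewrite -[C u _]/(evens (C u) k) eC.
move: cu; rewrite [q n.+1]/=; case: asboolP => [c1|nc]; last by rewrite un.
move=> c0; have [_ _ [k [k1 k2]]] := FS n _ (plt q n pq); apply.
by rewrite c0 // c1 // un.
Qed.
End ThinCover.

(** The Lusin-Novikov theorem: smallness for tuples of length one, with no condition on the code. *)
Lemma thin_cover R : borelN R ->
  (forall x, exists e : nat -> nat -> nat, forall u, R u -> evens u = x -> exists n, u = e n) ->
  exists Q : nat -> set (nat -> nat), (forall k, borelN (Q k) /\ thin (Q k)) /\ R = \bigcup_k Q k.
Proof.
move=> bR cnt; have [C [hC eC cC]] := borelN_code bR.
have [Q [hQ h]] := small_all bR hC eC cC cnt.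
exists (fun k => Q k `&` R); split=> [k|].
  split; first by apply: (s_and borelN_sig) => //; exact: (hQ k).1.
  by move=> z z' [h1 _] [h2 _]; exact: (hQ k).2.
apply/seteqP; split=> [u Ru|u [k _ []] //].
have [|[|i] [//= _ [k Qk]]] := h (fun=> u); first by move=> i _; split.
by exists k.
Qed.

Lemma cnt_enum (T : Type) (A : set T) (t0 : T) : countable A ->
  exists e : nat -> T, forall a, A a -> exists n, a = e n.
Proof.
move=> /countable_injP [f finj].
exists (fun n => if pselect (exists b, A b /\ f b = n) is left h then proj1_sig (cid h) else t0).
move=> a Aa; exists (f a); case: pselect => [h|h]; last by exfalso; apply: h; exists a.
by case: cid => b [Ab e] /=; apply: finj; rewrite ?inE.
Qed.

Lemma coded_psi (X : Type) (S : set (set X)) (c : X -> nat -> nat) (x0 : X) : coded S c ->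
  exists psi : (nat -> nat) -> X, mfun borelN S psi /\ forall x, psi (c x) = x.
Proof.
move=> [ci crg cm cA].
have H z : exists x, (exists2 x', c x' = z & x = x') \/ (~ range c z /\ x = x0).
  case: (pselect (range c z)) => [[x _ cx]|h]; last by exists x0; right.
  by exists x; left; exists x.
have [psi hp] := choice H.
have pK x : psi (c x) = x.
  case: (hp (c x)) => [[x' cx ->]|[h _]]; first exact: ci.
  by exfalso; apply: h; exists x.
exists psi; split=> // A /cA [B [bB eA]].
rewrite (_ : psi @^-1` A = [set z | (range c z /\ B z) \/ (~ range c z /\ A x0)]).
  apply: (s_or borelN_sig); apply: (s_and borelN_sig) => //; last exact: (s_const borelN_sig).
  exact: (s_not borelN_sig).
apply/seteqP; split=> z /=.
  by case: (hp z) => [[x <- ->]|[h ->]] Ax; [left; split; [exists x|rewrite eA in Ax]|right].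
by case: (hp z) => [[x <- ->]|[h ->]] [[h1 h2]|[h1 h2]] //; [rewrite eA|exfalso; apply: h1; exists x].
Qed.

Section ThinFun.
Variables (X Y : Type) (SX : set (set X)) (SY : set (set Y)) (c : X -> nat -> nat) (c' : Y -> nat -> nat).
Hypotheses (hc : coded SX c) (hc' : coded SY c').

(** The domain of the partial function with graph [Q] is an injective projection, hence Borel, so
    [f0] can be used outside it. *)
Lemma thin_fun (Q : set (nat -> nat)) (f0 : X -> Y) : borelN Q -> thin Q -> mfun SX SY f0 ->
  (forall u, Q u -> range c' (odds u)) ->
  exists f : X -> Y, [/\ mfun SX SY f, forall x u, Q u -> evens u = c x -> c' (f x) = odds u &
    forall x, (exists u, Q u /\ evens u = c x) \/ f x = f0 x].
Proof.
move=> bQ tQ mf0 rQ; have sX := coded_sig hc; have [ci _ cm _] := hc; have [ci' _ _ cA'] := hc'.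
have H x : exists y, (forall u, Q u -> evens u = c x -> c' y = odds u) /\ ((exists u, Q u /\ evens u = c x) \/ y = f0 x).
  case: (pselect (exists u, Q u /\ evens u = c x)) => [[u [Qu eu]]|h].
    have [y _ ey] := rQ u Qu; exists y; split; last by left; exists u.
    by move=> u' Qu' eu'; rewrite ey (tQ u u') // eu.
  by exists (f0 x); split; [move=> u Qu eu; exfalso; apply: h; exists u|right].
have [f hf] := choice H; exists f; split; last by move=> x; exact: (hf x).2.
  have im (Q' : set (nat -> nat)) : borelN Q' -> SX [set x | exists u, Q u /\ Q' u /\ evens u = c x].
    move=> bQ'; rewrite (_ : mkset _ = c @^-1` [set u \o double | u in Q `&` Q']).
      apply: cm; apply: lusin_souslin; first by apply: (s_and borelN_sig).
      by move=> u u' [Qu _] [Qu' _]; exact: tQ.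
    by apply/seteqP; split=> x /= [u]; [case=> [h1 [h2 h3]]; exists u|case=> h1 h2 h3; exists u].
  move=> A SA; have [B' [bB' eA]] := cA' A SA.
  rewrite (_ : f @^-1` A = [set x | (exists u, Q u /\ B' (odds u) /\ evens u = c x) \/
    (~ (exists u, Q u /\ True /\ evens u = c x) /\ A (f0 x))]).
    apply: (s_or sX); first exact: (im _ (mfun_odds bB')).
    apply: (s_and sX); last exact: mf0.
    by apply: (s_not sX); apply: (im [set u | True]); exact: (s_const borelN_sig).
  have fB x u : Q u -> evens u = c x -> A (f x) <-> B' (odds u).
    by move=> Qu eu; rewrite -((hf x).1 u Qu eu) eA.
  apply/seteqP; split=> x /=.
    case: (pselect (exists u, Q u /\ evens u = c x)) => [[u [Qu eu]] Af|h Af].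
      by left; exists u; split=> //; split=> //; apply/(fB x).
    right; split; first by case=> u [Qu [_ eu]]; apply: h; exists u.
    by case: (hf x).2 => // e; rewrite -e.
  case=> [[u [Qu [Bu eu]]]|[h Af0]]; first by apply/(fB x u).
  by case: (hf x).2 => [[u [Qu eu]]|->] //; exfalso; apply: h; exists u.
by move=> x u; exact: (hf x).1.
Qed.
End ThinFun.

(** Takes the place of the Feldman-Moore theorem. The maps need not be bijections, so composites and
    inverses are later available only pointwise. *)
Lemma cber_maps (Y : Type) (SY : set (set Y)) (c : Y -> nat -> nat) (E : Y -> Y -> Prop) B :
  coded SY c -> borelN B -> (forall x y, E x y <-> B (pairN (c x) (c y))) ->
  (forall x, E x x) -> (forall x, countable [set y | E x y]) ->
  exists g : nat -> Y -> Y, [/\ forall y, g 0 y = y, forall m, mfun SY SY (g m) &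
    forall x y, E x y <-> exists m, g m x = y].
Proof.
move=> hc bB EB Er cE; have [ci crg cm cA] := hc.
pose R := [set z | B z /\ range c (evens z) /\ range c (odds z)].
have bR : borelN R by apply: (s_and borelN_sig) => //; apply: (s_and borelN_sig); [exact: (mfun_evens crg)|exact: (mfun_odds crg)].
have [x|Q [hQ RQ]] := thin_cover bR.
  case: (pselect (range c x)) => [[y _ <-]|nx]; last first.
    by exists (fun _ _ => 0) => u [_ [rx _]] ex; exfalso; apply: nx; rewrite -ex.
  have [e he] := cnt_enum y (cE y); exists (fun n => pairN (c y) (c (e n))) => u [Bu [_ [y' _ ey']]] eu.
  have [|n en] := he y'; first by apply/EB; rewrite -eu ey' pairN_evens_odds.
  by exists n; rewrite -en -eu ey' pairN_evens_odds.
have idm : mfun SY SY id by move=> A.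
have H k : exists f : Y -> Y, [/\ mfun SY SY f, forall x u, Q k u -> evens u = c x -> c (f x) = odds u &
    forall x, E x (f x)].
  have [|f [h1 h2 h3]] := thin_fun hc hc (hQ k).1 (hQ k).2 idm.
    by move=> u Qu; have [_ [_ +]] : R u by rewrite RQ; exists k.
  exists f; split=> // x; case: (h3 x) => [[u [Qu eu]]|-> //].
  apply/EB; rewrite (h2 x u Qu eu) -eu pairN_evens_odds.
  by have [] : R u by rewrite RQ; exists k.
have [f hf] := choice H.
exists (fun m => if m is k.+1 then f k else id); split=> //.
  by case=> [|k] //; have [] := hf k.
move=> x y; split=> [/EB Bxy|[[|k] <-] //]; last by have [_ _] := hf k.
have : R (pairN (c x) (c y)) by split=> //; rewrite evens_pairN odds_pairN; split; [exists x|exists y].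
rewrite RQ => -[k _ Qk]; exists k.+1; have [_ h2 _] := hf k; apply: ci.
by rewrite (h2 x _ Qk) ?evens_pairN ?odds_pairN.
Qed.

(** * The space of labelled trees *)

Section Words.
Variables (I : countType) (i0 : I).
Variables (Y : Type) (SY : set (set Y)) (e : Y -> nat -> nat).
Hypothesis he : coded SY e.
Variable g : nat -> Y -> Y.
Hypotheses (g0 : forall y, g 0 y = y) (gM : forall m, mfun SY SY (g m))
  (gC : forall n m y, exists k, g k y = g n (g m y)) (gV : forall m y, exists n, g n (g m y) = y).

Definition word := seq (I * nat).
(* At the vertex reached along the word [w], [(z w i).1] is the position in the
   i-th copy of [Y] and [(z w i).2] a free label; the letter [(i, m)] moves by
   [g m] in the i-th copy. *)
Definition labelling := word -> I -> Y * (nat -> nat).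

Definition labelling_code (z : labelling) k := if (unpickle k : option (word * I * nat)) is Some (w, i, n)
  then pairN (e (z w i).1) (z w i).2 n else 0.
Definition labelling_sets : set (set labelling) := [set A | exists B, borelN B /\ A = labelling_code @^-1` B].

Lemma labelling_codeK z w i n : labelling_code z (pickle (w, i, n)) = pairN (e (z w i).1) (z w i).2 n.
Proof. by rewrite /labelling_code pickleK. Qed.

Lemma labelling_coded : coded labelling_sets labelling_code.
Proof.
have [ei erg _ _] := he; split.
- move=> z z' h; apply/funext => w; apply/funext => i.
  have h' : pairN (e (z w i).1) (z w i).2 = pairN (e (z' w i).1) (z' w i).2.
    by apply/funext => n; rewrite -!labelling_codeK h.
  have /ei h1 : e (z w i).1 = e (z' w i).1 by rewrite -(evens_pairN (e (z w i).1) (z w i).2) h' evens_pairN.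
  have h2 : (z w i).2 = (z' w i).2 by rewrite -(odds_pairN (e (z w i).1) (z w i).2) h' odds_pairN.
  by case: (z w i) (z' w i) h1 h2 => [a b] [a' b'] /= -> ->.
- rewrite (_ : range _ = [set a | (forall k, (unpickle k : option (word * I * nat)) = None -> a k = 0) /\
    (forall k t, (unpickle k : option (word * I * nat)) = Some t -> exists b, a k = b /\ a (pickle t) = b) /\
    forall (w : word) (i : I), range e (evens (fun n => a (pickle (w, i, n))))]).
    apply: (s_and borelN_sig).
      apply: (s_all borelN_sig) => k; apply: (s_imp borelN_sig); [exact: (s_const borelN_sig)|exact: borelN_cyl].
    apply: (s_and borelN_sig).
      do 2 apply: (s_all borelN_sig) => ?; apply: (s_imp borelN_sig); first exact: (s_const borelN_sig).
      by apply: (s_ex borelN_sig) => b; apply: (s_and borelN_sig); exact: borelN_cyl.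
    do 2 apply: (s_all borelN_sig) => ?.
    exact: (mfun_reindex (fun n => pickle (_, _, n.*2)) erg).
  apply/seteqP; split=> a.
    case=> z _ <-; split; first by move=> k; rewrite /labelling_code => ->.
    split; first by move=> k [[w i] n] ek; exists (labelling_code z k); split=> //; rewrite labelling_codeK /labelling_code ek.
    move=> w i; exists (z w i).1 => //; apply/funext => n.
    by rewrite /evens labelling_codeK -[RHS]/(evens (pairN _ _) n) evens_pairN.
  move=> [h1 [h2 h3]].
  exists (fun w i => (proj1_sig (cid2 (h3 w i)), odds (fun n => a (pickle (w, i, n))))) => //.
  apply/funext => k; rewrite /labelling_code; case ek: (unpickle k) => [[[w i] n]|]; last by rewrite h1.
  by case: cid2 => y' _ /= ->; rewrite pairN_evens_odds; have [b [-> ->]] := h2 _ _ ek.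
- by move=> B hB; exists B.
- by move=> A [B [hB ->]]; exists B.
Qed.

Definition labelling_sig := coded_sig labelling_coded.

Lemma mfun_label_pt w i : mfun labelling_sets SY (fun z => (z w i).1).
Proof.
apply: (mfun_coded he); apply: (mfunN labelling_sig) => n a.
rewrite (_ : mkset _ = [set z | labelling_code z (pickle (w, i, n.*2)) = a]).
  by apply: (mfunN_at _ _ (f := labelling_code)); have [] := labelling_coded.
by apply/seteqP; split=> z; rewrite /= labelling_codeK -[pairN _ _ _]/(evens (pairN _ _) n) evens_pairN.
Qed.

Lemma sig_label w i n a : labelling_sets [set z | (z w i).2 n = a].
Proof.
rewrite (_ : mkset _ = [set z | labelling_code z (pickle (w, i, n.*2.+1)) = a]).
  by apply: (mfunN_at _ _ (f := labelling_code)); have [] := labelling_coded.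
by apply/seteqP; split=> z; rewrite /= labelling_codeK -[pairN _ _ _]/(odds (pairN _ _) n) odds_pairN.
Qed.

Lemma mfun_labelling T S (f : T -> labelling) : sigalg S -> (forall w i, mfun S SY (fun t => (f t w i).1)) ->
  (forall w i n a, S [set t | (f t w i).2 n = a]) -> mfun S labelling_sets f.
Proof.
move=> hS h1 h2; apply: (mfun_coded labelling_coded); apply: (mfunN hS) => k a; rewrite /labelling_code /=.
case: (unpickle k) => [[[w i] n]|]; last exact: (s_const hS).
rewrite /pairN; case: (odd n); first exact: h2.
exact: (mfunN_at _ _ (mfun_code he (h1 w i))).
Qed.

Definition shiftw (w : word) (z : labelling) : labelling := fun v => z (w ++ v).

Lemma shiftw0 z : shiftw [::] z = z. Proof. by []. Qed.
Lemma shiftwD w w' z : shiftw w' (shiftw w z) = shiftw (w ++ w') z.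
Proof. by apply/funext => v; rewrite /shiftw catA. Qed.

Lemma mfun_shiftw w : mfun labelling_sets labelling_sets (shiftw w).
Proof. by apply: (mfun_labelling labelling_sig) => [v i|v i n a]; [exact: mfun_label_pt|exact: sig_label]. Qed.

Definition basept i (z : labelling) := (z [::] i).1.

(* The letters of type [i] act on the tree exactly as the [g m] act on the i-th
   position, so that the i-th class of the tree is a copy of a class of [E]. *)
Definition coherent1 z := forall i, (forall m, basept i (shiftw [:: (i, m)] z) = g m (basept i z)) /\
  (forall m n k, g n (g m (basept i z)) = g k (basept i z) -> shiftw [:: (i, m); (i, n)] z = shiftw [:: (i, k)] z) /\
  shiftw [:: (i, 0)] z = z.
Definition coherent z := forall w, coherent1 (shiftw w z).

Lemma coherent_sig : labelling_sets coherent.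
Proof.
have idZ : mfun labelling_sets labelling_sets id by move=> A.
apply: (s_all labelling_sig (I := word)) => w; apply: (@mfun_shiftw w coherent1).
have gmy m i : mfun labelling_sets SY (fun z => g m (basept i z)) by exact: (mfun_comp (mfun_label_pt [::] i) (gM m)).
apply: (s_all labelling_sig) => i; apply: (s_and labelling_sig).
  apply: (s_all labelling_sig) => m; apply: (s_eq labelling_sig he) => //; exact: (mfun_comp (mfun_shiftw _) (mfun_label_pt _ _)).
apply: (s_and labelling_sig); last by apply: (s_eq labelling_sig labelling_coded) => //; exact: mfun_shiftw.
apply: (s_all labelling_sig) => m; apply: (s_all labelling_sig) => n; apply: (s_all labelling_sig) => k; apply: (s_imp labelling_sig).
  by apply: (s_eq labelling_sig he) => //; exact: mfun_comp (gmy m i) (gM n).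
by apply: (s_eq labelling_sig labelling_coded); exact: mfun_shiftw.
Qed.

Lemma coherent_shiftw w z : coherent z -> coherent (shiftw w z).
Proof. by move=> h v; rewrite shiftwD. Qed.

Lemma coherent_coherent1 z : coherent z -> coherent1 z. Proof. by move=> h; exact: (h [::]). Qed.

Definition linked i z z' := exists m, shiftw [:: (i, m)] z = z'.
Definition joined z z' := exists w, shiftw w z = z'.

Lemma linked_refl i z : coherent z -> linked i z z.
Proof. by move=> /coherent_coherent1 /(_ i) [_ [_ h]]; exists 0. Qed.

Lemma linked_coherent i z z' : coherent z -> linked i z z' -> coherent z'.
Proof. by move=> h [m <-]; exact: coherent_shiftw. Qed.

Lemma linked_sym i z z' : coherent z -> linked i z z' -> linked i z' z.
Proof.
move=> /coherent_coherent1 /(_ i) [_ [h h0]] [m <-]; have [n hn] := gV m (basept i z).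
by exists n; rewrite shiftwD (h m n 0) ?g0.
Qed.

Lemma linked_trans i z z' z'' : coherent z -> linked i z z' -> linked i z' z'' -> linked i z z''.
Proof.
move=> /coherent_coherent1 /(_ i) [_ [h h0]] [m <-] [n <-]; have [k hk] := gC n m (basept i z).
by exists k; rewrite shiftwD (h m n k).
Qed.

Lemma linked_inj i z z1 z2 : coherent z -> linked i z z1 -> linked i z z2 -> basept i z1 = basept i z2 -> z1 = z2.
Proof.
move=> oz [m <-] [k <-] ey; have [h1 [h h0]] := coherent_coherent1 oz i; rewrite !h1 in ey.
have := h m 0 k; rewrite g0 => <- //.
by have [_ [_]] := coherent_coherent1 (coherent_shiftw [:: (i, m)] oz) i; rewrite shiftwD.
Qed.

Lemma joined_coherent z z' : coherent z -> joined z z' -> coherent z'.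
Proof. by move=> h [w <-]; exact: coherent_shiftw. Qed.
Lemma joined_refl z : joined z z. Proof. by exists [::]. Qed.
Lemma joined_trans z z' z'' : joined z z' -> joined z' z'' -> joined z z''.
Proof. by move=> [w <-] [v <-]; rewrite shiftwD; exists (w ++ v). Qed.
Lemma joined_sym z z' : coherent z -> joined z z' -> joined z' z.
Proof.
move=> oz [w <-]; elim: w z oz => [|[i m] w IH] z oz; first exact: joined_refl.
rewrite -[_ :: w]/([:: (i, m)] ++ w) -shiftwD.
apply: joined_trans (IH _ (coherent_shiftw _ oz)) _.
have [n hn] : linked i (shiftw [:: (i, m)] z) z by apply: linked_sym => //; exists m.
by exists [:: (i, n)].
Qed.

Let l0 : I * nat := (i0, 0).
(** The last letter is compared with the first as well. Cycles with two vertices count: they appear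
    when a longer cycle begins and ends with the same type and these two edges are merged. *)
Definition alternating (w : word) := (2 <= size w)%N /\
  forall a, (a < size w)%N -> (nth l0 w a).1 <> (nth l0 w (a.+1 %% size w)).1.
Definition simple_cycle z w := [/\ alternating w, shiftw w z = z &
  forall a b, (a < size w)%N -> (b < size w)%N -> shiftw (take a w) z = shiftw (take b w) z -> a = b].
Definition cycle_free z := forall v w, ~ simple_cycle (shiftw v z) w.

Lemma cycle_free_sig : labelling_sets cycle_free.
Proof.
have idZ : mfun labelling_sets labelling_sets id by move=> A.
apply: (s_all labelling_sig (I := word)) => v; apply: (s_all labelling_sig (I := word)) => w; apply: (s_not labelling_sig).
apply: (@mfun_shiftw v [set z | simple_cycle z w]).
rewrite (_ : mkset _ = [set z | alternating w /\ (shiftw w z = z /\ forall a b, (a < size w)%N -> (b < size w)%N ->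
    shiftw (take a w) z = shiftw (take b w) z -> a = b)]).
  apply: (s_and labelling_sig); first exact: (s_const labelling_sig).
  apply: (s_and labelling_sig); first by apply: (s_eq labelling_sig labelling_coded) => //; exact: mfun_shiftw.
  apply: (s_all labelling_sig) => a; apply: (s_all labelling_sig) => b; do 2 (apply: (s_imp labelling_sig); first exact: (s_const labelling_sig)).
  apply: (s_imp labelling_sig); last exact: (s_const labelling_sig).
  by apply: (s_eq labelling_sig labelling_coded); exact: mfun_shiftw.
by apply/seteqP; split=> z; [case=> h1 h2 h3|case=> h1 [h2 h3]].
Qed.

Lemma cycle_free_shiftw w z : cycle_free z -> cycle_free (shiftw w z).
Proof. by move=> h v u; rewrite shiftwD. Qed.

Lemma cycle_free_joined z z' : coherent z -> joined z z' -> cycle_free z' -> cycle_free z.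
Proof. by move=> oz /(joined_sym oz) [w <-]; exact: cycle_free_shiftw. Qed.

Lemma simple_cycle_of_edges m (x : nat -> labelling) (k : nat -> I) : (2 <= m)%N ->
  (forall a b, (a < m)%N -> (b < m)%N -> x a = x b -> a = b) ->
  (forall a, (a < m)%N -> linked (k a) (x a) (x (a.+1 %% m))) ->
  (forall a, (a < m)%N -> k a <> k (a.+1 %% m)) -> exists w, simple_cycle (x 0) w.
Proof.
move=> m2 xi hE hk.
have H a : exists n, (a < m)%N -> shiftw [:: (k a, n)] (x a) = x (a.+1 %% m).
  by case: (ltnP a m) => am; [have [n hn] := hE a am; exists n|exists 0].
have [n hn] := choice H; pose w : word := mkseq (fun a => (k a, n a)) m.
have sw : size w = m by rewrite size_mkseq.
have tw a : (a <= m)%N -> shiftw (take a w) (x 0) = x (a %% m).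
  elim: a => [|a IH] am; first by rewrite take0 shiftw0 mod0n.
  rewrite (take_nth l0) ?sw // -cats1 -shiftwD IH ?(ltnW am) // nth_mkseq // modn_small //; exact: hn.
exists w; split.
- split; first by rewrite sw.
  by rewrite sw => a am; rewrite !nth_mkseq ?ltn_pmod //; [exact: hk|lia].
- by rewrite -{1}(take_size w) sw tw // modnn.
- rewrite sw => a b am bm; rewrite !tw ?(ltnW am) ?(ltnW bm) // !modn_small //; exact: xi.
Qed.

Lemma joined_shiftw w z : joined z (shiftw w z). Proof. by exists w. Qed.

(* A code lists the letters of a simple cycle together with distinct initial
   segments of the codes of its vertices; the least code occurring in a class thus
   selects disjoint cycles in a Borel way. *)
Definition cycle_code := (word * (nat * seq (seq nat)))%type.
(** Indexed by the arriving letter: vertex [b] is entered along letter [b], and the last vertex of a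
    cycle is its starting point. *)
Definition cycle_pt (w : word) b z := shiftw (take b.+1 w) z.
Definition starts_code (k : cycle_code) z := [/\ alternating k.1, shiftw k.1 z = z, uniq k.2.2, size k.2.2 = size k.1 &
  forall b, (b < size k.1)%N -> mkseq (labelling_code (cycle_pt k.1 b z)) k.2.1 = nth [::] k.2.2 b].
Definition on_code (k : cycle_code) b p := [/\ (b < size k.1)%N, starts_code k (shiftw (drop b.+1 k.1) p) &
  cycle_pt k.1 b (shiftw (drop b.+1 k.1) p) = p].
Definition occurs n z := exists k : cycle_code, unpickle n = Some k /\ exists v, starts_code k (shiftw v z).
Definition least_code n z := occurs n z /\ forall m, (m < n)%N -> ~ occurs m z.
Definition leaves_on_cycle p i := exists n (k : cycle_code) b, [/\ least_code n p, unpickle n = Some k, on_code k b p & (nth l0 k.1 b).1 = i].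
Definition leads_to_cycle v p := exists i, leaves_on_cycle (shiftw v p) i.
(* [exit_type i p]: the edge class through which [p] is left towards the selected
   cycles of its class (or entered along them) has type [i]. *)
Definition exit_type i p := leaves_on_cycle p i \/ ((forall i', ~ leaves_on_cycle p i') /\ exists (l : I * nat) v,
  [/\ l.1 = i, leads_to_cycle (l :: v) p & forall v', leads_to_cycle v' p -> (size v < size v')%N]).

Lemma starts_code_sig k : labelling_sets (starts_code k).
Proof.
have idZ : mfun labelling_sets labelling_sets id by move=> A.
have [_ _ mcz _] := labelling_coded.
rewrite (_ : starts_code k = [set z | alternating k.1 /\ (shiftw k.1 z = z /\ (uniq k.2.2 /\ (size k.2.2 = size k.1 /\
  forall b, (b < size k.1)%N -> mkseq (labelling_code (cycle_pt k.1 b z)) k.2.1 = nth [::] k.2.2 b)))]).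
  apply: (s_and labelling_sig); first exact: (s_const labelling_sig).
  apply: (s_and labelling_sig); first by apply: (s_eq labelling_sig labelling_coded) => //; exact: mfun_shiftw.
  do 2 (apply: (s_and labelling_sig); first exact: (s_const labelling_sig)).
  apply: (s_all labelling_sig) => b; apply: (s_imp labelling_sig); first exact: (s_const labelling_sig).
  by apply: (s_mkseq _ _ labelling_sig); exact: mfun_comp (mfun_shiftw _) mcz.
by apply/seteqP; split=> z; [case|case=> h1 [h2 [h3 [h4 h5]]]].
Qed.

Lemma leaves_on_cycle_sig i : labelling_sets [set p | leaves_on_cycle p i].
Proof.
have idZ : mfun labelling_sets labelling_sets id by move=> A.
have SZo n : labelling_sets [set p | occurs n p].
  apply: (s_ex labelling_sig) => k; apply: (s_and labelling_sig); first exact: (s_const labelling_sig).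
  by apply: (s_ex labelling_sig (I := word)) => v; exact: (mfun_shiftw v (starts_code_sig k)).
apply: (s_ex labelling_sig) => n; apply: (s_ex labelling_sig (I := cycle_code)) => k; apply: (s_ex labelling_sig) => b.
rewrite (_ : mkset _ = [set p | (occurs n p /\ forall m, (m < n)%N -> ~ occurs m p) /\ (unpickle n = Some k /\
  ((b < size k.1)%N /\ (starts_code k (shiftw (drop b.+1 k.1) p) /\ cycle_pt k.1 b (shiftw (drop b.+1 k.1) p) = p)) /\ (nth l0 k.1 b).1 = i)]).
  apply: (s_and labelling_sig).
    apply: (s_and labelling_sig) => //; apply: (s_all labelling_sig) => m; apply: (s_imp labelling_sig); first exact: (s_const labelling_sig).
    exact: (s_not labelling_sig).
  apply: (s_and labelling_sig); first exact: (s_const labelling_sig).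
  apply: (s_and labelling_sig); last exact: (s_const labelling_sig).
  apply: (s_and labelling_sig); first exact: (s_const labelling_sig).
  apply: (s_and labelling_sig); first exact: (mfun_shiftw _ (starts_code_sig k)).
  by apply: (s_eq labelling_sig labelling_coded) => //; exact: (mfun_comp (mfun_shiftw _) (mfun_shiftw _)).
by apply/seteqP; split=> p; [case=> h1 h2 [h3 h4 h5] h6|case=> h1 [h2 [[h3 [h4 h5]] h6]]].
Qed.

Lemma exit_type_sig i : labelling_sets (exit_type i).
Proof.
have SZr v : labelling_sets [set p | leads_to_cycle v p].
  by apply: (s_ex labelling_sig) => j; exact: (mfun_shiftw v (leaves_on_cycle_sig j)).
apply: (s_or labelling_sig); first exact: leaves_on_cycle_sig.
apply: (s_and labelling_sig); first by apply: (s_all labelling_sig) => j; apply: (s_not labelling_sig); exact: leaves_on_cycle_sig.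
apply: (s_ex labelling_sig) => l; apply: (s_ex labelling_sig (I := word)) => v.
rewrite (_ : mkset _ = [set p | l.1 = i /\ (leads_to_cycle (l :: v) p /\ forall v', leads_to_cycle v' p -> (size v < size v')%N)]).
  apply: (s_and labelling_sig); first exact: (s_const labelling_sig).
  apply: (s_and labelling_sig) => //; apply: (s_all labelling_sig (I := word)) => v'.
  by apply: (s_imp labelling_sig) => //; exact: (s_const labelling_sig).
by apply/seteqP; split=> p; [case=> h1 h2 h3|case=> h1 [h2 h3]].
Qed.

Lemma occurs_joined n z z' : coherent z -> joined z z' -> occurs n z -> occurs n z'.
Proof.
move=> oz jz [k [ek [v hv]]]; exists k; split=> //.
have [u hu] := joined_trans (joined_sym oz jz) (joined_shiftw v z); by exists u; rewrite hu.
Qed.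

Lemma least_code_joined n z z' : coherent z -> joined z z' -> least_code n z -> least_code n z'.
Proof.
move=> oz jz [h1 h2]; split; first exact: occurs_joined h1.
by move=> m mn om; apply: (h2 m mn); apply: occurs_joined om; [exact: joined_coherent jz|exact: joined_sym].
Qed.

Lemma least_code_uniq n m z : least_code n z -> least_code m z -> n = m.
Proof.
by move=> [h1 h2] [h3 h4]; case: (ltngtP n m) => // l; [case: (h4 _ l)|case: (h2 _ l)].
Qed.

Lemma least_code_ex z : coherent z -> ~ cycle_free z -> exists n, least_code n z.
Proof.
move=> oz nf.
have [v [w [[w2 hc] Tz dis]]] : exists v w, simple_cycle (shiftw v z) w.
  by apply: contrapT => h; apply: nf => v w hc; apply: h; exists v, w.
set z1 := shiftw v z in Tz dis.
have sep a b : exists N, (a < b < size w)%N -> mkseq (labelling_code (cycle_pt w a z1)) N <> mkseq (labelling_code (cycle_pt w b z1)) N.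
  case: (boolP (a < b < size w)%N) => [/andP[ab bw]|_]; last by exists 0.
  have [k hk] : exists k, labelling_code (cycle_pt w a z1) k <> labelling_code (cycle_pt w b z1) k.
    apply: contrapT => h; have : cycle_pt w a z1 = cycle_pt w b z1.
      have [ci _ _ _] := labelling_coded; apply: ci; apply/funext => k; apply: contrapT => h'; apply: h; by exists k.
    rewrite /cycle_pt; case: (ltnP b.+1 (size w)) => bw' e1.
      have := dis a.+1 b.+1 ltac:(lia) bw' e1; lia.
    move: e1; rewrite (@take_oversize _ b.+1) // Tz => e1.
    have := dis a.+1 0 ltac:(lia) ltac:(lia); rewrite take0 shiftw0 => /(_ e1); lia.
  exists k.+1 => _ /mkseq_eq /(_ k (ltnSn k)); exact: hk.
have [N hN] := choice (fun p : nat * nat => sep p.1 p.2).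
have [M hM] : exists M, forall a b, (a < b < size w)%N -> (N (a, b) <= M)%N.
  exists (\max_(p <- allpairs pair (iota 0 (size w)) (iota 0 (size w))) N p) => a b hab.
  by apply: leq_bigmax_seq => //; apply/allpairsP; exists (a, b); rewrite !mem_iota /=; split=> //; lia.
pose k : cycle_code := (w, (M, mkseq (fun b => mkseq (labelling_code (cycle_pt w b z1)) M) (size w))).
suff : exists n, occurs n z.
  move=> [n on]; have [j [_ oj mj]] := @nat_min (occurs^~ z) 0 (ex_intro _ n (conj (leq0n _) on)).
  by exists j; split=> // m mj'; exact: mj.
exists (pickle k), k; rewrite pickleK; split=> //; exists v; split=> //=.
- apply/(uniqP [::]) => a b; rewrite !inE size_mkseq => aw bw; rewrite !nth_mkseq //.
  move=> e1; case: (ltngtP a b) => // ab; exfalso.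
    by apply: (hN (a, b)); rewrite /= ?ab //; apply/mkseq_eq => i hi; move/mkseq_eq: e1; apply; have := hM a b; lia.
  by apply: (hN (b, a)); rewrite /= ?ab //; apply/mkseq_eq => i hi; move/mkseq_eq: (esym e1); apply; have := hM b a; lia.
- by rewrite size_mkseq.
- by move=> b hb; rewrite nth_mkseq.
Qed.

Lemma leaves_on_cycle_ex z : coherent z -> ~ cycle_free z -> exists v, leads_to_cycle v z.
Proof.
move=> oz nf; have [n kn] := least_code_ex oz nf; have [[k [ek [v Sv]]] _] := kn.
have [[w2 _] Tz _ _ _] := Sv.
exists v, (nth l0 k.1 (size k.1).-1).1, n, k, (size k.1).-1; split=> //.
  by apply: least_code_joined kn => //; exact: joined_shiftw.
have sw : (size k.1).-1.+1 = size k.1 by lia.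
by split; rewrite ?sw ?drop_size ?shiftw0 // /cycle_pt ?sw ?take_size //; lia.
Qed.

Lemma exit_type_ex z : coherent z -> ~ cycle_free z -> exists i, exit_type i z.
Proof.
move=> oz nf; case: (pselect (exists i, leaves_on_cycle z i)) => [[i h]|h]; first by exists i; left.
have [v hv] := leaves_on_cycle_ex oz nf.
have [d [_ [[|l u] [ed hu]] md]] := @nat_min (fun d => exists v, size v = d /\ leads_to_cycle v z) 0
  (ex_intro _ _ (conj (leq0n _) (ex_intro _ v (conj erefl hv)))).
  by exfalso; apply: h.
exists l.1; right; split; first by move=> i hi; apply: h; exists i.
exists l, u; split=> // v' hv'; rewrite ltnNge; apply/negP => lt.
by apply: (md (size v')); [move: ed => /=; lia|exists v'].
Qed.

(** All selected cycles of a class carry the same code, whose initial segments are distinct; so a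
    vertex determines its index on the cycle and the type of the entering edge. *)
Lemma leaves_on_cycle_step n k b p : least_code n p -> unpickle n = Some k -> on_code k b p ->
  forall i, leaves_on_cycle p i -> (nth l0 k.1 b).1 = i.
Proof.
move=> kn ek [bw Sb pb] i [n' [k' [b' [kn' ek' [bw' Sb' pb'] <-]]]].
move: ek'; rewrite -(least_code_uniq kn kn') ek => -[e1]; subst k'.
have [_ _ u1 sz1 hb] := Sb; have [_ _ _ _ hb'] := Sb'.
have := hb b bw; rewrite pb => h1; have := hb' b' bw'; rewrite pb' => h2.
suff -> : b = b' by [].
by apply/eqP; rewrite -(nth_uniq [::] _ _ u1) ?sz1 // -h1 -h2.
Qed.

(** Suppose all points of the class in direction [i] had exit type [i]. If one lies on a selected
    cycle, its predecessor there is in the class too and alternation fails. If none does, a point at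
    least distance from the cycles moves along an edge of type [i] to a closer point of the same
    class. *)
Lemma exit_type_switch z i : coherent z -> ~ cycle_free z -> exists z', linked i z z' /\ ~ exit_type i z'.
Proof.
move=> oz nf; apply: contrapT => hn.
have BRc z' : linked i z z' -> exit_type i z' by move=> ez; apply: contrapT => h; apply: hn; exists z'.
case: (pselect (exists z' i', linked i z z' /\ leaves_on_cycle z' i')) => [[z' [i' [ez oc]]]|nc].
  have onci z2 : linked i z z2 -> (exists j, leaves_on_cycle z2 j) -> leaves_on_cycle z2 i.
    by move=> e2 [j hj]; case: (BRc z2 e2) => // -[/(_ j)].
  have [n [k [b [kn ek Cb eb]]]] := onci z' ez (ex_intro _ i' oc).
  have oz' := linked_coherent oz ez; have [bw Sb pb] := Cb; set z1 := shiftw (drop b.+1 k.1) z' in Sb pb.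
  have [[w2 hc] Tz u1 sz1 hb] := Sb.
  have back p b' : linked i p z' -> coherent p -> on_code k b' p -> (nth l0 k.1 b').1 = i.
    move=> ep op Cp; have jp : joined z' p by apply: joined_sym => //; have [m <-] := ep; exact: joined_shiftw.
    have ezp : linked i z p by apply: linked_trans ez _ => //; exact: linked_sym.
    have kp : least_code n p by exact: least_code_joined kn.
    by apply: (leaves_on_cycle_step kp ek Cp); apply: onci ezp _; exists (nth l0 k.1 b').1, n, k, b'.
  have oz1 : coherent z1 by exact: coherent_shiftw.
  (* The predecessor is entered along an edge of type [i], against alternation. For [b = 0] it is
     the starting point, which is entered along the last letter. *)
  case: b Cb eb bw @z1 Sb pb Tz hb oz1 => [|b] Cb eb bw z1 Sb pb Tz hb oz1.
    have h : (nth l0 k.1 (size k.1).-1).1 = i.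
      apply: (back z1) => //; last first.
        have sw : (size k.1).-1.+1 = size k.1 by lia.
        by split; rewrite ?sw ?drop_size ?shiftw0 // /cycle_pt ?sw ?take_size //; lia.
      exists (nth l0 k.1 0).2; rewrite -[RHS]pb /cycle_pt (take_nth l0) // take0 /=.
      by rewrite -eb; case: (nth l0 k.1 0).
    apply: (hc (size k.1).-1); first by lia.
    by rewrite prednK ?modnn ?h ?eb //; lia.
  have h : (nth l0 k.1 b).1 = i.
    apply: (back (cycle_pt k.1 b z1)); last 1 first.
    - have e1 : shiftw (drop b.+1 k.1) (cycle_pt k.1 b z1) = z1 by rewrite /cycle_pt shiftwD cat_take_drop.
      by split; rewrite ?e1 //; exact: ltnW.
    - exists (nth l0 k.1 b.+1).2; rewrite -[RHS]pb /cycle_pt (take_nth l0 bw) -cats1 -shiftwD.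
      by rewrite -eb; case: (nth l0 k.1 b.+1).
    - exact: coherent_shiftw.
  apply: (hc b); first exact: ltnW.
  by rewrite h modn_small // eb.
have [v0 hv0] := leaves_on_cycle_ex oz nf.
have [d [_ [z' [v [ez ed hv]]] md]] := @nat_min (fun d => exists z' v, [/\ linked i z z', size v = d & leads_to_cycle v z']) 0
  (ex_intro _ _ (conj (leq0n _) (ex_intro _ z (ex_intro _ v0 (And3 (linked_refl i oz) erefl hv0))))).
case: (BRc z' ez) => [oc|[_ [l [u [el hu mu]]]]]; first by apply: nc; exists z', i.
apply: (md (size u)); first by have := mu v hv; lia.
exists (shiftw [:: l] z'), u; split=> //.
by apply: linked_trans ez _ => //; exists l.2; rewrite -el; case: (l).
Qed.
End Words.

(** * The games *)

(** An injective numbering in which a word ranks above its tail and above the code of its first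
    letter. The former makes copied entries old, the latter limits how far copies can have
    travelled. *)
Fixpoint word_rank (I : countType) (r : seq (I * nat)) (i : I) : nat :=
  if r is l :: r' then 2 ^ (pickle l).+1 * (word_rank r' i).*2.+1 else (pickle i).*2.+1.

Lemma pow_odd_inj a b a' b' : 2 ^ a * b.*2.+1 = 2 ^ a' * b'.*2.+1 -> a = a' /\ b = b'.
Proof.
elim: a a' => [|a IH] [|a'].
- by rewrite !expn0 !mul1n => -[/double_inj].
- by rewrite expn0 expnS -mulnA; lia.
- by rewrite expn0 expnS -mulnA; lia.
- by rewrite !expnS -2!mulnA => /eqP; rewrite eqn_mul2l /= => /eqP /IH [-> ->].
Qed.

Lemma word_rank_inj (I : countType) (r r' : seq (I * nat)) i i' : word_rank r i = word_rank r' i' -> r = r' /\ i = i'.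
Proof.
have H0 (l : I * nat) s x y : 2 ^ (pickle l).+1 * (word_rank s x).*2.+1 = (pickle y).*2.+1 -> False.
  by rewrite -[RHS]mul1n -(expn0 2) => /pow_odd_inj [].
elim: r r' => [|l r IH] [|l' r'] /=.
- by move=> [/double_inj /(pcan_inj pickleK) ->].
- by move/esym/H0.
- by move/H0.
- by move/pow_odd_inj => [[/(pcan_inj pickleK) ->] /IH [-> ->]].
Qed.

Lemma word_rank_cons (I : countType) l (r : seq (I * nat)) i : (word_rank r i < word_rank (l :: r) i)%N /\ (pickle l < word_rank (l :: r) i)%N.
Proof.
have h : (pickle l < 2 ^ (pickle l).+1)%N by rewrite expnS; have := ltn_expl (pickle l) (isT : 1 < 2); lia.
by split=> /=; nia.
Qed.

(** Enumeration of pairs by square shells [max c k]; inside shell [n] the pairs with index [k = n]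
    come last. *)
Definition slot_time c k := if (k < c)%N then c * c + k else k * k + k + c.

Lemma slot_time_mono c c' k : (c < c')%N -> (slot_time c k < slot_time c' k)%N.
Proof.
move=> h; rewrite /slot_time; case: (ltnP k c) => h1; case: (ltnP k c') => h2.
- by have := ltn_mul h h; lia.
- by lia.
- by have := leq_mul h2 h2; lia.
- by lia.
Qed.

Lemma sq_uniq m n r r' : m * m + r = n * n + r' -> (r <= m + m)%N -> (r' <= n + n)%N -> m = n.
Proof.
move=> e1 hr hr'; case: (ltngtP m n) => // h; have := leq_mul h h; lia.
Qed.

Lemma slot_time_inj c k c' k' : slot_time c k = slot_time c' k' -> c = c' /\ k = k'.
Proof.
rewrite /slot_time; case: (ltnP k c) => h1; case: (ltnP k' c') => h2; rewrite -?addnA => h.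
- by have ec := sq_uniq h ltac:(lia) ltac:(lia); subst c'; lia.
- by have ec := sq_uniq h ltac:(lia) ltac:(lia); subst k'; lia.
- by have ec := sq_uniq h ltac:(lia) ltac:(lia); subst c'; lia.
- by have ec := sq_uniq h ltac:(lia) ltac:(lia); subst k'; lia.
Qed.

(** By the order within a shell, everything written up to such a slot has smaller index, or the same
    index and a rank that is no larger. *)
Lemma slot_time_before c k s n : (s <= n)%N -> (slot_time c k <= slot_time s n)%N ->
  (k = n /\ (c <= s)%N) \/ ((k < n)%N /\ (slot_time c k < slot_time 0 n)%N).
Proof.
move=> sn; rewrite /slot_time (ltnNge n s) sn /=; case: (ltnP k c) => h1 h2.
  have cn : (c <= n)%N by rewrite leqNgt; apply/negP => h; have := leq_mul h h; lia.
  by right; split; [lia|have := leq_mul cn cn; lia].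
case: (ltngtP k n) => kn; last by left; split=> //; lia.
  by right; split=> //; have := leq_mul kn kn; lia.
by have := leq_mul kn kn; lia.
Qed.

Section Game.
Variables (I : countType) (i0 : I).
Variables (Y : Type) (SY : set (set Y)) (e : Y -> nat -> nat).
Hypothesis he : coded SY e.
Variable g : nat -> Y -> Y.
Hypotheses (g0 : forall y, g 0 y = y) (gM : forall m, mfun SY SY (g m))
  (gC : forall n m y, exists k, g k y = g n (g m y)) (gV : forall m y, exists n, g n (g m y) = y).
Variable psi : (nat -> nat) -> Y.
Hypotheses (psiM : mfun borelN SY psi) (psiK : forall y, psi (e y) = y).

(* Words may name the same vertex; a stack is a reduced word, with its last letter
   first.  The slot [(u, i, k)] holds the k-th entry of the label in direction [i]
   at the vertex [u]; it belongs to the first letter of the word, or to [i] at the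
   root. *)
Definition stack := seq (I * nat).
Definition stack_rank (u : stack) i := word_rank (rev u) i.
Definition time u i k := slot_time (stack_rank u i) k.

Definition slot_at (t : nat) : option (stack * I * nat) :=
  if pselect (exists p : stack * I * nat, time p.1.1 p.1.2 p.2 = t) is left h
  then Some (proj1_sig (cid h)) else None.

Lemma slot_atK u i k : slot_at (time u i k) = Some (u, i, k).
Proof.
rewrite /slot_at; case: pselect => [h|h]; last by exfalso; apply: h; exists (u, i, k).
case: cid => [[[u' i'] k']] /= /slot_time_inj [/word_rank_inj [/(can_inj revK) -> ->] ->] //.
Qed.

Lemma slot_atP t u i k : slot_at t = Some (u, i, k) -> t = time u i k.
Proof. by rewrite /slot_at; case: pselect => // h; case: cid => p /= <- [->]. Qed.

Definition owner (u : stack) i := if rev u is l :: _ then l.1 else i.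
Definition owner_at t := if slot_at t is Some (u, i, k) then owner u i else i0.

Definition decode (l : nat -> nat) : Y := psi (evens l).
Definition slot_word c u i : nat -> nat := fun k => c (time u i k).
(* The position in direction [i] is inherited from the parent when the last letter
   has type [i], and is otherwise encoded by the label itself. *)
Fixpoint slot_pt c u i : Y := if u is l :: u' then
  if l.1 == i then g l.2 (slot_pt c u' i) else decode (slot_word c u i) else decode (slot_word c u i).
Definition top_is (u : stack) (i : I) := if u is l :: _ then l.1 == i else false.
(** The vertex at which the class of [u] in direction [i] was first entered, with its position.
    Naming the other members relative to it gives each of them one name. *)
Definition base_of c u i : stack * Y :=
  if top_is u i then (behead u, slot_pt c (behead u) i) else (u, slot_pt c u i).
Definition min_index b y : nat := if pselect (exists m, `[< g m b = y >]) is left h then ex_minn h else 0.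
Definition push_pt (ub : stack * Y) i y : stack :=
  if `[< y = ub.2 >] then ub.1 else (i, min_index ub.2 y) :: ub.1.
Definition stack_step c u l := push_pt (base_of c u l.1) l.1 (g l.2 (slot_pt c u l.1)).
Definition stack_of c (w : word I) := foldl (stack_step c) [::] w.
Definition outcome c : labelling I Y := fun w i => (slot_pt c (stack_of c w) i, slot_word c (stack_of c w) i).

Lemma min_indexP b y : (exists m, g m b = y) -> g (min_index b y) b = y.
Proof.
move=> [m hm]; rewrite /min_index; case: pselect => [h|h]; first by case: ex_minnP => k /asboolP.
by exfalso; apply: h; exists m; exact/asboolP.
Qed.

(** The invariant of stacks: adjacent letters of different type, no trivial letter, and least
    indices only. The last clause makes returning to a vertex restore the same stack. *)
Fixpoint good c u := if u is l :: u' then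
  [/\ good c u', ~~ top_is u' l.1, g l.2 (slot_pt c u' l.1) <> slot_pt c u' l.1 &
      min_index (slot_pt c u' l.1) (g l.2 (slot_pt c u' l.1)) = l.2] else True.

Lemma base_of_spec c u i : good c u -> [/\ ~~ top_is (base_of c u i).1 i, (base_of c u i).2 = slot_pt c (base_of c u i).1 i,
  good c (base_of c u i).1 & exists k, g k (base_of c u i).2 = slot_pt c u i].
Proof.
rewrite /base_of; case: ifP => h gu.
  by case: u h gu => //= l u /eqP <- [gu hu _ _]; rewrite eqxx; split=> //; exists l.2.
by split=> //=; [rewrite h|exists 0].
Qed.

Lemma stack_step_spec c u i m : good c u -> [/\ base_of c (stack_step c u (i, m)) i = base_of c u i,
  slot_pt c (stack_step c u (i, m)) i = g m (slot_pt c u i) & good c (stack_step c u (i, m))].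
Proof.
move=> gu; have [h1 h2 h3 [k hk]] := base_of_spec i gu; rewrite /stack_step /push_pt /=.
move: h1 h2 h3 hk; case: (base_of c u i) => u0 b /= h1 h2 h3 hk.
case: asboolP => [e1|ne]; first by rewrite /base_of (negbTE h1) -h2 e1.
have hi : g (min_index b (g m (slot_pt c u i))) b = g m (slot_pt c u i).
  by apply: min_indexP; have [n hn] := gC m k b; exists n; rewrite hn hk.
by split; rewrite /base_of /= ?eqxx -?h2 ?hi.
Qed.

Lemma push_pt_canon c u i : good c u -> push_pt (base_of c u i) i (slot_pt c u i) = u.
Proof.
rewrite /push_pt /base_of; case: u => [|l u] /=; first by move=> _; case: asboolP.
case: eqP => [<-|_] /=; last by move=> _; case: asboolP.
by case=> _ _ h1 h2; case: asboolP => // _; rewrite h2; case: (l).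
Qed.

Lemma stack_of_good c w : good c (stack_of c w).
Proof.
rewrite /stack_of; elim/last_ind: w => // w [i m] IH; rewrite foldl_rcons; by have [] := stack_step_spec i m IH.
Qed.

(** A step depends only on the base of the class and on the target position, and leaves the base
    unchanged. Hence two steps in one direction equal any single step to the same position. *)
Lemma outcome_coherent c : coherent g (outcome c).
Proof.
move=> w i; have gu := stack_of_good c w; set u := stack_of c w in gu.
have E v j : shiftw w (outcome c) v j = (slot_pt c (foldl (stack_step c) u v) j, slot_word c (foldl (stack_step c) u v) j).
  by rewrite /shiftw /outcome /stack_of foldl_cat.
have ST m : stack_step c u (i, m) = push_pt (base_of c u i) i (g m (slot_pt c u i)) by [].
move: (shiftw w (outcome c)) E => z E; split.
  by move=> m; rewrite /basept /shiftw !E /=; have [] := stack_step_spec i m gu.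
split.
  move=> m n k; rewrite /basept E /= => ek; apply/funext => v; apply/funext => j; rewrite /shiftw !E /=.
  have [h1 h2 h3] := stack_step_spec i m gu.
  by rewrite [stack_step c (stack_step c u (i, m)) (i, n)]/stack_step h1 h2 ek -ST.
apply/funext => v; apply/funext => j; rewrite /shiftw !E /=.
by rewrite ST g0 push_pt_canon.
Qed.

Lemma mfun_slot_pt u i : mfun borelN SY (fun c => slot_pt c u i).
Proof.
have hd u' : mfun borelN SY (fun c => decode (slot_word c u' i)).
  apply: mfun_comp psiM; exact: (mfun_reindex (fun n => time u' i n.*2)).
elim: u => [|l u IH] /=; first exact: hd.
by case: (l.1 == i); [exact: mfun_comp IH (gM l.2)|exact: hd].
Qed.

Lemma s_min_index T S (b y : T -> Y) m : sigalg S -> mfun S SY b -> mfun S SY y -> S [set t | min_index (b t) (y t) = m].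
Proof.
move=> hS hb hy.
have heq k : S [set t | g k (b t) = y t] by apply: (s_eq hS he) => //; exact: mfun_comp hb (gM k).
rewrite (_ : mkset _ = [set t | (g m (b t) = y t /\ forall k, (k < m)%N -> g k (b t) <> y t) \/
   (m = 0 /\ forall k, g k (b t) <> y t)]).
  apply: (s_or hS); apply: (s_and hS) => //; try exact: (s_const hS); apply: (s_all hS) => k.
    by apply: (s_imp hS); [exact: (s_const hS)|exact: (s_not hS)].
  exact: (s_not hS).
apply/seteqP; split=> t; rewrite /= /min_index.
  case: pselect => [h|h] <-.
    case: ex_minnP => k /asboolP hk mk; left; split=> // k' hk' ek'.
    by have := mk k' (introT (asboolP _) ek'); lia.
  by right; split=> // k hk; apply: h; exists k; exact/asboolP.
case: pselect => [h [[h1 h2]|[_ h1]]|h [[h1 h2]|[-> //]]].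
- case: ex_minnP => k /asboolP hk mk; have := mk m (introT (asboolP _) h1).
  by case: (ltngtP k m) => // l _; case: (h2 k l).
- by exfalso; case: h => k /asboolP /h1.
- by exfalso; apply: h; exists m; exact/asboolP.
Qed.

Lemma borelN_stack_step u l v : borelN [set c | stack_step c u l = v].
Proof.
pose u0 := if top_is u l.1 then behead u else u.
have b1 c : (base_of c u l.1).1 = u0 by rewrite /base_of /u0; case: ifP.
have b2 : mfun borelN SY (fun c => (base_of c u l.1).2).
  by rewrite /base_of; case: (top_is u l.1) => /=; exact: mfun_slot_pt.
have hy : mfun borelN SY (fun c => g l.2 (slot_pt c u l.1)) by exact: mfun_comp (mfun_slot_pt u l.1) (gM l.2).
rewrite (_ : mkset _ = [set c | (g l.2 (slot_pt c u l.1) = (base_of c u l.1).2 /\ u0 = v) \/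
  (~ g l.2 (slot_pt c u l.1) = (base_of c u l.1).2 /\
   exists m, min_index (base_of c u l.1).2 (g l.2 (slot_pt c u l.1)) = m /\ (l.1, m) :: u0 = v)]).
  have heq : borelN [set c | g l.2 (slot_pt c u l.1) = (base_of c u l.1).2] by exact: (s_eq borelN_sig he).
  apply: (s_or borelN_sig); apply: (s_and borelN_sig) => //; try exact: (s_const borelN_sig); first exact: (s_not borelN_sig).
  by apply: (s_ex borelN_sig) => m; apply: (s_and borelN_sig); [exact: s_min_index borelN_sig _ _|exact: (s_const borelN_sig)].
apply/seteqP; split=> c; rewrite /= /stack_step /push_pt b1.
  by case: asboolP => h <-; [left|right; split=> //; eexists].
by case: asboolP => h [[h1 h2]|[h1 [m [<- h2]]]].
Qed.

Lemma borelN_stack_of w v : borelN [set c | stack_of c w = v].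
Proof.
elim/last_ind: w v => [|w l IH] v; first exact: (s_const borelN_sig ([::] = v)).
rewrite (_ : mkset _ = [set c | exists u, stack_of c w = u /\ stack_step c u l = v]).
  by apply: (s_ex borelN_sig (I := stack)) => u; apply: (s_and borelN_sig); [exact: IH|exact: borelN_stack_step].
apply/seteqP; split=> c; rewrite /= /stack_of foldl_rcons; first by move=> h; eexists.
by case=> u [-> ->].
Qed.

Lemma mfun_outcome : mfun borelN (@labelling_sets I Y e) outcome.
Proof.
apply: (mfun_labelling he borelN_sig) => [w i A hA|w i n a].
  rewrite (_ : _ @^-1` A = [set c | exists u, stack_of c w = u /\ A (slot_pt c u i)]).
    by apply: (s_ex borelN_sig (I := stack)) => u; apply: (s_and borelN_sig); [exact: borelN_stack_of|exact: (mfun_slot_pt u i hA)].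
  by apply/seteqP; split=> c /=; [move=> h; eexists|case=> u [<-]].
rewrite (_ : mkset _ = [set c | exists u, stack_of c w = u /\ slot_word c u i n = a]).
  by apply: (s_ex borelN_sig (I := stack)) => u; apply: (s_and borelN_sig); [exact: borelN_stack_of|exact: borelN_cyl].
by apply/seteqP; split=> c /=; [move=> h; eexists|case=> u [<-]].
Qed.

Definition wins_off (j : I) (s : seq nat -> nat) (P : set (labelling I Y)) := forall c,
  (forall t, owner_at t <> j -> c t = s (mkseq c t)) -> P (outcome c).

(* If the opponent won every game, playing all the winning strategies against
   each other would produce a point outside every [P j]. *)
Lemma strategy_wins (P : I -> set (labelling I Y)) : (forall j, @labelling_sets I Y e (P j)) ->
  (forall z, coherent g z -> exists j, P j z) -> exists j s, wins_off j s (P j).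
Proof.
move=> hP cov; apply: contrapT => no.
have H j : exists s : seq nat -> nat, forall c, (forall t, owner_at t = j -> c t = s (mkseq c t)) -> ~ P j (outcome c).
  have hB : borelN [set c | ~ P j (outcome c)] by apply: (s_not borelN_sig); exact: mfun_outcome.
  case: (determined (fun t => owner_at t != j) hB) => [[s hs]|[s hs]].
    by exists s => c hc; apply: hs => t /negbFE /eqP; exact: hc.
  exfalso; apply: no; exists j, s => c hc; apply: contrapT => nP.
  by apply: (hs c _ nP) => t /eqP; exact: hc.
have [s hs] := choice H.
pose F := fix F t := if t is t'.+1 then rcons (F t') (s (owner_at t') (F t')) else [::].
have sF t : size (F t) = t by elim: t => //= t IH; rewrite size_rcons IH.
pose c t := s (owner_at t) (F t).
have FE t : F t = mkseq c t by elim: t => //= t IH; rewrite mkseqS -IH.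
have [j Pj] := cov _ (outcome_coherent c).
by apply: (hs j c _ Pj) => t <-; rewrite -FE.
Qed.

Section Assembly.
Variables (j : I) (s : Y -> seq nat -> nat) (l : Y -> nat -> nat).
Hypothesis hl : forall v, decode (l v) = v.

(* In the run at [v], the root label in direction [j] is [l v], the other slots in
   direction [j] are copied from the run at the neighbouring point, and [s v]
   answers. *)
Definition next_glue (v : Y) (rest : Y -> nat -> nat) (h : seq nat) (t : nat) : nat :=
  match slot_at t with
  | Some (u, i, k) =>
    if rev u is m :: r then
      if m.1 == j then (if (time (rev r) i k < t)%N then rest (g m.2 v) (time (rev r) i k) else 0)
      else s v h
    else if i == j then l v k else s v h
  | None => if i0 == j then 0 else s v h
  end.

Fixpoint hist t v : seq nat := if t is t'.+1 then
  rcons (hist t' v) (next_glue v (fun p => nth 0 (hist t' p)) (hist t' v) t') else [::].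
Definition glue v t := nth 0 (hist t.+1 v) t.

Lemma size_hist t v : size (hist t v) = t.
Proof. by elim: t v => //= t IH v; rewrite size_rcons IH. Qed.

Lemma histE t v : hist t v = mkseq (glue v) t.
Proof.
elim: t v => //= t IH v; rewrite mkseqS -IH; congr rcons.
by rewrite /glue /= nth_rcons size_hist ltnn eqxx.
Qed.

Lemma glueE v t : glue v t = next_glue v glue (mkseq (glue v) t) t.
Proof.
rewrite {1}/glue /= nth_rcons size_hist ltnn eqxx histE /next_glue.
case: (slot_at t) => [[[u i] k]|] //; case: (rev u) => [|m r] //; case: eqP => // _.
by case: ltnP => // lt; rewrite histE nth_mkseq.
Qed.

Lemma glue_root v k : glue v (time [::] j k) = l v k.
Proof. by rewrite glueE /next_glue slot_atK /= eqxx. Qed.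

(** Removing the first letter of the word lowers the rank, hence the time, so the test in
    [next_glue] succeeds and the entry to be copied exists. *)
Lemma glue_dir v u m i k : glue v (time (rcons u (j, m)) i k) = glue (g m v) (time u i k).
Proof.
rewrite glueE /next_glue slot_atK rev_rcons /= eqxx revK ifT //; apply: slot_time_mono.
by rewrite /stack_rank rev_rcons; have [] := word_rank_cons (j, m) (rev u) i.
Qed.

Lemma glue_str v t : owner_at t <> j -> glue v t = s v (mkseq (glue v) t).
Proof.
rewrite glueE /owner_at /next_glue /owner; case: (slot_at t) => [[[u i] k]|]; last by move/eqP/negbTE => ->.
by case: (rev u) => [|m r] /eqP/negbTE ->.
Qed.

Lemma slot_word_root v : slot_word (glue v) [::] j = l v.
Proof. by apply/funext => k; exact: glue_root. Qed.

Lemma slot_pt_root v : slot_pt (glue v) [::] j = v.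
Proof. by rewrite /= slot_word_root hl. Qed.

(** The name, in the run at [v], of the vertex that the run at [p] calls [u], for [p] in the class
    of [v]. *)
Definition address v p u := if `[< p = v >] then u else rcons u (j, min_index v p).
Definition class_step (x : Y * stack) (m : I * nat) : Y * stack :=
  if nilp x.2 && (m.1 == j) then (g m.2 x.1, [::]) else (x.1, stack_step (glue x.1) x.2 m).
Definition off_class (u : stack) := if rev u is m :: _ then m.1 != j else true.

Lemma off_class_cons m u : off_class (m :: u) = if nilp u then m.1 != j else off_class u.
Proof.
rewrite /off_class; case/lastP: u => [|u x] //.
by rewrite rev_cons rev_rcons /nilp size_rcons.
Qed.

Lemma off_class_tail m u : off_class (m :: u) -> off_class u.
Proof. by rewrite off_class_cons; case: u. Qed.

Section Addr.
Variables v p : Y.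
Hypothesis vp : exists m, g m v = p.

Lemma slot_word_address u i : slot_word (glue v) (address v p u) i = slot_word (glue p) u i.
Proof.
rewrite /address; case: asboolP => [->//|_]; apply/funext => k.
by rewrite /slot_word glue_dir min_indexP.
Qed.

Lemma slot_pt_address u i : off_class u -> slot_pt (glue v) (address v p u) i = slot_pt (glue p) u i.
Proof.
elim: u => [|m u IH] nu.
  have := slot_word_address [::] i; rewrite /address; case: asboolP => [->//|_] hlab /=.
  case: eqP => [<-|_]; last by rewrite hlab.
  by rewrite -/(slot_pt (glue v) [::] j) -/(slot_pt (glue p) [::] j) !slot_pt_root min_indexP.
have := slot_word_address (m :: u) i; have := IH (off_class_tail nu).
by rewrite /address; case: asboolP => [->//|_] /= -> ->.
Qed.

Lemma base_of_address u i : off_class u -> ~~ (nilp u && (i == j)) ->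
  base_of (glue v) (address v p u) i = (address v p (base_of (glue p) u i).1, (base_of (glue p) u i).2).
Proof.
move=> nu hu; case: u nu hu => [|m u] nu hu.
  have h0 : top_is (address v p [::]) i = false.
    by move: hu; rewrite /address; case: asboolP => //= _; rewrite eq_sym => /negbTE.
  by rewrite /base_of h0 slot_pt_address.
have e1 : top_is (address v p (m :: u)) i = (m.1 == i) by rewrite /address; case: asboolP.
have e2 : behead (address v p (m :: u)) = address v p u by rewrite /address; case: asboolP.
rewrite /base_of e1 [top_is (m :: u) i]/=; case: ifP => _; first by rewrite e2 slot_pt_address //; exact: off_class_tail nu.
by rewrite slot_pt_address.
Qed.

Lemma stack_step_address u m : off_class u -> ~~ (nilp u && (m.1 == j)) ->
  stack_step (glue v) (address v p u) m = address v p (stack_step (glue p) u m) /\ off_class (stack_step (glue p) u m).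
Proof.
move=> nu hu; rewrite /stack_step base_of_address // slot_pt_address //; split.
  rewrite /push_pt /=; case: asboolP => // _; by rewrite /address; case: asboolP.
have nb0 : off_class (base_of (glue p) u m.1).1 /\ off_class ((m.1, 0) :: (base_of (glue p) u m.1).1).
  rewrite /base_of; case: u nu hu => [|x u] nu hu /=; first by rewrite off_class_cons.
  case: eqP => [<-|_] /=; last by split=> //; rewrite off_class_cons.
  by split; [exact: off_class_tail nu|move: nu; rewrite !off_class_cons].
rewrite /push_pt; case: asboolP => _; first exact: nb0.1.
by move: nb0.2; rewrite !off_class_cons.
Qed.

Lemma stack_step_address0 n : stack_step (glue v) (address v p [::]) (j, n) = address v (g n p) [::].
Proof.
rewrite /stack_step /= slot_pt_address // slot_pt_root.
have -> : base_of (glue v) (address v p [::]) j = ([::], v).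
  by rewrite /address /base_of; case: asboolP => _ /=; rewrite ?eqxx -/(slot_pt (glue v) [::] j) slot_pt_root.
by rewrite /push_pt /address /=; case: asboolP.
Qed.
End Addr.

(** A walk in the run at [v] is followed by switching to the run at the current point of the class:
    a letter of type [j] read at the root changes the run, any other is executed within it. The
    stack in the current run never starts with type [j]. *)
Lemma class_step_spec v w x : (exists m, g m v = x.1) -> off_class x.2 ->
  let x' := foldl class_step x w in
  [/\ foldl (stack_step (glue v)) (address v x.1 x.2) w = address v x'.1 x'.2, exists m, g m v = x'.1 & off_class x'.2].
Proof.
elim: w x => [|m w IH] x ex nx //=.
rewrite /class_step; case: ifP => [/andP[/nilP e2 /eqP ej]|/negbT h].
  rewrite e2; case: m ej => mj n /= ->; rewrite (stack_step_address0 ex).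
  apply: (IH (g n x.1, [::])) => //=; have [k hk] := ex; rewrite -hk; exact: gC.
have [h1 h2] := stack_step_address ex nx h; rewrite h1; exact: (IH (x.1, stack_step (glue x.1) x.2 m)).
Qed.

Lemma outcome_class_step v w i : let x := foldl class_step (v, [::]) w in
  outcome (glue v) w i = (slot_pt (glue x.1) x.2 i, slot_word (glue x.1) x.2 i).
Proof.
have [|//|h1 h2 h3] := @class_step_spec v w (v, [::]); first by exists 0.
have e0 : address v v [::] = [::] by rewrite /address; case: asboolP.
by rewrite /outcome /stack_of /=; move: h1; rewrite /= e0 => ->; rewrite slot_pt_address // slot_word_address.
Qed.

Lemma outcome_shift v m : shiftw [:: (j, m)] (outcome (glue v)) = outcome (glue (g m v)).
Proof.
apply/funext => w; apply/funext => i; rewrite /shiftw outcome_class_step [RHS]outcome_class_step /=.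
suff -> : class_step (v, [::]) (j, m) = (g m v, [::]) by [].
by rewrite /class_step /= eqxx.
Qed.

Lemma outcome_root v : outcome (glue v) [::] j = (v, l v).
Proof. by rewrite /outcome /stack_of [foldl _ _ _]/= slot_pt_root slot_word_root. Qed.

Lemma outcome_wins v P : wins_off j (s v) P -> P (outcome (glue v)).
Proof. by apply; exact: glue_str. Qed.
End Assembly.

(** The strategies may depend on [v] in any way, so no measurability of [Z] is asserted; this
    version is meant for mixing different strategies within a class. *)
Lemma assemble (j : I) (s : Y -> seq nat -> nat) : exists Z : Y -> labelling I Y,
  [/\ forall v, coherent g (Z v), forall v m, shiftw [:: (j, m)] (Z v) = Z (g m v),
      forall v, basept j (Z v) = v & forall v P, wins_off j (s v) P -> P (Z v)].
Proof.
pose l v := pairN (e v) (fun=> 0).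
have hl v : decode (l v) = v by rewrite /decode evens_pairN.
exists (fun v => outcome (glue j s l v)); split.
- by move=> v; exact: outcome_coherent.
- by move=> v m; exact: outcome_shift.
- by move=> v; rewrite /basept outcome_root.
- by move=> v P; exact: outcome_wins.
Qed.

(** Only finitely many histories of a given length lie below [bs]. *)
Lemma bounded_histories (s : seq nat -> nat) bs : exists M, forall h, size h = size bs ->
  (forall i, (nth 0 h i <= nth 0 bs i)%N) -> (s h <= M)%N.
Proof.
elim: bs s => [|b bs IH] s; first by exists (s [::]) => h /size0nil ->.
have [M hM] := choice (fun a => IH (fun h => s (a :: h))).
exists (\max_(a < b.+1) M a) => -[//|a h] /= [sh] hb.
have ab : (a < b.+1)%N := hb 0.
apply: leq_trans (leq_bigmax (Ordinal ab)); apply: hM => // i; exact: (hb i.+1).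
Qed.

Lemma inj_unbounded (f : nat -> nat) c : injective f -> exists r, (c <= f r)%N.
Proof.
move=> fi; apply: contrapT => h.
have fc (r : 'I_c.+1) : (f r < c)%N by rewrite ltnNge; apply/negP => h'; apply: h; exists r.
have hi : injective (fun r : 'I_c.+1 => Ordinal (fc r)) by move=> a b [/fi /val_inj].
by have := leq_card _ hi; rewrite !card_ord ltnn.
Qed.

Section AntiCollision.
Variables (j : I) (s : seq nat -> nat).
Hypothesis e1 : forall y n, (e y n <= 1)%N.

(* Runs at points outside a common class must not collide, although the strategy
   could copy labels.  The labels at even places code the point; an odd place [k]
   announces a number exceeding everything the strategy can output at the slot [k]
   while nearby points announce nothing there. *)
Definition max_output bs := proj1_sig (cid (bounded_histories s bs)).
Definition digit t := if slot_at t is Some (_, _, k) then k else 0.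
(** Bounds the entry at time [t] in all runs whose labels at index [k] are at most [b k]. The
    summands account for a label, an answer of the strategy to bounded histories, and an entry
    copied from earlier. *)
Fixpoint hbound_hist (b : nat -> nat) t := if t is t'.+1 then
  rcons (hbound_hist b t') (b (digit t') + max_output (hbound_hist b t') + sumn (hbound_hist b t')) else [::].
Definition hbound b t := nth 0 (hbound_hist b t.+1) t.

Lemma size_hbound_hist b t : size (hbound_hist b t) = t.
Proof. by elim: t => //= t IH; rewrite size_rcons IH. Qed.

Lemma hbound_histE b t : hbound_hist b t = mkseq (hbound b) t.
Proof.
elim: t => //= t IH; rewrite mkseqS -IH; congr rcons.
by rewrite /hbound /= nth_rcons size_hbound_hist ltnn eqxx.
Qed.

Lemma hboundE b t : hbound b t = b (digit t) + max_output (mkseq (hbound b) t) + sumn (mkseq (hbound b) t).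
Proof. by rewrite {1}/hbound /= nth_rcons size_hbound_hist ltnn eqxx !hbound_histE. Qed.

Lemma hbound_mono b t t' : (t' < t)%N -> (hbound b t' <= hbound b t)%N.
Proof.
move=> h; rewrite [hbound b t]hboundE.
suff : (hbound b t' <= sumn (mkseq (hbound b) t))%N by lia.
elim: t h => // t IH; rewrite ltnS mkseqS sumn_rcons leq_eqVlt => /orP[/eqP ->|/IH]; lia.
Qed.

Lemma hbound_str b t h : size h = t -> (forall i, (i < t)%N -> nth 0 h i <= hbound b i)%N -> (s h <= hbound b t)%N.
Proof.
move=> sh hh; rewrite hboundE; suff : (s h <= max_output (mkseq (hbound b) t))%N by lia.
rewrite /max_output; case: cid => M /= hM; apply: hM; first by rewrite size_mkseq.
move=> i; case: (ltnP i t) => it; first by rewrite nth_mkseq // hh.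
by rewrite nth_default // sh.
Qed.

Definition move_by n v := if (unpickle n : option (I * nat)) is Some l then g l.2 v else v.
(** Contains the points whose labels can have been copied into slots of rank [c] at [v], since each
    copy lowers the rank and uses a letter with code below it. It is finite, so one finite prefix
    tells a point outside it from all its members. *)
Fixpoint near c (v : Y) : set Y := if c is c'.+1 then
  [set p | near c' v p \/ exists n, (n <= c')%N /\ near c' (move_by n v) p] else [set v].

Lemma near_mono c c' v p : (c <= c')%N -> near c v p -> near c' v p.
Proof. by move/subnKC <-; elim: (c' - c)%N => [|n IH]; rewrite ?addn0 ?addnS //= => /IH; left. Qed.

Lemma near_refl c v : near c v v. Proof. by apply: (@near_mono 0). Qed.

Lemma near_move c c' (l : I * nat) v p : (c' < c)%N -> (pickle l < c)%N -> near c' (g l.2 v) p -> near c v p.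
Proof.
case: c => // c; rewrite !ltnS => h1 h2 h3; right; exists (pickle l); split=> //.
by rewrite /move_by pickleK; exact: near_mono h3.
Qed.

Lemma near_class c v p : near c v p -> exists m, g m v = p.
Proof.
elim: c v => [v ->|c IH v [/IH //|[n [_ /IH [m <-]]]]]; first by exists 0.
by rewrite /move_by; case: (unpickle n) => [l|]; [exact: gC|exists m].
Qed.

Lemma near_sep c v x : ~ near c v x -> exists M, forall p, near c v p -> mkseq (e p) M <> mkseq (e x) M.
Proof.
have up p M M' : (M <= M')%N -> mkseq (e p) M <> mkseq (e x) M -> mkseq (e p) M' <> mkseq (e x) M'.
  by move=> MM h /mkseq_eq h'; apply: h; apply/mkseq_eq => i hi; apply: h'; lia.
elim: c v => [|c IH] v nx.
  have [k hk] : exists k, e v k <> e x k.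
    apply: contrapT => h; apply: nx; have [ei _ _ _] := he; apply/esym; apply: ei.
    by apply/funext => k; apply: contrapT => h'; apply: h; exists k.
  by exists k.+1 => p -> /mkseq_eq /(_ k (ltnSn k)).
have [M hM] := IH v (fun h => nx (or_introl h)).
have H n : exists M, (n <= c)%N -> forall p, near c (move_by n v) p -> mkseq (e p) M <> mkseq (e x) M.
  case: (leqP n c) => nc; last by exists 0.
  by have [|M' hM'] := IH (move_by n v); [move=> h; apply: nx; right; exists n|exists M'].
have [Mn hMn] := choice H.
exists (maxn M (\max_(n < c.+1) Mn n)) => p [hp|[n [nc hp]]].
  by apply: up (hM p hp); exact: leq_maxl.
apply: up (hMn n nc p hp); apply: leq_trans (leq_maxr _ _).
exact: (leq_bigmax (Ordinal (nc : (n < c.+1)%N))).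
Qed.

(** Odd places list all pairs of a rank and a prefix; the spare number in the code makes each pair
    recur at arbitrarily large places. *)
Definition guess k : option (nat * seq nat) :=
  if odd k then
    if (unpickle k./2 : option (nat * (seq nat * nat))) is Some x then Some (x.1, x.2.1) else None
  else None.
Fixpoint bound_hist k : seq nat := if k is k'.+1 then
  rcons (bound_hist k') (if guess k' is Some x then (hbound (nth 0 (bound_hist k')) (slot_time x.1 k')).+1 else 1) else [::].
(** Computed as if no label had an announcement at index [k], because reading [bound_hist k] at its
    own length gives the default 0. One more is then out of reach of such runs. *)
Definition bound k := if guess k is Some x then (hbound (nth 0 (bound_hist k)) (slot_time x.1 k)).+1 else 1.

Lemma bound_histE k : bound_hist k = mkseq bound k.
Proof. by elim: k => //= k IH; rewrite mkseqS -IH. Qed.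

Definition marked_code (y : Y) k := if odd k then
  if guess k is Some x then (if mkseq (e y) (size x.2) == x.2 then bound k else 0) else 0
  else e y k./2.

Lemma evens_marked_code y : evens (marked_code y) = e y.
Proof. by apply/funext => k; rewrite /evens /marked_code odd_double doubleK. Qed.

Lemma decode_marked_code y : decode (marked_code y) = y.
Proof. by rewrite /decode evens_marked_code. Qed.

Lemma marked_code_le y k : (marked_code y k <= bound k)%N.
Proof.
rewrite /marked_code /bound /guess; case: (odd k) => //.
by case: (unpickle _) => [x|] //=; case: ifP.
Qed.

Let x := glue j (fun=> s) marked_code.

(** By this time only indices below [k], or [k] itself at small rank, have come up. Labels of the
    first kind obey the general bound and those of the second kind vanish by hypothesis; a copied
    entry comes from a neighbour, where the near points for the lowered rank are still near [v]. *)
Lemma glue_bound c0 k t v : (c0 <= k)%N -> (t <= slot_time c0 k)%N ->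
  (forall c p, (slot_time c k <= t)%N -> near c v p -> marked_code p k = 0) -> (x v t <= hbound (nth 0 (bound_hist k)) t)%N.
Proof.
move=> c0k; elim/ltn_ind: t v => t IH v tt hz.
have str : (s (mkseq (x v) t) <= hbound (nth 0 (bound_hist k)) t)%N.
  apply: hbound_str => [|i it]; first by rewrite size_mkseq.
  rewrite nth_mkseq //; apply: IH => //; first by lia.
  by move=> c p h; apply: hz; lia.
have tm0 c : (slot_time 0 k <= slot_time c k)%N by case: c => // c; apply: ltnW; exact: slot_time_mono.
rewrite /x glueE /next_glue -/x; case et: (slot_at t) => [[[u i] k']|]; last by case: ifP.
have tE := slot_atP et; case er: (rev u) => [|m r].
  case: eqP => // ij; have eu : u = [::] by rewrite -[u]revK er.
  move: tE; rewrite eu ij => tE; have := tt; rewrite tE => /(slot_time_before c0k) [[ek _]|[kk _]].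
    by rewrite ek (hz (stack_rank [::] j)) //; [rewrite tE ek|exact: near_refl].
  apply: leq_trans (marked_code_le v k') _; rewrite -tE hboundE /digit et bound_histE nth_mkseq //; lia.
case: eqP => // ej; case: ltnP => // lt; apply: leq_trans (hbound_mono _ lt).
have [hc1 hc2] := word_rank_cons m r i.
have scu : stack_rank u i = word_rank (m :: r) i by rewrite /stack_rank er.
have scr' : stack_rank (rev r) i = word_rank r i by rewrite /stack_rank revK.
apply: IH => //; first by lia.
move=> c p hc np; move: (tt); rewrite tE => /(slot_time_before c0k) [[ek _]|[_ lt0]]; last first.
  by have := tm0 c; move: lt0 lt hc; rewrite tE /time; lia.
have cc : (c <= stack_rank (rev r) i)%N.
  by rewrite leqNgt; apply/negP => h; move: hc; rewrite /time ek; have := slot_time_mono k h; lia.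
apply: (hz (stack_rank u i)); first by rewrite tE /time ek.
by apply: near_move np; rewrite scu; [move: cc; rewrite scr'; lia|].
Qed.

(** If [y] is not near [p], some prefix of its code separates it from the near points. At a place
    guessing this prefix [y] announces a number while they stay silent, so the entry in the run at
    [p] is smaller than that number. *)
Lemma anti_collision u i p y : owner u i <> j -> (forall k, x p (time u i k) = marked_code y k) ->
  exists m, g m p = y.
Proof.
move=> ou hx; case: (pselect (near (stack_rank u i) p y)) => [/near_class //|nn]; exfalso.
have [M hM] := near_sep nn; set c := stack_rank u i in nn hM.
pose f (r : nat) := pickle (c, (mkseq (e y) M, r)).
(* The spare number pushes the place [k] beyond the rank [c], as the shell order requires. *)
have [r hr] : exists r, (c <= f r)%N by apply: inj_unbounded => a b /(pcan_inj pickleK) [].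
pose k := (f r).*2.+1; have ok : odd k by rewrite /= odd_double.
have sk : guess k = Some (c, mkseq (e y) M).
  by rewrite /guess ok /k /= uphalf_double /f pickleK.
have := hx k; rewrite [marked_code y k]/marked_code ok sk /= size_mkseq eqxx /bound sk => hk.
suff : (x p (time u i k) <= hbound (nth 0 (bound_hist k)) (slot_time c k))%N by rewrite hk ltnn.
apply: (@glue_bound c k) => //; first by rewrite /k; lia.
move=> c' p' hc np; have cc : (c' <= c)%N.
  by rewrite leqNgt; apply/negP => h; have := leq_trans (slot_time_mono k h) hc; rewrite ltnn.
rewrite /marked_code ok sk /= size_mkseq ifF //; apply/eqP; apply: hM; exact: near_mono np.
Qed.

(** A walk from the tree of [v] to that of [y] ends in the run at some [p] of the class of [v]. If
    it ends at the root of that run, then [y = p]; if not, the label of [y] occurs inside the run,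
    and [anti_collision] applies. *)
Lemma outcome_collision v y : joined (outcome (x v)) (outcome (x y)) <-> exists m, g m v = y.
Proof.
split=> [[w hw]|[m <-]]; last by exists [:: (j, m)]; rewrite outcome_shift //; exact: decode_marked_code.
have [|//|_ [m hm] nu] := @class_step_spec j (fun=> s) marked_code decode_marked_code v w (v, [::]); first by exists 0.
have := congr1 (fun z : labelling I Y => z [::] j) hw.
rewrite /shiftw cats0 (@outcome_class_step j (fun=> s) marked_code decode_marked_code) (@outcome_root j (fun=> s) marked_code decode_marked_code) /= -/x.
move: hm nu; case: (foldl _ _ _) => p u /= hm nu [hy hlab].
have [k hk] : exists k, g k p = y; last by rewrite -hk -hm; exact: gC.
case eu: (rev u) => [|l r].
  have e0 : u = [::] by rewrite -[u]revK eu.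
  by exists 0; rewrite g0 -hy e0 slot_pt_root //; exact: decode_marked_code.
apply: (@anti_collision u j); last by move=> k; rewrite -hlab.
by move: nu; rewrite /off_class /owner eu => /eqP.
Qed.

Lemma mfun_marked_code k a : SY [set y | marked_code y k = a].
Proof.
have sY := coded_sig he; have [_ _ me _] := he.
rewrite /marked_code; case: (odd k); last exact: (mfunN_at _ _ me).
case: (guess k) => [[c q]|] /=; last exact: (s_const sY (0 = a)).
rewrite (_ : mkset _ = [set y | (mkseq (e y) (size q) = q /\ bound k = a) \/ (~ mkseq (e y) (size q) = q /\ 0 = a)]).
  have h := s_mkseq (size q) q sY me.
  by apply: (s_or sY); apply: (s_and sY) => //; try exact: (s_const sY); exact: (s_not sY).
apply/seteqP; split=> y /=; case: eqP => h; [by left|by right|by case=> -[]|by case=> -[]].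
Qed.

Lemma mfun_glue : mfun SY borelN x.
Proof.
have sY := coded_sig he; apply: (mfunN sY) => t; elim/ltn_ind: t => t IH a.
have str : SY [set v | s (mkseq (x v) t) = a].
  rewrite (_ : mkset _ = [set v | exists q, (size q = t /\ forall i, (i < t)%N -> x v i = nth 0 q i) /\ s q = a]).
    apply: (s_ex sY) => q; apply: (s_and sY); last exact: (s_const sY).
    apply: (s_and sY); first exact: (s_const sY).
    apply: (s_all sY) => i; case: (ltnP i t) => it; last first.
      by rewrite (_ : mkset _ = [set v : Y | True]); [exact: (s_const sY)|apply/seteqP; split].
    by apply: (s_imp sY); [exact: (s_const sY)|exact: IH].
  apply/seteqP; split=> v /= [].
    by exists (mkseq (x v) t); split=> //; split=> [|i it]; rewrite ?size_mkseq ?nth_mkseq.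
  move=> q [[sq hq] <-]; congr s; apply: (@eq_from_nth _ 0); rewrite size_mkseq // => i it.
  by rewrite nth_mkseq // hq.
rewrite (_ : mkset _ = [set v | next_glue j (fun=> s) marked_code v x (mkseq (x v) t) t = a]); last first.
  have xE v : x v t = next_glue j (fun=> s) marked_code v x (mkseq (x v) t) t by exact: glueE.
  by apply/seteqP; split=> v; rewrite /= xE.
rewrite /next_glue; case: (slot_at t) => [[[u i] k]|]; last by case: (i0 == j) => //; exact: (s_const sY).
case: (rev u) => [|m r]; first by case: (i == j) => //; exact: mfun_marked_code.
case: (m.1 == j) => //; case: ltnP => lt; last exact: (s_const sY).
exact: (gM m.2 (IH _ lt a)).
Qed.

Lemma game_embedding P : wins_off j s P -> exists Z : Y -> labelling I Y,
  [/\ mfun SY (@labelling_sets I Y e) Z, forall v, coherent g (Z v) /\ P (Z v), forall v m, shiftw [:: (j, m)] (Z v) = Z (g m v),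
      forall v, basept j (Z v) = v & forall v y, joined (Z v) (Z y) <-> exists m, g m v = y].
Proof.
move=> hP; exists (fun v => outcome (x v)); split.
- exact: mfun_comp mfun_glue mfun_outcome.
- by move=> v; split; [exact: outcome_coherent|exact: outcome_wins].
- by move=> v m; apply: outcome_shift; exact: decode_marked_code.
- by move=> v; rewrite /basept outcome_root //; exact: decode_marked_code.
- exact: outcome_collision.
Qed.
End AntiCollision.
End Game.

Record borel_action (Y : Type) (SY : set (set Y)) (e : Y -> nat -> nat) (g : nat -> Y -> Y)
    (psi : (nat -> nat) -> Y) : Prop := BorelAction {
  ba_code : coded SY e;
  ba_bit : forall y n, (e y n <= 1)%N;
  ba_0 : forall y, g 0 y = y;
  ba_meas : forall m, mfun SY SY (g m);
  ba_comp : forall n m y, exists k, g k y = g n (g m y);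
  ba_inv : forall m y, exists n, g n (g m y) = y;
  ba_psiM : mfun borelN SY psi;
  ba_psiK : forall y, psi (e y) = y }.

Section FreeGame.
Variables (I : countType) (i0 : I) (Y : Type) (SY : set (set Y)) (e : Y -> nat -> nat)
  (g : nat -> Y -> Y) (psi : (nat -> nat) -> Y).
Hypothesis H : borel_action SY e g psi.
Notation labelling := (labelling I Y).
Notation labelling_sets := (@labelling_sets I Y e).

(* Non-free trees are split between the directions by [exit_type]. *)
Definition payoff (j : I) (A : set labelling) : set labelling :=
  [set z | (cycle_free i0 z /\ A z) \/ (~ cycle_free i0 z /\ exit_type i0 e j z)].
Definition Wins (j : I) (A : set labelling) := exists s, wins_off i0 g psi j s (payoff j A).

Lemma Wins_mono j (A B : set labelling) : (forall z, cycle_free i0 z -> A z -> B z) -> Wins j A -> Wins j B.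
Proof.
move=> AB [s hs]; exists s => c /hs [[fz Az]|]; last by right.
by left; split=> //; exact: AB.
Qed.

Lemma Wins_cover (A : I -> set labelling) : (forall j, labelling_sets (A j)) ->
  (forall z, coherent g z -> cycle_free i0 z -> exists j, A j z) -> exists j, Wins j (A j).
Proof.
move=> mA cov; have hc := ba_code H; have sZ := labelling_sig I hc.
have [||j [s hs]] := strategy_wins i0 hc (ba_0 H) (ba_meas H) (ba_comp H) (ba_psiM H) (P := fun j => payoff j (A j)).
- move=> j; apply: (s_or sZ); apply: (s_and sZ).
  + exact: cycle_free_sig hc.
  + exact: mA.
  + by apply: (s_not sZ); exact: cycle_free_sig hc.
  + exact: exit_type_sig hc _.
- move=> z oz; case: (pselect (cycle_free i0 z)) => fz.
    by have [j Aj] := cov z oz fz; exists j; left.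
  by have [j Bj] := exit_type_ex hc (ba_0 H) (ba_inv H) oz fz; exists j; right.
by exists j, s.
Qed.

(* Along an assembled class, [exit_type_switch] excludes the non-free alternative. *)
Lemma payoff_free j (A : Y -> set labelling) (Z : Y -> labelling) : (forall v, coherent g (Z v)) ->
  (forall v m, shiftw [:: (j, m)] (Z v) = Z (g m v)) -> (forall v, payoff j (A v) (Z v)) ->
  forall v, cycle_free i0 (Z v) /\ A v (Z v).
Proof.
move=> oZ shift hP v; suff fz : cycle_free i0 (Z v) by case: (hP v) => // -[].
apply: contrapT => nf.
have [z' [[m hm] nB]] := exit_type_switch (ba_code H) (ba_0 H) (ba_comp H) (ba_inv H) j (oZ v) nf.
rewrite shift in hm; case: (hP (g m v)) => [[fz _]|[_]]; last by rewrite hm.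
by apply: nf; apply: (cycle_free_joined (ba_0 H) (ba_inv H) (oZ v) _ fz); exists [:: (j, m)]; rewrite shift.
Qed.

Lemma Wins_assemble j (s : Y -> seq nat -> nat) (A : Y -> set labelling) :
  (forall v, wins_off i0 g psi j (s v) (payoff j (A v))) -> exists Z : Y -> labelling,
  [/\ forall v, coherent g (Z v), forall v, cycle_free i0 (Z v), forall v, A v (Z v) &
      forall v m, shiftw [:: (j, m)] (Z v) = Z (g m v)].
Proof.
move=> hs; have [Z [oZ shift _ hW]] := assemble i0 (ba_0 H) (ba_comp H) (ba_psiK H) j s.
have h := payoff_free oZ shift (fun v => hW v _ (hs v)).
by exists Z; split=> // v; have [] := h v.
Qed.

Lemma Wins_embedding j A : Wins j A -> exists Z : Y -> labelling,
  [/\ mfun SY labelling_sets Z, forall v, coherent g (Z v) /\ cycle_free i0 (Z v), forall v, A (Z v), injective Z &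
      forall v y, joined (Z v) (Z y) <-> exists m, g m v = y].
Proof.
move=> [s hs].
have [Z [mZ oP shift yZ hJ]] := game_embedding (ba_code H) (ba_0 H) (ba_meas H) (ba_comp H)
  (ba_psiM H) (ba_psiK H) (ba_bit H) hs.
have h := @payoff_free j (fun=> A) Z (fun v => (oP v).1) shift (fun v => (oP v).2).
exists Z; split=> //.
- by move=> v; split; [exact: (oP v).1|exact: (h v).1].
- by move=> v; exact: (h v).2.
- by move=> v v' /(congr1 (basept j)); rewrite !yZ.
Qed.

(** Moves alternate between the two directions and always change the position. A first repetition
    would close a simple cycle, against freeness. *)
Lemma infinite_path (a b : I) (z0 : labelling) : a <> b -> coherent g z0 -> cycle_free i0 z0 ->
  (forall y, exists m, g m y <> y) ->
  exists v : nat -> labelling, injective v /\ forall n, joined z0 (v n).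
Proof.
move=> ab oz fz hy; pose k n := if odd n then a else b.
have off_class (p : nat * labelling) : exists z', coherent g p.2 -> linked (k p.1) p.2 z' /\ z' <> p.2.
  case: (pselect (coherent g p.2)) => op; last by exists p.2.
  have [m hm] := hy (basept (k p.1) p.2); exists (shiftw [:: (k p.1, m)] p.2) => _; split; first by exists m.
  by move=> /(congr1 (basept (k p.1))); have [h _] := coherent_coherent1 op (k p.1); rewrite h.
have [f hf] := choice off_class.
pose v := fix v n := if n is n'.+1 then f (n', v n') else z0.
have ov n : coherent g (v n) by elim: n => //= n IH; exact: linked_coherent IH (hf (n, v n) IH).1.
have evens n : linked (k n) (v n) (v n.+1) := (hf (n, v n) (ov n)).1.
have nv n : v n.+1 <> v n := (hf (n, v n) (ov n)).2.
have jv n : joined z0 (v n).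
  by elim: n => [|n IH]; [exact: joined_refl|apply: joined_trans IH _; have [m <-] := evens n; exact: joined_shiftw].
exists v; split=> //; apply: contrapT => ninj.
have [q hq] : exists q, exists p, (p < q)%N /\ v p = v q.
  apply: contrapT => h; apply: ninj => p q e1; case: (ltngtP p q) => // pq; exfalso; apply: h.
    by exists q, p.
  by exists p, q.
have [b' [_ [p [pq vpq]] mb]] := @nat_min (fun q => exists p, (p < q)%N /\ v p = v q) 0 (ex_intro _ q (conj (leq0n q) hq)).
have dis i i' : (i < b')%N -> (i' < b')%N -> v i = v i' -> i = i'.
  move=> ib ib' e1; case: (ltngtP i i') => // ii; exfalso.
    by apply: (mb i' _); [lia|exists i].
  by apply: (mb i _); [lia|exists i'].
have kk n : k n <> k n.+1 by rewrite /k /=; case: (odd n) => //= /esym.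
have k2 n m : odd n = odd m -> k n = k m by rewrite /k => ->.
have fv n : cycle_free i0 (v n) by have [w <-] := jv n; exact: cycle_free_shiftw.
have nocyc m (x : nat -> labelling) t : (2 <= m)%N -> x 0 = v t ->
  (forall a b, (a < m)%N -> (b < m)%N -> x a = x b -> a = b) -> forall kx,
  (forall a, (a < m)%N -> linked (kx a) (x a) (x (a.+1 %% m))) ->
  (forall a, (a < m)%N -> kx a <> kx (a.+1 %% m)) -> False.
  move=> m2 x0 xi kx hE hk; have [w hw] := simple_cycle_of_edges i0 m2 xi hE hk.
  by apply: (fv t [::] w); rewrite shiftw0 -x0.
set m := (b' - p)%N; have bE : b' = (p + m)%N by rewrite /m; lia.
have m0 : (0 < m)%N by rewrite /m; lia.
have m1 : m <> 1 by move=> e1; apply: (nv p); rewrite vpq bE e1 addn1.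
(* With an odd number of edges the first and the last have the same type; merging them drops vertex
   [p] and leaves an alternating cycle on [m.-1] vertices. *)
case om: (odd m).
  have m3 : (2 <= m.-1)%N by case: (m) om m0 m1 => [|[|[|?]]].
  apply: (@nocyc m.-1 (fun i => v (p + i).+1) p.+1 m3 _ _ (fun i => k (p + i).+1)).
  - by rewrite addn0.
  - by move=> i i' hi hi' /dis h; have := h ltac:(lia) ltac:(lia); lia.
  - move=> i hi; case: (eqVneq i.+1 m.-1) => im; last by rewrite modn_small ?addnS //; lia.
    rewrite im modnn addn0.
    have b1 : ((p + i).+2 = b')%N by lia.
    have e1 := evens (p + i).+1; rewrite b1 -vpq in e1.
    have kp : k (p + i).+1 = k p by apply: k2; lia.
    rewrite kp in e1 *; exact: (linked_trans (ba_comp H) (ov _) e1 (evens p)).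
  - move=> i hi; case: (eqVneq i.+1 m.-1) => im; last by rewrite modn_small ?addnS //; lia.
    rewrite im modnn addn0 (k2 (p + i).+1 p); [exact: kk|lia].
apply: (@nocyc m (fun i => v (p + i)%N) p _ _ _ (fun i => k (p + i)%N)).
- by lia.
- by rewrite addn0.
- by move=> i i' hi hi' /dis h; have := h ltac:(lia) ltac:(lia); lia.
- move=> i hi; case: (eqVneq i.+1 m) => im; last by rewrite modn_small ?addnS //; lia.
  by rewrite im modnn addn0 vpq bE -im addnS; exact: evens.
- move=> i hi; case: (eqVneq i.+1 m) => im; last by rewrite modn_small ?addnS //; lia.
  rewrite im modnn addn0 -(k2 (p + i).+1 p); first exact: kk.
  by lia.
Qed.
End FreeGame.

(** * Standard Borel spaces and their codes *)

Import Order.TTheory GRing.Theory Num.Theory.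

Lemma meas_sig d (X : measurableType d) : sigalg (@measurable d X).
Proof.
by split; [move=> A; exact: measurableC|move=> A; exact: bigcupT_measurable|exists setT].
Qed.

Lemma sigma_sub (T : Type) (G S : set (set T)) : sigalg S -> G `<=` S -> <<s G >> `<=` S.
Proof.
move=> hS GS; apply: smallest_sub => //; split.
- exact: (s_const hS False).
- by move=> A SA; rewrite setTD; exact: (sg_setC hS).
- by move=> A SA; exact: (sg_bigcup hS).
Qed.

Lemma countable_basis (T : topologicalType) : @second_countable T -> exists U : nat -> set T,
  (forall n, open (U n)) /\ forall x V, nbhs x V -> exists n, U n x /\ U n `<=` V.
Proof.
move=> [B /countable_injP [f finj] [Bo Bn]].
pose U n := if pselect (exists b, B b /\ f b = n) is left h then proj1_sig (cid h) else set0.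
exists U; split=> [n|x V /Bn [b [Bb bx] bV]].
  rewrite /U; case: pselect => [h|_]; last exact: open0.
  by case: cid => b [Bb _] /=; exact: Bo.
exists (f b); suff -> : U (f b) = b by [].
rewrite /U; case: pselect => [h|h]; last by exfalso; apply: h; exists b.
by case: cid => b' [Bb' e] /=; apply: finj; rewrite ?inE.
Qed.

Section StdCoded.
Variables (R : realType) (P : metricType R) (U : nat -> set P).
Hypotheses (Uo : forall n, open (U n))
  (Ub : forall x V, nbhs x V -> exists n, U n x /\ U n `<=` V)
  (Pc : forall F : set_system P, ProperFilter F -> cauchy F -> exists p : P, F --> p).
Local Open Scope ring_scope.

Definition pcode (p : P) n : nat := `[< U n p >].

Lemma pcode1 p n : (pcode p n = 1)%N <-> U n p.
Proof. by rewrite /pcode; case: asboolP => h; split. Qed.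

(** Describes the codes of points: families of basic sets that form a filter base of nonempty sets,
    contain sets of arbitrarily small radius, are upward closed and are regular. All clauses
    quantify over indices only, which makes the range Borel. *)
Definition isfilt (a : nat -> nat) := [/\ forall n, (a n = 0 \/ a n = 1)%N,
  forall k l, (a k = 1)%N -> (a l = 1)%N -> exists m, (a m = 1)%N /\ U m `<=` U k `&` U l,
  forall m, (a m = 1)%N -> exists x, U m x,
  forall j, exists m, (a m = 1)%N /\ exists c, U m `<=` ball c (j.+1%:R^-1 : R) &
  (forall k m, U k `<=` U m -> (a k = 1)%N -> (a m = 1)%N) /\
  (forall m, (a m = 1)%N -> exists k, (a k = 1)%N /\ closure (U k) `<=` U m)].

Lemma pcode_inj : injective pcode.
Proof.
move=> p q e; apply: contrapT => /eqP pq; rewrite -mdist_gt0 in pq.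
have [n [Up UV]] := Ub (nbhsx_ballx p _ pq).
have /UV : U n q by apply/pcode1; rewrite -e; exact/pcode1.
by rewrite ballEmdist /= ltxx.
Qed.

Lemma isfilt_pcode p : isfilt (pcode p).
Proof.
split.
- by move=> n; rewrite /pcode; case: asboolP; [right|left].
- move=> k l /pcode1 Uk /pcode1 Ul.
  have [|m [Um UV]] := @Ub p (U k `&` U l); first by apply: filterI; apply: open_nbhs_nbhs.
  by exists m; split=> //; exact/pcode1.
- by move=> m /pcode1 Um; exists p.
- move=> j; have [|m [Um UV]] := @Ub p (ball p (j.+1%:R^-1)).
    by apply: nbhsx_ballx; rewrite invr_gt0.
  by exists m; split; [exact/pcode1|exists p].
- split; first by move=> k m km /pcode1 Uk; apply/pcode1; exact: km.
  move=> m /pcode1 Um; have /nbhs_ballP [e /= e0 he] : nbhs p (U m) by apply: open_nbhs_nbhs.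
  have e2 : 0 < e / 2 by rewrite divr_gt0.
  have [k [Uk UV]] := Ub (nbhsx_ballx p _ e2).
  exists k; split; first exact/pcode1.
  move=> q cq; apply: he.
  have [r [/UV pairN /ball_sym rq]] := cq _ (nbhsx_ballx q _ e2).
  by rewrite [e]splitr; exact: ball_triangle pairN rq.
Qed.

(** Small sets make the filter Cauchy, hence convergent by completeness. Upward closure puts every
    basic neighbourhood of the limit into the family, and regularity puts the limit into every
    member. *)
Lemma isfilt_ex a : isfilt a -> exists p, pcode p = a.
Proof.
move=> [h0 hI hn hd [hu hr]].
pose F : set_system P := [set S | exists m, (a m = 1)%N /\ U m `<=` S].
have FF : ProperFilter F.
  split.
    by move=> [m [am Um]]; have [x Ux] := hn m am; exact: (Um x Ux).
  split.
  - by have [m [am _]] := hd 0%N; exists m.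
  - move=> A B [k [ak Uk]] [l [al Ul]]; have [m [am Um]] := hI k l ak al.
    by exists m; split=> // x /Um [/Uk ? /Ul ?].
  - by move=> A B AB [k [ak Uk]]; exists k; split=> // x /Uk /AB.
have [p Fp] : exists p : P, F --> p.
  apply: Pc; apply: cauchy_exP => e e0.
  have [j hj] : exists j : nat, (j.+1%:R^-1 : R) <= e.
    exists (Num.truncn (e^-1)); rewrite invf_ple ?posrE ?ltr0n //.
    by apply: ltW; apply: truncnS_gt.
  have [m [am [c Um]]] := hd j; exists c, m; split=> // x /Um.
  exact: le_ball.
exists p; apply/funext => n; have e : U n p <-> (a n = 1)%N.
  split=> [Un|an].
    have [|k [ak Uk]] := Fp (U n); first by apply: open_nbhs_nbhs.
    exact: hu Uk ak.
  have [k [ak Uk]] := hr n an; apply: Uk => V /Fp [m [am Um]].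
  have [l [al Ul]] := hI k m ak am; have [x Ux] := hn l al.
  by exists x; have [? /Um ?] := Ul x Ux.
rewrite /pcode; case: asboolP => h; first by rewrite (e.1 h).
by case: (h0 n) => // /e.
Qed.

Lemma borelN_isfilt : borelN [set a | isfilt a].
Proof.
have cyl n a : borelN [set z | z n = a] by exact: borelN_cyl.
have cst Q : borelN [set z | Q] by exact: (s_const borelN_sig).
rewrite (_ : mkset _ = [set a | (forall n, (a n = 0 \/ a n = 1)%N) /\
  (forall k l, (a k = 1)%N -> (a l = 1)%N -> exists m, (a m = 1)%N /\ U m `<=` U k `&` U l) /\
  (forall m, (a m = 1)%N -> exists x, U m x) /\
  (forall j, exists m, (a m = 1)%N /\ exists c, U m `<=` ball c (j.+1%:R^-1 : R)) /\
  (forall k m, U k `<=` U m -> (a k = 1)%N -> (a m = 1)%N) /\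
  (forall m, (a m = 1)%N -> exists k, (a k = 1)%N /\ closure (U k) `<=` U m)]); last first.
  by apply/seteqP; split=> a [h1]; [move=> h2 h3 h4 [h5 h6]; do !split|move=> [h2 [h3 [h4 [h5 h6]]]]; do !split].
apply: (s_and borelN_sig); first by apply: (s_all borelN_sig) => n; apply: (s_or borelN_sig).
apply: (s_and borelN_sig).
  do 2 apply: (s_all borelN_sig) => ?; do 2 (apply: (s_imp borelN_sig) => //).
  by apply: (s_ex borelN_sig) => m; apply: (s_and borelN_sig).
apply: (s_and borelN_sig); first by apply: (s_all borelN_sig) => m; apply: (s_imp borelN_sig).
apply: (s_and borelN_sig).
  by apply: (s_all borelN_sig) => j; apply: (s_ex borelN_sig) => m; apply: (s_and borelN_sig).
apply: (s_and borelN_sig).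
  by do 2 apply: (s_all borelN_sig) => ?; do 2 apply: (s_imp borelN_sig) => //.
apply: (s_all borelN_sig) => m; apply: (s_imp borelN_sig) => //.
by apply: (s_ex borelN_sig) => k; apply: (s_and borelN_sig).
Qed.

Lemma pcode_open V : open V -> exists B, borelN B /\ V = pcode @^-1` B.
Proof.
move=> oV; exists [set a | exists n, (a n = 1)%N /\ U n `<=` V]; split.
  apply: (s_ex borelN_sig) => n; apply: (s_and borelN_sig); [exact: borelN_cyl|exact: (s_const borelN_sig)].
apply/seteqP; split=> [x Vx|x [n [/pcode1 Un]]]; last by apply.
have [|n [Un UV]] := @Ub x V; first by apply: open_nbhs_nbhs.
by exists n; split=> //; exact/pcode1.
Qed.
End StdCoded.

Lemma std_coded (R : realType) d (X : measurableType d) : standard_borel R X ->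
  exists c : X -> nat -> nat, coded (@measurable d X) c /\ forall x n, (c x n <= 1)%N.
Proof.
move=> [P [Pc /countable_basis [U [Uo Ub]] [h [bh mh]]]].
exists (fun x => pcode U (h x)); split; last by move=> x n; exact: leq_b1.
split.
- by move=> x y /(pcode_inj Ub); exact: bij_inj.
- rewrite (_ : [set pcode U (h i) | i in [set: X]] = [set a | isfilt U a]); first exact: borelN_isfilt.
  apply/seteqP; split=> [a [x _ <-]|a fa]; first exact: isfilt_pcode.
  have [p <-] := isfilt_ex Uo Pc fa; have [g gh hg] := bh.
  by exists (g p) => //; rewrite hg.
- apply: (mfunN (meas_sig X)) => n a; rewrite /pcode.
  rewrite (_ : mkset _ = [set x | (U n (h x) /\ a = 1%N) \/ (~ U n (h x) /\ a = 0%N)]).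
    have mU : measurable [set x | U n (h x)].
      by apply/mh; apply: sub_sigma_algebra.
    apply: (s_or (meas_sig X)); apply: (s_and (meas_sig X)) => //; try exact: (s_const (meas_sig X)).
    exact: (s_not (meas_sig X)).
  apply/seteqP; split=> x /=; case: asboolP => hx.
  - by move=> <-; left.
  - by move=> <-; right.
  - by case=> -[].
  - by case=> -[].
- move=> A mA; pose S := [set V | exists B, borelN B /\ h @^-1` V = (fun x => pcode U (h x)) @^-1` B].
  have [g gh hg] := bh.
  have eA : A = h @^-1` (g @^-1` A) by apply/seteqP; split=> x /=; rewrite gh.
  have : <<s @open P >> (g @^-1` A) by apply/mh; rewrite -eA.
  have sS : sigalg S.
    split.
    - move=> V [B [hB e]]; exists (~` B); split; first exact: borelN_setC.
      by apply/funext => x; exact: (congr1 not (congr1 (fun Q : set X => Q x) e)).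
    - move=> V hV; have [B hB] := choice hV; exists (\bigcup_i B i); split.
        by apply: borelN_bigcup => i; exact: (hB i).1.
      by rewrite 2!preimage_bigcup; apply: eq_bigcupr => i _; exact: (hB i).2.
    - by exists [set x | False], [set x | False]; split=> //; exact: (s_const borelN_sig).
  have GS : @open P `<=` S by move=> V /(pcode_open Ub) [B [hB ->]]; exists B.
  by move/(sigma_sub sS GS) => [B [hB e]]; exists B; rewrite -e -eA.
Qed.

(** * Closed subsets of the Baire space as standard Borel spaces *)

Record clspace := Clspace { cl_set : set (nat -> nat); cl_pt : nat -> nat; cl_in : cl_set cl_pt }.

Definition clpoint (R : realType) (s : clspace) := {z | cl_set s z}.

Section ClosedSpace.
Variables (R : realType) (s : clspace).
Local Open Scope ring_scope.
Implicit Types x y z : clpoint R s.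
Let half : R := 2^-1.
Let half_gt0 n : 0 < half ^+ n. Proof. by rewrite exprn_gt0 // invr_gt0 ltr0n. Qed.
Let half_lt1 : half < 1. Proof. by rewrite invf_lt1 ?ltr0n // ltr1n. Qed.
Let half_lt m n : (half ^+ m < half ^+ n) = (n < m)%N.
Proof. by apply: ltr_iXn2l => //; exact: (half_gt0 1). Qed.

Lemma cldist_ex x y : exists e : R, (x = y /\ e = 0) \/
  (exists k, [/\ e = half ^+ k, sval x k <> sval y k & forall i, (i < k)%N -> sval x i = sval y i]).
Proof.
case: (pselect (x = y)) => [->|ne]; first by exists 0; left.
have h : exists i, sval x i != sval y i.
  apply: contrapT => h; apply: ne; apply: sval_inj; apply/funext => i.
  by apply: contrapT => /eqP ni; apply: h; exists i.
have [k /eqP hk mk] := ex_minnP h; exists (half ^+ k); right; exists k; split=> // i ik.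
by apply: contrapT => /eqP /mk; lia.
Qed.

Definition cldist x y : R := proj1_sig (cid (cldist_ex x y)).

Lemma cldistP x y n : (cldist x y < half ^+ n) <-> forall i, (i <= n)%N -> sval x i = sval y i.
Proof.
rewrite /cldist; case: cid => e /= [[-> ->]|[k [-> nk hk]]]; first by split.
rewrite half_lt; split=> [nk' i hi|h]; first by apply: hk; lia.
by rewrite ltnNge; apply/negP => kn; apply: nk; exact: h.
Qed.

Lemma cldist_ge0 x y : 0 <= cldist x y.
Proof. by rewrite /cldist; case: cid => e /= [[_ ->]|[k [-> _ _]]] //; exact: ltW. Qed.

Lemma cldist_xx x : cldist x x = 0.
Proof. by rewrite /cldist; case: cid => e /= [[_ ->]|[k [_ /(_ erefl)]]]. Qed.

Lemma cldist_eq x y : cldist x y = 0 -> x = y.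
Proof.
by rewrite /cldist; case: cid => e /= [[-> _]//|[k [-> _ _]]] e0; have := half_gt0 k; rewrite e0 ltxx.
Qed.

Lemma cldist_sym x y : cldist x y = cldist y x.
Proof.
suff H a b : cldist a b <= cldist b a by apply/eqP; rewrite eq_le !H.
rewrite leNgt; apply/negP => lt; move: (lt); rewrite {2}/cldist; case: cid => e /= [[_ ->]|[k [-> nk _]]].
  by rewrite ltNge cldist_ge0.
by move/cldistP => /(_ k (leqnn k)) /esym.
Qed.

Lemma cldist_tri y x z : cldist x z <= cldist x y + cldist y z.
Proof.
have h1 := cldist_ge0 x y; have h2 := cldist_ge0 y z.
rewrite [X in X <= _]/cldist; case: cid => e /= [[_ ->]|[k [-> nk _]]]; first exact: addr_ge0.
rewrite leNgt; apply/negP => lt.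
have /cldistP /(_ k (leqnn k)) e1 : cldist x y < half ^+ k by apply: le_lt_trans lt; rewrite lerDl.
have /cldistP /(_ k (leqnn k)) e2 : cldist y z < half ^+ k by apply: le_lt_trans lt; rewrite lerDr.
by apply: nk; rewrite e1.
Qed.

Lemma half_small (e : R) : 0 < e -> exists n : nat, half ^+ n < e.
Proof.
move=> e0; exists (Num.truncn e^-1); rewrite /half exprVn invf_plt ?posrE ?exprn_gt0 ?ltr0n //.
apply: (lt_le_trans (truncnS_gt _)); rewrite -natrX ler_nat; exact: ltn_expl.
Qed.
End ClosedSpace.

HB.instance Definition _ (R : realType) (s : clspace) := gen_eqMixin (clpoint R s).
HB.instance Definition _ (R : realType) (s : clspace) := gen_choiceMixin (clpoint R s).
HB.instance Definition _ (R : realType) (s : clspace) := isPointed.Build (clpoint R s) (exist _ _ (cl_in s)).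
HB.instance Definition _ (R : realType) (s : clspace) := isMetric.Build R (clpoint R s)
  (@cldist_xx R s) (@cldist_eq R s) (@cldist_sym R s) (@cldist_tri R s).

Section ClosedSpace2.
Variables (R : realType) (s : clspace).
Hypothesis cF : closedN (cl_set s).
Local Open Scope ring_scope.
Notation T := (clpoint R s).

Lemma cl_ball (x y : T) n : ball x (2^-1 ^+ n : R) y <-> forall i, (i <= n)%N -> sval x i = sval y i.
Proof. by rewrite ballEmdist; exact: cldistP. Qed.

Lemma cl_complete (F : set_system T) : ProperFilter F -> cauchy F -> exists p : T, F --> p.
Proof.
move=> FF /cauchyP cF'.
have H n : exists x : T, F (ball x (2^-1 ^+ n)) by apply: cF'; rewrite exprn_gt0 // invr_gt0 ltr0n.
have [x hx] := choice H.
have ag n m i : (i <= n)%N -> (i <= m)%N -> sval (x n) i = sval (x m) i.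
  move=> hn hm; have [y [/cl_ball h1 /cl_ball h2]] := filter_ex (filterI (hx n) (hx m)).
  by rewrite h1 // h2.
have hz : cl_set s (fun i => sval (x i) i).
  apply: cF => n; exists (sval (x n)); split; first exact: svalP.
  by apply/mkseq_eq => i hi; apply: ag; lia.
exists (exist _ _ hz) => V /nbhs_ballP [e /= e0 he].
have [n hn] := half_small e0; apply: filterS (hx n) => y /cl_ball hy.
apply: he; apply: (le_ball (ltW hn)); apply/cl_ball => i hi /=.
by rewrite -hy //; exact: ag.
Qed.

Definition clcyl (q : seq nat) : set T := [set x | mkseq (sval x) (size q) = q].

Lemma clcyl_open q : open (clcyl q).
Proof.
rewrite openE => x xq; apply/nbhs_ballP; exists (2^-1 ^+ size q) => /=; first by rewrite exprn_gt0 // invr_gt0 ltr0n.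
move=> y /cl_ball h; rewrite /clcyl /= -[RHS]xq; apply/mkseq_eq => i hi; by rewrite h // ltnW.
Qed.

Lemma clcyl_nbhs (x : T) V : nbhs x V -> exists q, clcyl q x /\ clcyl q `<=` V.
Proof.
move=> /nbhs_ballP [e /= e0 he]; have [n hn] := half_small e0.
exists (mkseq (sval x) n.+1); split; first by rewrite /clcyl /mkset size_mkseq.
move=> y; rewrite /clcyl /mkset size_mkseq => /mkseq_eq h; apply: he; apply: (le_ball (ltW hn)).
by apply/cl_ball => i hi; rewrite h.
Qed.

Lemma cl_second : @second_countable T.
Proof.
exists (range clcyl); first by apply: card_le_trans (card_image_le _ _) _; exact: countableP.
split; first by move=> _ [q _ <-]; exact: clcyl_open.
move=> x V /clcyl_nbhs [q [qx qV]]; exists (clcyl q) => //; split=> //; by exists q.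
Qed.

Definition clmeas := g_sigma_algebraType (@open T).

Lemma cl_std : standard_borel R clmeas.
Proof.
exists T; split; [exact: cl_complete|exact: cl_second|].
by exists id; split=> //; exists id.
Qed.

Lemma clmeas_code : borelN (cl_set s) -> coded (@measurable _ clmeas) (fun x : clmeas => sval (x : T)).
Proof.
move=> bF; have sm := meas_sig clmeas; split.
- by move=> x y; exact: sval_inj.
- rewrite (_ : [set sval x | x in [set: T]] = cl_set s) //.
  by apply/seteqP; split=> [_ [x _ <-]|z hz]; [exact: svalP|exists (exist _ z hz)].
- apply: (mfunN sm) => n a; apply: sub_sigma_algebra; rewrite openE => x xn; apply/nbhs_ballP.
  exists (2^-1 ^+ n) => /=; first by rewrite exprn_gt0 // invr_gt0 ltr0n.
  by move=> y /cl_ball h; rewrite /= -h.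
- move=> A; pose S := [set V : set T | exists B, borelN B /\ V = (fun x : T => sval x) @^-1` B].
  have sS : sigalg S.
    split.
    + by move=> V [B [hB ->]]; exists (~` B); split; first exact: borelN_setC.
    + move=> V hV; have [B hB] := choice hV; exists (\bigcup_i B i); split.
        by apply: borelN_bigcup => i; exact: (hB i).1.
      by rewrite preimage_bigcup; apply: eq_bigcupr => i _; exact: (hB i).2.
    + by exists [set x | False], [set x | False]; split=> //; exact: (s_const borelN_sig).
  apply: (sigma_sub sS) => V oV.
  exists [set z | exists q, mkseq z (size q) = q /\ clcyl q `<=` V]; split.
    apply: (s_ex borelN_sig) => q; apply: (s_and borelN_sig); last exact: (s_const borelN_sig).
    by apply: (s_mkseq (f := id) _ _ borelN_sig) => B.
  apply/seteqP; split=> x => [Vx|[q [qx]]]; last exact.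
  by have [q [qx qV]] := clcyl_nbhs (open_nbhs_nbhs (conj oV Vx)); exists q.
Qed.
End ClosedSpace2.

(** Converse of [std_coded]. A Borel set is the injective projection of a closed set, and that
    closed set with its ultrametric is the required space. *)
Lemma coded_std (R : realType) (B : set (nat -> nat)) : borelN B -> B !=set0 ->
  exists d (X : measurableType d) (c : X -> nat -> nat),
    [/\ standard_borel R X, coded (@measurable d X) c & range c = B].
Proof.
move=> bB [z0 Bz0]; have [C [hC eC cC]] := borelN_code bB.
pose F := [set C u | u in B].
have FE : F = [set z | B (evens z) /\ C (evens z) = z].
  apply/seteqP; split=> [_ [u Bu <-]|z [h1 h2]]; first by rewrite /= eC.
  by exists (evens z).
have bF : borelN F.
  rewrite FE; apply: (s_and borelN_sig); first exact: (mfun_evens bB).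
  by apply: (s_eqN borelN_sig); [exact: mfun_comp mfun_evens hC|move=> A].
pose s := @Clspace F (C z0) (imageP _ Bz0).
have [cin crg cm cA] := clmeas_code R (s := s) bF.
have CE (x : clmeas R s) : B (evens (sval (x : clpoint R s))) /\ C (evens (sval (x : clpoint R s))) = sval (x : clpoint R s).
  have FE' z : F z -> B (evens z) /\ C (evens z) = z by rewrite FE.
  exact: FE' (svalP (x : clpoint R s)).
have rgE : [set evens (sval (x : clpoint R s)) | x in [set: clmeas R s]] = B.
  apply/seteqP; split=> [_ [x _ <-]|u Bu]; first exact: (CE x).1.
  by exists (exist _ (C u) (imageP _ Bu)) => //=; rewrite eC.
exists _, (clmeas R s), (fun x => evens (sval (x : clpoint R s))); split=> //; first exact: cl_std.
split.
- move=> x y e; apply: cin; by rewrite -(CE x).2 -(CE y).2 e.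
- by rewrite rgE.
- exact: mfun_comp cm mfun_evens.
- move=> A /cA [B' [bB' ->]]; exists (C @^-1` B'); split; first exact: hC.
  by apply/seteqP; split=> x; rewrite /= (CE x).2.
Qed.

(** * Transfer between measurable spaces and codes *)

Lemma mfunP d d' (X : measurableType d) (Y : measurableType d') (f : X -> Y) :
  measurable_fun setT f <-> mfun (@measurable d X) (@measurable d' Y) f.
Proof.
split=> [h B mB|h _ B mB]; last by rewrite setTI; exact: h.
by have := h measurableT B mB; rewrite setTI.
Qed.

Lemma mfun_fst d d' (X : measurableType d) (Y : measurableType d') :
  mfun (@measurable _ (X * Y)%type) (@measurable d X) fst.
Proof. exact/mfunP. Qed.

Lemma mfun_snd d d' (X : measurableType d) (Y : measurableType d') :
  mfun (@measurable _ (X * Y)%type) (@measurable d' Y) snd.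
Proof. exact/mfunP. Qed.

Lemma prod_bor d d' (X : measurableType d) (Y : measurableType d') c c' (M : set (X * Y)) :
  coded (@measurable d X) c -> coded (@measurable d' Y) c' -> measurable M ->
  exists B, borelN B /\ forall p, M p <-> B (pairN (c p.1) (c' p.2)).
Proof.
move=> [_ _ _ cA] [_ _ _ cA']; pose S := [set M : set (X * Y) | exists B, borelN B /\ forall p, M p <-> B (pairN (c p.1) (c' p.2))].
have sS : sigalg S.
  split.
  - move=> A [B [hB h]]; exists (~` B); split; first exact: borelN_setC.
    by move=> p; split=> nA; [move/h|move/(h p)].
  - move=> A hA; have [B hB] := choice hA; exists (\bigcup_i B i); split.
      by apply: borelN_bigcup => i; exact: (hB i).1.
    by move=> p; split=> -[i _ Ai]; exists i => //; apply/(hB i).2.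
  - by exists [set x | False], [set x | False]; split=> //; exact: (s_const borelN_sig).
apply: (sigma_sub sS) => A [[A' mA' <-]|[A' mA' <-]].
  have [B [bB ->]] := cA _ mA'; exists (evens @^-1` B); split; first exact: mfun_evens.
  by move=> p; rewrite setTI /= evens_pairN.
have [B [bB ->]] := cA' _ mA'; exists (odds @^-1` B); split; first exact: mfun_odds.
by move=> p; rewrite setTI /= odds_pairN.
Qed.

Lemma std_action (R : realType) d (Y : measurableType d) (E : Y -> Y -> Prop) :
  standard_borel R Y -> cber E -> exists e g psi,
    borel_action (@measurable d Y) e g psi /\ forall x y, E x y <-> exists m, g m x = y.
Proof.
move=> /std_coded [e [he e1]] [[Er Es Et] mE cE].
have [B [bB EB]] := prod_bor he he mE.
have EB' x y : E x y <-> B (pairN (e x) (e y)) := EB (x, y).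
have [g [g0 gM gE]] := cber_maps he bB EB' Er cE.
have [psi [pM pK]] := coded_psi point he.
exists e, g, psi; split=> //; split=> //.
- by move=> n m y; apply/gE; apply: (Et _ (g m y)); apply/gE; [exists m|exists n].
- by move=> m y; apply/gE; apply: Es; apply/gE; exists m.
Qed.

(** Relations are pulled back along [f], which is an isomorphism on each class. *)
Lemma structurable_pullback (L : language) (K : set (Lstructure L)) d d' (X : measurableType d)
    (Y : measurableType d') (F : X -> X -> Prop) (E : Y -> Y -> Prop) (f : X -> Y) :
  cber F -> structurable K E -> mfun (@measurable d X) (@measurable d' Y) f ->
  (forall x, set_bij [set x' | F x x'] [set y | E (f x) y] f) -> structurable K F.
Proof.
move=> cF [_ [Q [mQ hQ]]] mf bf; split=> //.
exists (fun i => map_tuple f @^-1` Q i); split=> [i|x].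
  have /mfunP : measurable_fun setT (map_tuple f : (arity i).-tuple X -> (arity i).-tuple Y).
    apply/measurable_fun_tnthP => j.
    rewrite (_ : _ \o _ = f \o (fun t => tnth t j)); last by apply/funext => t; rewrite /= tnth_map.
    by apply: measurableT_comp; [exact/mfunP|exact: measurable_tnth].
  by apply; exact: mQ.
have [M KM [h [bh hh]]] := hQ (f x); exists M => //; exists (h \o f); split.
  exact: set_bij_comp (bf x) bh.
move=> i t ht; have hft k : [set y | E (f x) y] (tnth (map_tuple f t) k).
  by rewrite tnth_map; have [fs _ _] := bf x; exact: fs.
rewrite /= (hh i (map_tuple f t) hft); suff -> : map_tuple h (map_tuple f t) = map_tuple (h \o f) t by [].
by apply: val_inj; rewrite /= map_comp.
Qed.

(** * The independent join on the free trees, and its embedding *)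

Section FreeJoin.
Variables (R : realType) (L : language) (K : set (Lstructure L)).
Variables (d : measure_display) (Y : measurableType d) (E : Y -> Y -> Prop) (e : Y -> nat -> nat)
  (g : nat -> Y -> Y) (psi : (nat -> nat) -> Y).
Hypotheses (H : borel_action (@measurable d Y) e g psi) (EG : forall x y, E x y <-> exists m, g m x = y)
  (sE : structurable K E).
Variables (I : countType) (i0 : I) (ti : nat -> I) (D : set nat).
Hypotheses (ti_inj : forall a b, D a -> D b -> ti a = ti b -> a = b)
  (ti_sur : forall i, exists a, D a /\ ti a = i) (cl : closed_under_independent_joins R K D).
Notation labelling := (labelling I Y).
Notation labelling_sets := (@labelling_sets I Y e).
Definition free_part : set labelling := [set z | coherent g z /\ cycle_free i0 z].

Lemma free_part_sig : labelling_sets free_part.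
Proof.
have hc := ba_code H; apply: (s_and (labelling_sig I hc)); first exact: (coherent_sig I hc (ba_meas H)).
exact: cycle_free_sig hc.
Qed.

Lemma free_part_joined z z' : free_part z -> joined z z' -> free_part z'.
Proof. by move=> [oz fz] [w <-]; split; [exact: coherent_shiftw|exact: cycle_free_shiftw]. Qed.

(** The free trees are a Borel set of labellings; they are re-coded as a standard Borel space so
    that the closure hypothesis applies. Absence of alternating simple cycles gives independence,
    and reading words letter by letter identifies the join with [joined]. *)
Lemma free_join : (exists z, free_part z) -> exists d' (X : measurableType d') (F : X -> X -> Prop) (q : X -> labelling),
  (standard_borel R X /\ structurable K F) /\ (mfun (@measurable d' X) labelling_sets q /\ injective q) /\
  (forall A, measurable A -> labelling_sets (q @` A)) /\
  (forall z, free_part z <-> exists x, q x = z) /\ forall x x', F x x' <-> joined (q x) (q x').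
Proof.
move=> [z0 fz0]; have hc := ba_code H; have hz := labelling_coded I hc; have [czi czr czm czA] := hz.
have [B0 [bB0 eB0]] := free_part_sig.
pose B := [set a | B0 a /\ range (@labelling_code I Y e) a].
have bB : borelN B by exact: (s_and borelN_sig).
have [|d' [X [c [sX hX rc]]]] := coded_std R bB.
  by exists (labelling_code e z0); split; [move: fz0; rewrite eB0|exists z0].
have [ci _ cm cA] := hX.
have Hq x : exists z, free_part z /\ labelling_code e z = c x.
  have : B (c x) by rewrite -rc; exists x.
  by move=> [h1 [z _ ez]]; exists z; split=> //; rewrite eB0 /= ez.
have [q hq] := choice Hq.
have qi : injective q by move=> x x' h; apply: ci; rewrite -(hq x).2 -(hq x').2 h.
have qs z : free_part z -> exists x, q x = z.
  move=> fz; have : B (labelling_code e z) by split; [move: fz; rewrite eB0|exists z].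
  by rewrite -rc => -[x _ cx]; exists x; apply: czi; rewrite (hq x).2.
have qm : mfun (@measurable d' X) labelling_sets q.
  apply: (mfun_coded hz); rewrite (_ : _ \o _ = c) //; apply/funext => x; exact: (hq x).2.
have qo A : measurable A -> labelling_sets (q @` A).
  move=> /cA [B' [bB' eA]]; rewrite (_ : q @` A = free_part `&` @labelling_code I Y e @^-1` B').
    by apply: (s_and (labelling_sig I hc)); [exact: free_part_sig|exact: czm].
  apply/seteqP; split=> [_ [x Ax <-]|z [/qs [x <-]]].
    by split; [exact: (hq x).1|rewrite /= (hq x).2; move: Ax; rewrite eA].
  by rewrite /= (hq x).2 => h; exists x => //; rewrite eA.
have sX' := meas_sig X; have ok x : coherent g (q x) by have [[]] := hq x.
pose F n x x' := linked (ti n) (q x) (q x').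
have mv l x : exists x', q x' = shiftw [:: l] (q x).
  by apply: qs; apply: free_part_joined (hq x).1 _; exact: joined_shiftw.
have Feq n : RelationClasses.Equivalence (F n).
  split; first by move=> x; exact: linked_refl.
  - by move=> x x'; exact: (linked_sym (ba_0 H) (ba_inv H) (ok x)).
  - by move=> x x' x''; exact: (linked_trans (ba_comp H) (ok x)).
have Fc n : cber (F n).
  split=> //.
  - have sXX := meas_sig (X * X)%type.
    have m1 := mfun_comp (@mfun_fst _ _ X X) qm; have m2 := mfun_comp (@mfun_snd _ _ X X) qm.
    by apply: (s_ex sXX) => m; apply: (s_eq sXX hz) m2; exact: (mfun_comp m1 (mfun_shiftw hc _)).
  - move=> x; have [f hf] := choice (fun m => mv (ti n, m) x).
    apply: (@sub_countable _ _ _ (range f)); last exact: card_le_trans (card_image_le _ _) (countableP _).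
    by apply: subset_card_le => x' [m hm]; exists m => //; apply: qi; rewrite hf.
(* The base point in direction [ti n] maps each class bijectively onto an [E]-class. *)
have Fs n : structurable K (F n).
  apply: (structurable_pullback (Fc n) sE (f := fun x => basept (ti n) (q x))).
    exact: mfun_comp qm (mfun_label_pt hc _ _).
  move=> x; have [h1 _] := coherent_coherent1 (ok x) (ti n); split.
  - by move=> x' [m hm]; apply/EG; exists m; rewrite -hm h1.
  - move=> x1 x2; rewrite !inE => h2 h3 h4; apply: qi.
    exact: (linked_inj (ba_0 H) (ok x) h2 h3 h4).
  - move=> y /EG [m <-]; have [x' hx'] := mv (ti n, m) x; exists x'; first by exists m.
    by rewrite hx' h1.
have ind : independent D F.
  move=> [n [x [k [n2 xi kD kk [hE hn]]]]].
  have nocyc m (x' : nat -> X) kx : (2 <= m)%N ->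
    (forall a b, (a < m)%N -> (b < m)%N -> x' a = x' b -> a = b) ->
    (forall a, (a < m)%N -> F (kx a) (x' a) (x' (a.+1 %% m))) ->
    (forall a, (a < m)%N -> D (kx a)) -> (forall a, (a < m)%N -> kx a <> kx (a.+1 %% m)) -> False.
    move=> m2 x'i hF hD hk; have [|||w hw] := @simple_cycle_of_edges _ i0 _ m (q \o x') (ti \o kx) m2.
    - by move=> a b am bm /qi; exact: x'i.
    - by [].
    - move=> a am /ti_inj h; apply: (hk a am); apply: h; apply: hD => //; rewrite ltn_mod; lia.
    - have [[_ fz] _] := hq (x' 0); exact: (fz [::] w).
  have xi' a b : (a <= n)%N -> (b <= n)%N -> x a = x b -> a = b by move=> an bn; apply: xi; rewrite inE.
  (* Independence does not compare the last index with the first. If they agree, the two edges at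
     [x 0] are merged and [n] vertices remain, which may be only two. *)
  case: (eqVneq (k n) (k 0)) => [e0|/eqP ne].
    apply: (nocyc n (fun a => x a.+1) (fun a => if a == n.-1 then k 0 else k a.+1)) => //.
    - by move=> a b an bn /xi' h; have := h ltac:(lia) ltac:(lia); lia.
    - move=> a an; case: eqP => [->|nn].
        rewrite prednK ?modnn; last by lia.
        have h1 := hE 0 ltac:(lia); rewrite -e0 /F /= in h1 *; move: hn h1; rewrite e0 => h0 h1.
        exact: (linked_trans (ba_comp H) (ok _) h0 h1).
      by rewrite modn_small; [apply: hE; lia|lia].
    - by move=> a an; case: eqP => _; apply: kD; lia.
    - move=> a an; case: eqP => [->|nn].
        rewrite prednK ?modnn; last by lia.
        case: eqP => h0; first by lia.
        exact: (kk 0 ltac:(lia)).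
      rewrite modn_small; last by lia.
      case: eqP => h0; last by apply: kk; lia.
      by rewrite -e0 (_ : n = a.+2); [apply: kk; lia|lia].
  apply: (nocyc n.+1 x k) => //; first by lia.
  - by move=> a an; case: (eqVneq a n) => [->|nn]; [rewrite modnn|rewrite modn_small; [apply: hE|]; lia].
  - by move=> a an; case: (eqVneq a n) => [->|nn]; [rewrite modnn|rewrite modn_small; [apply: kk|]; lia].
have sJ := @cl d' X F sX (fun n _ => Fs n) ind.
exists d', X, (join D F), q; split=> //; split=> //; split=> //; split.
  by move=> z; split=> [/qs //|[x <-]]; exact: (hq x).1.
move=> x x'; split.
  move=> hj; apply: (hj (fun a b => joined (q a) (q b))).
    split; first by move=> a; exact: joined_refl.
    - by move=> a b; exact: (joined_sym (ba_0 H) (ba_inv H) (ok a)).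
    - by move=> a b c'; exact: joined_trans.
  by move=> n _ a b [m hm]; exists [:: (ti n, m)].
move=> [w hw] G eG hG; elim: w x hw => [|[i m] w IH] x hw.
  by move: hw; rewrite shiftw0 => /qi ->; case: eG.
have [x1 hx1] := mv (i, m) x; have [n [Dn en]] := ti_sur i.
have G1 : G x x1 by apply: (hG n Dn); exists m; rewrite en.
have G2 : G x1 x' by apply: IH; rewrite hx1 shiftwD.
by case: eG => _ _ Gt; exact: Gt G1 G2.
Qed.
End FreeJoin.

Section FreeEmbed.
Variables (R : realType) (L : language) (K : set (Lstructure L)).
Variables (d : measure_display) (Y : measurableType d) (E : Y -> Y -> Prop) (e : Y -> nat -> nat)
  (g : nat -> Y -> Y) (psi : (nat -> nat) -> Y).
Hypotheses (H : borel_action (@measurable d Y) e g psi) (EG : forall x y, E x y <-> exists m, g m x = y)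
  (sE : structurable K E).
Variables (I : countType) (i0 : I) (ti : nat -> I) (D : set nat).
Hypotheses (ti_inj : forall a b, D a -> D b -> ti a = ti b -> a = b)
  (ti_sur : forall i, exists a, D a /\ ti a = i) (cl : closed_under_independent_joins R K D).
Notation Zf := (@free_part d Y g I i0).
Notation labelling_sets := (@labelling_sets I Y e).

(** A free tree is obtained from determinacy itself: with the trivial condition in every direction
    some direction is won, and its assembled runs are free. *)
Lemma free_part_ex : exists z, Zf z.
Proof.
have sZ := labelling_sig I (ba_code H).
have [||j hj] := @Wins_cover I i0 Y _ e g psi H (fun=> setT).
- by move=> _; exact: (s_const sZ True).
- by move=> z _ _; exists i0.
have [Z [_ hZ _ _ _]] := Wins_embedding H hj.
by exists (Z point); exact: hZ.
Qed.

Lemma free_embed d2 (Y2 : measurableType d2) (E2 : Y2 -> Y2 -> Prop) : universal_structurable R K E2 ->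
  exists h : labelling I Y -> Y2, [/\ forall A, measurable A -> labelling_sets (Zf `&` h @^-1` A),
    forall z z', Zf z -> Zf z' -> joined z z' <-> E2 (h z) (h z') &
    forall z z', Zf z -> Zf z' -> h z = h z' -> z = z'].
Proof.
move=> [_ uni].
have [d' [X [F [q [[sX sF] [[mq qi] [qo [qs qJ]]]]]]]] := free_join H EG sE ti_inj ti_sur cl free_part_ex.
have [f [[mf _ fr] fi _]] := uni _ X F sX sF.
have Hh z : exists y, forall x, q x = z -> y = f x.
  case: (pselect (exists x, q x = z)) => [[x hx]|nx]; last by exists point => x hx; exfalso; apply: nx; exists x.
  by exists (f x) => x'; rewrite -hx => /qi ->.
have [h hh] := choice Hh; have hq x : h (q x) = f x by exact: hh.
exists h; split.
- move=> A mA; rewrite (_ : _ `&` _ = q @` (f @^-1` A)); last first.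
    apply/seteqP; split=> [z [/qs [x <-]]|_ [x Ax <-]]; first by rewrite /= hq => Ax; exists x.
    by split; [apply/qs; exists x|rewrite /= hq].
  by apply: qo; rewrite -[X in measurable X]setTI; exact: mf.
- by move=> z z' /qs [x <-] /qs [x' <-]; rewrite !hq -qJ; exact: fr.
- by move=> z z' /qs [x <-] /qs [x' <-]; rewrite !hq => /fi -> //; rewrite inE.
Qed.

Lemma Wins_embeds (h : labelling I Y -> Y) j (A : set Y) : (forall A, measurable A -> labelling_sets (Zf `&` h @^-1` A)) ->
  (forall z z', Zf z -> Zf z' -> joined z z' <-> E (h z) (h z')) ->
  (forall z z', Zf z -> Zf z' -> h z = h z' -> z = z') ->
  Wins i0 e g psi j (Zf `&` h @^-1` A) -> borel_embeds setT E A E.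
Proof.
move=> mh hJ hi /(Wins_embedding H) [Z [mZ fZ AZ Zi ZJ]].
exists (h \o Z); split; last first.
  by move=> x y _ _ exy; apply: Zi; apply: hi exy; exact: fZ.
split.
- apply/mfunP => B mB; rewrite (_ : _ @^-1` B = Z @^-1` (Zf `&` h @^-1` B)); first exact: mZ (mh B mB).
  by apply/seteqP; split=> v; [move=> hB; split; [exact: fZ|]|case].
- by move=> v _; have [] := AZ v.
- by move=> x y _ _; rewrite EG -ZJ; exact: hJ.
Qed.
End FreeEmbed.

(** * Part 3: countable covers and injective reductions *)

Section Consequences.
Variables (R : realType) (L : language) (K : set (Lstructure L)).
Variables (d : measure_display) (Y : measurableType d) (E : Y -> Y -> Prop).
Hypotheses (Ystd : standard_borel R Y) (Euniv : universal_structurable R K E).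

Lemma countable_cover_embeds (A : nat -> set Y) :
  closed_under_independent_joins R K setT -> (forall i, measurable (A i)) ->
  (forall y, exists i, A i y) -> exists i, borel_embeds setT E (A i) E.
Proof.
move=> cl mA cov; have sE := Euniv.1.
have [e [g [psi [H EG]]]] := std_action Ystd sE.1.
have ti_inj (a b : nat) : [set: nat] a -> [set: nat] b -> a = b -> a = b by [].
have ti_sur (i : nat) : exists a : nat, [set: nat] a /\ a = i by exists i.
have [h [mh hJ hi]] := free_embed H EG sE 0 ti_inj ti_sur cl Euniv.
have [||i hW] := @Wins_cover _ 0 Y _ e g psi H (fun i => @free_part d Y g nat 0 `&` h @^-1` A i).
- by move=> i; exact: mh.
- by move=> z oz fz; have [i Ai] := cov (h z); exists i; split.
by exists i; exact: (Wins_embeds H EG mh hJ hi hW).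
Qed.

(** Points with the same image under a reduction are equivalent, so [f] is countable-to-one. A cover
    of its reversed graph by thin sets splits [Y] into Borel sets on which [f] is injective; [E]
    embeds into its restriction to one of them, and [f] is applied afterwards. *)
Lemma reducible_embeds d' (X : measurableType d') (F : X -> X -> Prop) :
  closed_under_independent_joins R K setT -> standard_borel R X -> cber F ->
  borel_reducible setT E setT F -> borel_embeds setT E setT F.
Proof.
move=> cl Xstd [_ _ cF] [f [mf _ fr]]; have [[Er Es Et] _ cE] := Euniv.1.1.
have [c [hc _]] := std_coded Ystd; have [c' [hc' _]] := std_coded Xstd.
have mf' : mfun (@measurable d Y) (@measurable d' X) f by exact/mfunP.
have mcf := mfun_comp mf' (mfun_code hc' (fun B (hB : measurable B) => hB)).
have [ci crg cm cA] := hc; have [ci' crg' cm' _] := hc'.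
pose R0 := [set u | range c (odds u) /\ exists y, u = pairN (c' (f y)) (c y)].
have [psi [pM pK]] := coded_psi point hc.
have R0E : R0 = [set u | range c (odds u) /\ evens u = c' (f (psi (odds u)))].
  apply/seteqP; split=> u [h1]; first by case=> y ey; split=> //; rewrite ey evens_pairN odds_pairN pK.
  by case: h1 => y _ cy h2; split; [exists y|exists y; rewrite -[LHS]pairN_evens_odds h2 -cy pK].
have bR : borelN R0.
  rewrite R0E; apply: (s_and borelN_sig); first exact: (mfun_odds crg).
  apply: (s_eqN borelN_sig); first exact: mfun_evens.
  exact: (mfun_comp (mfun_comp mfun_odds pM) mcf).
have [x|Q [hQ RQ]] := thin_cover bR.
  case: (pselect (exists y, c' (f y) = x)) => [[y0 <-]|nx]; last first.
    by exists (fun _ _ => 0) => u [_ [y ->]]; rewrite evens_pairN => ey; exfalso; apply: nx; exists y.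
  have [en hen] := cnt_enum y0 (cE y0).
  exists (fun n => pairN (c' (f y0)) (c (en n))) => u [_ [y ->]]; rewrite evens_pairN => /ci' efy; rewrite efy.
  have [|n ->] := hen y; first by apply/fr => //; rewrite efy; apply/(fr y0 y0).
  by exists n.
pose A k := [set y | Q k (pairN (c' (f y)) (c y))].
have [||k [h [[mh hA hr] hi]]] := @countable_cover_embeds A cl.
- move=> k; apply: (mfun_pairN (meas_sig Y) mcf cm); exact: (hQ k).1.
- move=> y; have : R0 (pairN (c' (f y)) (c y)) by split; [rewrite odds_pairN; exists y|exists y].
  by rewrite RQ => -[k _ Qk]; exists k.
exists (f \o h); split; last first.
  move=> x y xT yT exy; apply: hi xT yT _; apply: ci.
  have := (hQ k).2 _ _ (hA x I) (hA y I); rewrite !evens_pairN => /(_ (congr1 c' exy)).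
  by move/(congr1 odds); rewrite !odds_pairN.
split=> //; first by apply: measurableT_comp => //.
by move=> x y _ _; rewrite hr //; exact: fr.
Qed.
End Consequences.

(** The universe of [M] becomes a standard Borel space with a single class, coded by constant
    sequences. A nontrivial [M] thus yields a relation under which every point can be moved. *)
Lemma full_structurable (R : realType) (L : language) (K : set (Lstructure L)) (M : Lstructure L) a :
  K M -> universe M a -> exists d (X : measurableType d) (F : X -> X -> Prop) (k : X -> nat),
  [/\ standard_borel R X, structurable K F, forall x y, F x y & forall n, universe M n -> exists x, k x = n].
Proof.
move=> KM Ma; pose B := [set z : nat -> nat | exists n, universe M n /\ forall k, z k = n].
have bB : borelN B.
  by apply: (s_ex borelN_sig) => n; apply: (s_and borelN_sig); [exact: (s_const borelN_sig)|apply: (s_all borelN_sig) => k; exact: borelN_cyl].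
have [|d [X [c [sX [ci _ cm _] rc]]]] := coded_std R bB; first by exists (fun=> a), a.
have Hc x : exists n, universe M n /\ forall k, c x k = n by have : range c (c x); [exists x|rewrite rc].
pose k x := c x 0%N.
have ki : injective k.
  move=> x y exy; apply: ci; apply/funext => n.
  by have [m [_ hm]] := Hc x; have [m' [_ hm']] := Hc y; move: exy; rewrite /k !hm !hm'.
have kM x : universe M (k x) by have [n [Mn hn]] := Hc x; rewrite /k hn.
have ks n : universe M n -> exists x, k x = n.
  move=> Mn; have : range c (fun=> n) by rewrite rc; exists n.
  by case=> x _ ex; exists x; rewrite /k ex.
exists d, X, (fun _ _ => True), k; split=> //; split.
  split; first by split.
    exact: (s_const (meas_sig _) True).
  by move=> x; apply/countable_injP; exists k => y z _ _; exact: ki.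
exists (fun i => [set t | interp M (map_tuple k t)]); split=> [i|x].
  rewrite (_ : mkset _ = [set t | exists u : (arity i).-tuple nat, interp M u /\ forall j, k (tnth t j) = tnth u j]); last first.
    apply/seteqP; split=> t /=; first by move=> h; exists (map_tuple k t); split=> // j; rewrite tnth_map.
    by move=> [u [Mu hu]]; rewrite (_ : map_tuple k t = u) //; apply: eq_from_tnth => j; rewrite tnth_map.
  apply: (s_ex (meas_sig _)) => u; apply: (s_and (meas_sig _)); first exact: (s_const (meas_sig _)).
  apply: (s_all (meas_sig _)) => j.
  have := @measurable_tnth _ X _ j measurableT _ (cm _ (borelN_cyl 0 (tnth u j))).
  by rewrite setTI.
exists M => //; exists k; split=> //; split=> //.
- by move=> y z _ _; exact: ki.
- by move=> n /ks [y <-]; exists y.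
Qed.

(** * Part 2: the ultrafilter of large invariant sets *)

Section Ultrafilter.
Variables (R : realType) (L : language) (K : set (Lstructure L)).
Variables (d : measure_display) (Y : measurableType d) (E : Y -> Y -> Prop).
Hypotheses (Ystd : standard_borel R Y) (Euniv : universal_structurable R K E).
Hypotheses (ntK : has_nontrivial_structure K) (cl : closed_under_binary_independent_joins R K).

Let ti n : bool := n == 1%N.
Let ti_inj a b : `I_2 a -> `I_2 b -> ti a = ti b -> a = b.
Proof. by case: a b => [|[|?]] [|[|?]]. Qed.
Let ti_sur i : exists a, `I_2 a /\ ti a = i.
Proof. by case: i; [exists 1|exists 0]. Qed.

(** An alternating path through a free tree over the single-class relation is infinite, and
    universality carries it into one [E]-class. It provides room to play countably many strategies
    side by side. *)
Lemma infinite_class : exists v : nat -> Y, injective v /\ forall m n, E (v m) (v n).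
Proof.
have [M KM [a [b [Ma Mb ab]]]] := ntK.
have [d' [X [F [k [sX sF Ft ks]]]]] := full_structurable R KM Ma.
have [e [g [psi [H FG]]]] := std_action sX sF.1.
have [h [_ hJ hi]] := free_embed H FG sF false ti_inj ti_sur cl Euniv.
have [z0 fz0] := free_part_ex H false.
have [//||v [vi vJ]] := @infinite_path _ false _ _ _ _ _ H true false z0 _ fz0.1 fz0.2.
  move=> y; have [xa ha] := ks _ Ma; have [xb hb] := ks _ Mb.
  case: (pselect (y = xa)) => [ya|ya]; last by have [m hm] := (FG y xa).1 (Ft _ _); exists m => e1; apply: ya; rewrite -e1.
  by have [m hm] := (FG y xb).1 (Ft _ _); exists m; rewrite hm ya => e1; apply: ab; rewrite -ha -hb e1.
have fv n : free_part g false (v n) := free_part_joined fz0 (vJ n).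
have [[Er Es Et] _ _] := Euniv.1.1.
have hv n : E (h z0) (h (v n)) by apply/hJ => //.
exists (h \o v); split=> [m n emn|m n]; first by apply: vi; exact: hi (fv m) (fv n) emn.
by apply: Et (hv n); apply: Es; exact: hv.
Qed.

Lemma borel_card_ultrafilter : exists U : set (set Y),
  [/\ sigma_complete_ultrafilter E U, preserves_borel_card E U &
    forall A, invariant_borel E A -> U A \/ U (~` A)].
Proof.
have [v [vi vE]] := infinite_class; have sE := Euniv.1.
have [[Er Es Et] _ _] := sE.1.
have [e [g [psi [H EG]]]] := std_action Ystd sE.1.
have [h [mh hJ hi]] := free_embed H EG sE false ti_inj ti_sur cl Euniv.
pose W j A := Wins false e g psi j (free_part g false `&` h @^-1` A).
have Wcap j (A : nat -> set Y) : (forall n, invariant_borel E (A n)) -> (forall n, W j (A n)) ->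
    exists y, forall n, A n y.
  move=> iA hW; have [s hs] := choice hW.
  (* At [v n] the strategy for [A n] is played, elsewhere any of them. The trees assembled along
     this class are joined, so by invariance a single point lies in every [A n]. *)
  have Hn y : exists n, (exists m, v m = y) -> v n = y.
    by case: (pselect (exists m, v m = y)) => [[m hm]|nv]; [exists m|exists 0 => /nv].
  have [nu hnu] := choice Hn.
  have nuv n : nu (v n) = n by apply: vi; apply: hnu; exists n.
  have [Z [oZ fZ AZ shift]] := Wins_assemble H (fun y => hs (nu y)).
  exists (h (Z (v 0%N))) => n; have [_ hA] := AZ (v n); rewrite nuv in hA.
  apply: (iA n).2 hA; apply: Es; apply/(hJ _ _ (conj (oZ _) (fZ _)) (conj (oZ _) (fZ _))).
  by have [m hm] := (EG _ _).1 (vE 0%N n); exists [:: (j, m)]; rewrite shift hm.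
have iC A : invariant_borel E A -> invariant_borel E (~` A).
  move=> [mA iA]; split; first exact: measurableC.
  by move=> x y exy nA /(iA y x (Es _ _ exy)).
(* Determinacy with [A] assigned to direction [j] and its complement to the other direction. *)
have dich j A : invariant_borel E A -> W j A \/ W (~~ j) (~` A).
  move=> iA; have [||i hW] := @Wins_cover _ false Y _ e g psi H
    (fun i => free_part g false `&` h @^-1` (if i == j then A else ~` A)).
  - by move=> i; apply: mh; case: ifP => _; [exact: iA.1|exact: (iC A iA).1].
  - move=> z oz fz; case: (pselect (A (h z))) => hA; first by exists j; rewrite eqxx.
    by exists (~~ j); split=> //; case: (j).
  case: (eqVneq i j) hW => [->|ij] hW; first by left.
  by right; move: hW; rewrite (_ : i = ~~ j) //; case: i j ij => -[].
have Wdisj j A : invariant_borel E A -> W j A -> ~ W j (~` A).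
  move=> iA w1 w2; have [||y hy] := Wcap j (fun n => if n is 0 then A else ~` A).
  - by case=> // n; exact: iC.
  - by case.
  by have := hy 1%N (hy 0%N).
(* Largeness is independent of the direction, which turns the alternative between two directions
   into one for a single direction. *)
have Wflip j A : invariant_borel E A -> W j A -> W (~~ j) A.
  move=> iA w; case: (dich (~~ j) A iA) => //; rewrite negbK => w2.
  by case: (Wdisj j A iA w w2).
have Wsplit A : invariant_borel E A -> W false A \/ W false (~` A).
  by move=> iA; case: (dich false A iA) => [|/(Wflip true _ (iC A iA))]; [left|right].
pose U := [set A | invariant_borel E A /\ W false A].
have Uint (A : nat -> set Y) : (forall n, U (A n)) -> exists y, forall n, A n y.
  by move=> hU; apply: (Wcap false) => n; have [] := hU n.
have Usplit A : invariant_borel E A -> U A \/ U (~` A).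
  by move=> iA; case: (Wsplit A iA) => w; [left|right; split => //; exact: iC].
have Ucap (A : nat -> set Y) : (forall n, U (A n)) -> U (\bigcap_n A n).
  move=> hU; have iB : invariant_borel E (\bigcap_n A n).
    split; first by apply: bigcapT_measurable => n; exact: (hU n).1.1.
    by move=> x y exy hx n _; exact: (hU n).1.2 exy (hx n I).
  (* If the complement of the intersection were large, it and the [A n] would be countably many
     large sets without a common point. *)
  case: (Usplit _ iB) => // nU.
  have [|y hy] := Uint (fun n => if n is m.+1 then A m else ~` \bigcap_n A n); first by case.
  by case: (hy 0%N) => n _; exact: (hy n.+1).
have i0 : invariant_borel E set0 by split.
have U0 : ~ U set0.
  by move=> h0; have [|y /(_ 0%N)//] := Uint (fun=> set0).
exists U; split=> //.
- split=> //.
  + split=> //; first by move=> A [].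
    * by case: (Usplit _ i0) => //; rewrite setC0.
    * move=> A B UA UB; rewrite (_ : A `&` B = \bigcap_n (if n is 0 then A else B)).
        by apply: Ucap => -[].
      apply/seteqP; split=> [y [hA hB] [|n] _ //|y hy].
      by split; [exact: (hy 0%N)|exact: (hy 1%N)].
    * move=> A B [iA wA] iB AB; split=> //; apply: Wins_mono wA => z _ [fz hz].
      by split=> //; exact: AB.
  + move=> V [Vi VT V0 VI Vup] UV; apply/seteqP; split=> // A VA.
    case: (Usplit A (Vi _ VA)) => // /UV nV; exfalso; apply: V0.
    by rewrite -(setICr A); exact: VI.
- move=> A [iA wA]; split.
    by have [f [hf _]] := Wins_embeds H EG mh hJ hi wA; exists f.
  by exists id; split=> //; exact: measurable_id.
Qed.

Lemma not_smooth_union_of_smaller : ~ smooth_disjoint_union_of_smaller E.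
Proof.
move=> [f [mf fE hf]]; have [[Er Es Et] _ _] := Euniv.1.1.
have [U [[[Ui UT U0 UI Uup] _ Ucap] Ucard Usplit]] := borel_card_ultrafilter.
pose bit n b := [set y | (f y : nat -> bool) n = b].
have mbit n b : measurable (bit n b).
  rewrite -[bit n b]setTI; apply: (mf measurableT [set c : cantor_space | c n = b]).
  apply: sub_sigma_algebra.
  have : open ((fun c : cantor_space => c n) @^-1` [set b]).
    apply: open_comp; last exact: discrete_open.
    by move=> c _; exact: proj_continuous.
  by [].
have ibit n b : invariant_borel E (bit n b).
  by split=> // x y /fE; rewrite /bit /= => ->.
(* The ultrafilter decides every bit of the invariant, so by countable completeness it contains one
   fibre. *)
have Hc n : exists b, U (bit n b).
  case: (Usplit _ (ibit n true)) => hU; first by exists true.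
  exists false; rewrite (_ : bit n false = ~` bit n true) //.
  by apply/seteqP; split=> y; rewrite /bit /=; case: (_ n).
have [c hc] := choice Hc.
have := Ucap _ hc; rewrite (_ : \bigcap_n _ = f @^-1` [set c]).
  by move=> /Ucard [] r _; case: (hf c) => _; apply.
apply/seteqP; split=> y /=; last by move=> <- n _.
by move=> hy; apply/funext => n; exact: hy.
Qed.
End Ultrafilter.

(** * Part 1: a null copy *)

Lemma measurable_image d d' (X : measurableType d) (Y : measurableType d') c c' (f : X -> Y) (M : set X) :
  coded (@measurable d X) c -> coded (@measurable d' Y) c' ->
  measurable_fun setT f -> injective f -> measurable M -> measurable (f @` M).
Proof.
move=> hc hc' /mfunP mf fi mM; have [ci cr cm cA] := hc; have [ci' cr' cm' cA'] := hc'.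
have [B [bB MB]] := cA _ mM.
have [psi [pM pK]] := coded_psi point hc.
(* The coded graph of [f]; its second projection is injective, so the image is Borel. *)
pose G := [set u | [/\ range c (evens u), B (evens u) & odds u = c' (f (psi (evens u)))]].
have bG : borelN G.
  rewrite (_ : G = [set u | (range c (evens u) /\ B (evens u)) /\ odds u = c' (f (psi (evens u)))]); last first.
    by apply/seteqP; split=> u [] => [h1 h2 h3|[h1 h2] h3].
  apply: (s_and borelN_sig); first by apply: (s_and borelN_sig); exact: mfun_evens.
  apply: (s_eqN borelN_sig); first exact: mfun_odds.
  exact: (mfun_comp (mfun_comp mfun_evens pM) (mfun_comp mf cm')).
have GE u : G u <-> exists2 x, M x & u = pairN (c x) (c' (f x)).
  rewrite MB; split=> [[[x _ cx] Bu hu]|[x Bx ->]].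
    by exists x; rewrite /= ?cx // -[LHS]pairN_evens_odds hu -cx pK.
  by split; rewrite ?evens_pairN ?odds_pairN ?pK //; exists x.
have oE u : u \o (fun n => n.*2.+1) = odds u by [].
have hI : borelN [set u \o (fun n => n.*2.+1) | u in G].
  apply: lusin_souslin => // u u' /GE [x _ ->] /GE [x' _ ->].
  by rewrite !oE !odds_pairN => /ci' /fi ->.
rewrite (_ : f @` M = c' @^-1` [set u \o (fun n => n.*2.+1) | u in G]); first exact: cm'.
apply/seteqP; split=> [_ [x Mx <-]|y [u /GE [x Mx ->]]].
  by exists (pairN (c x) (c' (f x))); [apply/GE; exists x|rewrite oE odds_pairN].
by rewrite oE odds_pairN => /ci' <-; exists x.
Qed.

Lemma countable_inj T U (A : set T) (B : set U) (f : T -> U) :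
  set_fun A B f -> set_inj A f -> countable B -> countable A.
Proof.
move=> fAB fi /countable_injP [g gi]; apply/countable_injP; exists (g \o f) => x y xA yA e1.
apply: fi => //; apply: gi => //; rewrite inE; apply: fAB; exact: set_mem.
Qed.

Section NullSet.
Variables (R : realType) (L : language) (K : set (Lstructure L)).
Variables (d : measure_display) (Y : measurableType d) (E : Y -> Y -> Prop).
Hypotheses (Ystd : standard_borel R Y) (Euniv : universal_structurable R K E).

(** Projecting [E] times equality to [Y] is bijective on each class, so the product is structurable
    and embeds by universality; [F x a] is the image of the pair. The images of slabs are Borel
    because the embedding is injective. *)
Lemma cantor_product : exists (F : Y -> (nat -> nat) -> Y),
  [/\ forall (M : set (nat -> nat)), borelN M -> measurable [set y | exists x a, [/\ M a, forall n, (a n <= 1)%N & F x a = y]],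
   forall a, (forall n, (a n <= 1)%N) -> measurable_fun setT (F^~ a),
   forall x a x' a', (forall n, (a n <= 1)%N) -> (forall n, (a' n <= 1)%N) -> F x a = F x' a' -> x = x' /\ a = a' &
   forall a x x', (forall n, (a n <= 1)%N) -> E x x' <-> E (F x a) (F x' a)].
Proof.
have [[[Er Es Et] mE cE] _] := Euniv.1.
have [c [hc _]] := std_coded Ystd; have [ci cr cm cA] := hc.
have [psi [pM pK]] := coded_psi point hc.
pose B := [set u | range c (evens u) /\ forall n, (odds u n <= 1)%N].
have bB : borelN B.
  apply: (s_and borelN_sig); first exact: mfun_evens.
  apply: (s_all borelN_sig) => n; apply: (mfun_odds (B := [set a | (a n <= 1)%N])).
  rewrite (_ : mkset _ = [set a | a n = 0%N] `|` [set a | a n = 1%N]); first by apply: (s_or borelN_sig); exact: borelN_cyl.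
  by apply/seteqP; split=> a /=; [case: (a n) => [|[|?]]; [left|right|]|case=> ->].
have [|d' [X [cX [sX hX rX]]]] := coded_std R bB.
  by exists (pairN (c point) (fun=> 0)); rewrite /B /= evens_pairN odds_pairN; split=> //; exists point.
have [ciX _ cmX _] := hX; have [psiX [pMX pKX]] := coded_psi point hX.
pose p x := psi (evens (cX x)); pose al x := odds (cX x).
have BX x : B (cX x) by rewrite -rX; exists x.
have cp x : c (p x) = evens (cX x) by have [[y _ cy] _] := BX x; rewrite /p -cy pK.
have cXE x : cX x = pairN (c (p x)) (al x) by rewrite cp pairN_evens_odds.
have mp : mfun (@measurable _ X) (@measurable _ Y) p := mfun_comp (mfun_comp cmX mfun_evens) pM.
have mal : mfun (@measurable _ X) borelN al := mfun_comp cmX mfun_odds.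
pose mk y a := psiX (pairN (c y) a).
have mkE y a : (forall n, (a n <= 1)%N) -> p (mk y a) = y /\ al (mk y a) = a.
  move=> ha; have : range cX (pairN (c y) a) by rewrite rX /B /= evens_pairN odds_pairN; split=> //; exists y.
  by move=> [x _ ex]; rewrite /mk -ex pKX /al /p ex evens_pairN odds_pairN pK.
have Kmk x : mk (p x) (al x) = x by rewrite /mk -cXE pKX.
have al1 x n : (al x n <= 1)%N by have [_ h] := BX x; exact: h.
pose F x x' := E (p x) (p x') /\ al x = al x'.
have sF : structurable K F.
  apply: (structurable_pullback (f := p) _ Euniv.1 mp).
    split.
    - split; first by move=> x; split.
        by move=> x y [h1 h2]; split=> //; exact: Es.
      by move=> x y z [h1 h2] [h3 h4]; split; [exact: Et h1 h3|rewrite h2].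
    - apply: (s_and (meas_sig _)).
        have /mfunP h : measurable_fun setT (fun q : X * X => (p q.1, p q.2)).
          by apply: measurable_fun_pair; apply/mfunP; [exact: (mfun_comp (@mfun_fst _ _ X X) mp)|exact: (mfun_comp (@mfun_snd _ _ X X) mp)].
        exact: h mE.
      by apply: (s_eqN (meas_sig _)); [exact: (mfun_comp (@mfun_fst _ _ X X) mal)|exact: (mfun_comp (@mfun_snd _ _ X X) mal)].
    - move=> x; apply: (countable_inj (f := p) _ _ (cE (p x))) => [x' []//|x1 x2].
      by rewrite !inE => -[_ e1] [_ e2] e3; rewrite -[x1]Kmk -[x2]Kmk e3 -e1 e2.
  move=> x; split.
  - by move=> x' [].
  - by move=> x1 x2; rewrite !inE => -[_ e1] [_ e2] e3; rewrite -[x1]Kmk -[x2]Kmk e3 -e1 e2.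
  - move=> y hy; have [h1 h2] := mkE y (al x) (al1 x).
    by exists (mk y (al x)) => //; split; rewrite ?h1 ?h2.
have [f [[mf _ fr] fi _]] := Euniv.2 _ X F sX sF.
have fi' : injective f by move=> x y; apply: fi; rewrite inE.
exists (fun y a => f (mk y a)); split.
- move=> M bM; rewrite (_ : mkset _ = f @` (al @^-1` M)).
    by apply: (measurable_image hX hc) => //; exact: mal.
  apply/seteqP; split=> [_ [x [a [Ma ha <-]]]|_ [x Mx <-]].
    by exists (mk x a) => //=; have [_ ->] := mkE x a ha.
  by exists (p x), (al x); rewrite Kmk; split.
- move=> a ha; apply/mfunP; apply: (mfun_comp (g := f)); last exact/mfunP.
  apply: (mfun_coded hX); rewrite (_ : cX \o _ = fun y => pairN (c y) a).
    apply: (mfun_pairN (meas_sig Y)) => //.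
    by move=> B' _; exact: (s_const (meas_sig Y)).
  by apply/funext => y; rewrite /= cXE; have [-> ->] := mkE y a ha.
- move=> x a x' a' ha ha' /fi' e1; have [h1 h2] := mkE x a ha; have [h3 h4] := mkE x' a' ha'.
  by split; [rewrite -h1 e1 h3|rewrite -h2 e1 h4].
- move=> a x x' ha; rewrite -fr // /F; have [-> ->] := mkE x a ha; have [-> ->] := mkE x' a ha.
  by split=> [|[]].
Qed.

Lemma null_invariant_copy (mu : probability Y R) : exists A : set Y,
  [/\ measurable A, mu A = 0%E & borel_invariantly_embeds setT E A E].
Proof.
have [F [Fim Fm Fi FE]] := cantor_product.
pose M s := [set y | exists x a, [/\ mkseq a (size s) = s, forall n, (a n <= 1)%N & F x a = y]].
have mM s : measurable (M s) by apply: Fim; exact: (s_mkseq _ _ borelN_sig).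
pose m s : R := fine (mu (M s)).
have m0 s : (0 <= m s)%R by exact: fine_ge0.
have mD s : (m (rcons s 0%N) + m (rcons s 1%N) <= m s)%R.
  have sub b : M (rcons s b) `<=` M s.
    by move=> y [x [a [h1 h2 h3]]]; exists x, a; split=> //; move: h1; rewrite size_rcons mkseqS => /rcons_inj [].
  have dis : M (rcons s 0%N) `&` M (rcons s 1%N) = set0.
    apply/seteqP; split=> // y [[x [a [h1 h2 h3]]] [x' [a' [h1' h2' h3']]]].
    have [_ aa] := Fi _ _ _ _ h2 h2' (etrans h3 (esym h3')); subst a'.
    by move: h1'; rewrite !size_rcons in h1 *; rewrite h1 => /rcons_inj [].
  rewrite -fineD ?fin_num_measure // -measureU //.
  apply: fine_le; rewrite ?fin_num_measure //; first exact: measurableU.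
  apply: le_measure; rewrite ?inE //; first exact: measurableU.
  by move=> y [] /sub.
(* The lighter of the two digits has at most half of the measure. *)
have Hb s : exists b, (b <= 1)%N /\ (m (rcons s b) *+ 2 <= m s)%R.
  have := mD s; case: (leP (m (rcons s 0%N)) (m (rcons s 1%N))) => h1 h2; [exists 0|exists 1]; split=> //; lra.
have [b hb] := choice Hb.
pose t := fix t n := if n is n'.+1 then rcons (t n') (b (t n')) else [::].
pose a n := b (t n).
have ta n : t n = mkseq a n by elim: n => // n IH; rewrite mkseqS -IH.
have a1 n : (a n <= 1)%N := (hb (t n)).1.
pose A := [set y | exists x a', [/\ a' = a, forall n, (a' n <= 1)%N & F x a' = y]].
have mA : measurable A.
  apply: (Fim [set a' | a' = a]); apply: (s_eqN (f := id) (g := fun=> a) borelN_sig) => // B _.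
  exact: (s_const borelN_sig).
have AE y : A y <-> exists x, F x a = y.
  by split=> [[x [_ [-> _ <-]]]|[x <-]]; [exists x|exists x, a].
exists A; split=> //; last first.
  exists (F^~ a); split; first split.
  - exact: Fm.
  - by move=> x _; apply/AE; exists x.
  - by move=> x y _ _; exact: FE.
  - by move=> x y _ _ /Fi [].
  - by move=> y z _ /AE [x <-] _; exists x.
(* Halving gives in particular this linear bound, enough for measure zero by the Archimedean
   property. *)
have bd n : (n.+1%:R * fine (mu A) <= 1 :> R)%R.
  have le1 : (fine (mu A) <= m (t n))%R.
    apply: fine_le; rewrite ?fin_num_measure //; apply: le_measure; rewrite ?inE //.
    by move=> y /AE [x <-]; exists x, a; rewrite ta size_mkseq.
  suff le2 : (n.+1%:R * m (t n) <= 1 :> R)%R.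
    by apply: le_trans le2; apply: ler_wpM2l.
  elim: n {le1} => [|n IH].
    rewrite mul1r; have : (fine (mu (M (t 0))) <= fine (1%:E : \bar R))%R; last by [].
    by apply: fine_le; rewrite ?fin_num_measure //; exact: probability_le1.
  have := (hb (t n)).2; have := m0 (rcons (t n) (b (t n))); move: IH; rewrite /= -!natr1 -/(a n).
  have : (0 <= n%:R :> R)%R by exact: ler0n.
  set u := m (rcons _ _); set w := m (t n); set k := (n%:R)%R => *; nra.
have fA : mu A = (fine (mu A))%:E by rewrite fineK ?fin_num_measure.
rewrite fA; congr (_%:E); have r0 : (0 <= fine (mu A))%R by exact: fine_ge0.
move: (fine _) r0 bd => r r0 bd; apply/eqP; rewrite eq_le r0 andbT leNgt; apply/negP => rpos.
have h1 : (r^-1 < (Num.bound r^-1)%:R)%R by apply: Num.Theory.archi_boundP; rewrite invr_ge0.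
have := bd (Num.bound r^-1); rewrite leNgt => /negP; apply.
rewrite -ltr_pdivrMr // mul1r; apply: lt_trans h1 _; by rewrite ltr_nat.
Qed.
End NullSet.

Theorem theorem1p10 (R : realType) (L : language) (K : set (Lstructure L))
    (K_borel : borel_class K) (K_iso : iso_closed K)
    (d : measure_display) (Y : measurableType d) (Y_std : standard_borel R Y)
    (E : Y -> Y -> Prop) (E_univ : universal_structurable R K E) :
  (forall mu : probability Y R,
     exists A : set Y, [/\ measurable A, mu A = 0%E &
       borel_invariantly_embeds setT E A E])
  /\
  (has_nontrivial_structure K ->
   closed_under_binary_independent_joins R K ->
     (exists U : set (set Y),
        sigma_complete_ultrafilter E U /\ preserves_borel_card E U)
     /\ ~ smooth_disjoint_union_of_smaller E)
  /\
  (closed_under_countable_independent_joins R K ->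
     (forall A : nat -> set Y,
        (forall i, measurable (A i)) -> trivIset setT A ->
        \bigcup_i A i = setT ->
        exists i, borel_embeds setT E (A i) E)
     /\ (forall (d' : measure_display) (X : measurableType d')
           (F : X -> X -> Prop), standard_borel R X -> cber F ->
           borel_reducible setT E setT F -> borel_embeds setT E setT F)).
Proof.
split; first by move=> mu; exact: (null_invariant_copy Y_std E_univ mu).
split=> [ntK cl|cl].
  split; last exact: (not_smooth_union_of_smaller Y_std E_univ ntK cl).
  by have [U [hU hp _]] := borel_card_ultrafilter Y_std E_univ ntK cl; exists U.
have cl' : closed_under_independent_joins R K setT by exact: cl.
split=> [A mA _ cov|d' X F]; last exact: (reducible_embeds Y_std E_univ cl').
apply: (countable_cover_embeds Y_std E_univ cl' mA) => y.
by have : setT y by []; rewrite -cov => -[i _ Ai]; exists i.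
Qed.
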